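(* Let $\varepsilon_n:=\zeta_3\big(\widetilde{\mathrm{B}_{n,\frac12}},\mathrm{N}\big)$ for $n\in\mathbb{N}$. For $P\in\mathcal{P}_3$ and $n\in\mathbb{N}$, we have $$\zeta_3\left(\widetilde{P^{\ast n}},\mathrm{N}\right)\ \le\ \frac{B(\varrho(P))}{6\sqrt n}+\varepsilon_n .$$ On the right, the leading term for $n\to\infty$ is optimal in the sense that $$\frac{B(\rho)}{6}=\lim_{n\to\infty}\sqrt n\,\zeta_3\left(\widetilde{P_\rho^{\ast n}},\mathrm{N}\right)=\sqrt k\left|\widetilde{P_\rho^{\ast k}}f-\mathrm{N}f\right|\quad\text{for }\rho\in[1,\infty[\text{ and }k\in\mathbb{N},$$ where $f(x)=x^3/6$ for $x\in\mathbb{R}$ and $P_\rho\in\mathcal{P}_3$ is the two-point law defined in the context (which satisfies $\varrho(P_\rho)=\rho$); and the leading term for $\rho\to1$ is asymptotically exact in the sense that $$\varepsilon_n=\lim_{P\in\mathcal{P}_3:\ \varrho(P)\to1}\zeta_3\left(\widetilde{P^{\ast n}},\mathrm{N}\right)\quad\text{for }n\in\mathbb{N}.$$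
   Context: $\mathcal{P}_3$ is the set of all probability laws $P$ on $\mathbb{R}$ with $\int|x|^3\,dP(x)<\infty$ and variance $\sigma^2(P)>0$; $\mu(P)$ is the mean. For such $P$, the standardization $\widetilde P$ is the image of $P$ under $x\mapsto (x-\mu(P))/\sigma(P)$, and $\varrho(P):=\int\left|\frac{x-\mu(P)}{\sigma(P)}\right|^3dP(x)\ (\ge1)$. $P^{\ast n}$ is the $n$-th convolution power; $Pf:=\int f\,dP$. $\mathrm{N}$ is the standard normal law on $\mathbb{R}$, and $\mathrm{B}_{n,\frac12}$ is the binomial law with parameters $n$ and $\frac12$. $B(\rho):=\sqrt{\tfrac12\rho^2+\tfrac12\rho\sqrt{\rho^2+8}-2}$ for $\rho\in[1,\infty[$. For $\rho\in[1,\infty[$, $P_\rho$ is the two-point law (of mean 0 and variance 1) with $P_\rho(\{-\sqrt{p/q}\})=q:=1-p$ and $P_\rho(\{\sqrt{q/p}\})=p:=\frac12-\frac12\sqrt{\frac\rho2\sqrt{\rho^2+8}-\frac{\rho^2}2-1}$. Zolotarev distance of order 3: for probability laws $P,Q$ on $\mathbb{R}$, $\zeta_3(P,Q):=\sup_{f\in\mathcal{F}_3^\infty}|Pf-Qf|$, where $\mathcal{F}_3^\infty$ is the set of bounded, twice continuously differentiable functions $f:\mathbb{R}\to\mathbb{R}$ with $|f''(x)-f''(y)|\le|x-y|$ for all $x,y\in\mathbb{R}$. The limit over $P\in\mathcal{P}_3$ with $\varrho(P)\to1$ means: for each $\eta>0$ there is $\delta>0$ such that the quantity is within $\eta$ of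 the limit for every $P\in\mathcal{P}_3$ with $\varrho(P)\le1+\delta$. *)

(* Defs.v *)
From HB Require Import structures.
From mathcomp Require Import all_boot all_order all_algebra.
From mathcomp Require Import all_classical all_reals all_analysis.
From mathcomp Require Import measurable_realfun.

Set Implicit Arguments.
Unset Strict Implicit.
Unset Printing Implicit Defensive.

Import Order.TTheory GRing.Theory Num.Theory.
Import numFieldNormedType.Exports.

Local Open Scope classical_set_scope.
Local Open Scope ring_scope.

Notation law R := (probability (measurableTypeR R) R).

Section moments.
Context {R : realType}.
Implicit Type P : law R.

Definition mean P : R := fine ('E_P[idfun])%E.

Definition stddev P : R := Num.sqrt (fine ('V_P[idfun])%E).

(* The variance is tested in the extended reals; it is finite as soon as the
   third absolute moment is. *)
Definition P3 : set (law R) :=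
  [set P : law R | (\int[P]_x (`|x| ^+ 3)%:E < +oo)%E /\ (0 < 'V_P[idfun])%E].

Definition std_map (m s : R) (x : measurableTypeR R) : measurableTypeR R :=
  (x - m) / s.

Lemma measurable_std_map m s : measurable_fun setT (std_map m s).
Proof. by apply: measurable_funM => //; exact: measurable_funB. Qed.

HB.instance Definition _ m s :=
  isMeasurableFun.Build _ _ _ _ (std_map m s) (measurable_std_map m s).

Definition standardize P : law R :=
  distribution P (std_map (mean P) (stddev P)).

Definition varrho P : R := \int[P]_x (`|(x - mean P) / stddev P| ^+ 3).

End moments.

Section convolution.
Context {R : realType}.

Definition add_map (xy : measurableTypeR R * measurableTypeR R) :
  measurableTypeR R := xy.1 + xy.2.

Lemma measurable_add_map : measurable_fun setT add_map.
Proof. by apply: measurable_funD. Qed.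

HB.instance Definition _ :=
  isMeasurableFun.Build _ _ _ _ add_map measurable_add_map.

Definition conv (P Q : law R) : law R := distribution (P \x Q)%E add_map.

Fixpoint conv_pow (P : law R) (n : nat) : law R :=
  if n is m.+1 then conv (conv_pow P m) P
  else \d_(0 : measurableTypeR R).

End convolution.

Section particular_laws.
Context {R : realType}.

Definition std_normal : law R := normal_prob 0 1.

Definition nat_inj (k : nat) : measurableTypeR R := k%:R.

Lemma measurable_nat_inj : measurable_fun setT nat_inj.
Proof. by []. Qed.

HB.instance Definition _ :=
  isMeasurableFun.Build _ _ _ _ nat_inj measurable_nat_inj.

(* [binomial_prob] lives on [nat]; this is its image on the real line. *)
Definition binomial_half (n : nat) : law R :=
  distribution (binomial_prob n (2^-1 : R)) nat_inj.

Definition p_rho (rho : R) : R :=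
  2^-1 - 2^-1 * Num.sqrt (rho / 2 * Num.sqrt (rho ^+ 2 + 8) - rho ^+ 2 / 2 - 1).

Definition two_points (p : R) (b : bool) : measurableTypeR R :=
  if b then Num.sqrt ((1 - p) / p) else - Num.sqrt (p / (1 - p)).

Lemma measurable_two_points p : measurable_fun setT (two_points p).
Proof. by []. Qed.

HB.instance Definition _ p :=
  isMeasurableFun.Build _ _ _ _ (two_points p) (measurable_two_points p).

(* [bernoulli_prob p] gives mass [p] to [true] and [1 - p] to [false]; note that
   [0 < p_rho rho <= 2^-1] for [1 <= rho]. *)
Definition P_ (rho : R) : law R :=
  distribution (bernoulli_prob (p_rho rho)) (two_points (p_rho rho)).

Definition Bfun (rho : R) : R :=
  Num.sqrt (rho ^+ 2 / 2 + rho / 2 * Num.sqrt (rho ^+ 2 + 8) - 2).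

End particular_laws.

Section zolotarev.
Context {R : realType}.

Definition F3oo : set (R -> R) :=
  [set f : R -> R | [/\ exists M : R, forall x, `|f x| <= M,
               forall x, derivable f x 1,
               forall x, derivable f^`()%classic x 1,
               continuous f^`(2)%classic &
               forall x y, `|f^`(2)%classic x - f^`(2)%classic y| <= `|x - y| ] ].

Definition zeta3 (P Q : law R) : \bar R :=
  ereal_sup [set (`| \int[P]_x f x - \int[Q]_x f x |)%:E | f in F3oo].

Definition eps (n : nat) : \bar R :=
  zeta3 (standardize (binomial_half n)) std_normal.

End zolotarev.

(* Main.v *)
Require Import Defs.
From HB Require Import structures.
From mathcomp Require Import all_boot all_order all_algebra.
From mathcomp Require Import all_classical all_reals all_analysis.
From mathcomp Require Import measurable_realfun ring lra.
Import Order.TTheory GRing.Theory Num.Theory.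
Import numFieldNormedType.Exports.
Local Open Scope classical_set_scope.
Local Open Scope ring_scope.

(* Single summand: let [Q_1] be the Rademacher law and [f] bounded with a [c]-Lipschitz
   second derivative. For a suitable Lagrange multiplier [lam], the mean of
   [f - lam |x|^3] over the standardized two-point laws (atoms [-u] and [1/u]) is maximal
   at some [u], and criticality of [u] says that a quadratic touches [f - lam |x|^3] to
   first order at both atoms. The sign of the third derivative turns it into a majorant,
   so [P f - lam rho(P)] is at most its value at a two-point law, where the trapezoid
   rule gives [|Q_u f - Q_1 f| <= c |1/u - u| / 6]; the convex function expressing the third
   absolute moment through [d = |1/u - u|] has inverse [B]. Hence
   [|P f - Q_1 f| <= c B(rho(P)) / 6], and replacing the summands one by one by Rademacher
   variables multiplies this by [n], while scaling by [sqrt n] divides [c] by [n^(3/2)].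

   Order of [eps n]: replacing Rademacher by Gaussian summands one by one, the [m]
   Gaussians already present smooth the test function at scale [sqrt m]; as the moments
   of order at most three agree, step [m] costs [O(c / sqrt m)], in total [O(1 / n)]. *)

Set Implicit Arguments.
Unset Strict Implicit.
Unset Printing Implicit Defensive.

(** * Differentiable functions *)

(** The Rademacher law is the intermediate target because [Bfun 1 = 0]: the cost of the exchange
    vanishes as the third absolute moment tends to 1, and [eps n] is what remains. Using the
    comparison in both directions then gives the limit for [rho -> 1].

    The one-summand problem is solved by duality. Only mean, variance and third absolute moment are
    fixed, so the majorant has the form quadratic plus [lam * |x|^3]. If the target skewness is
    [d0], then [lam] times the slope at [d0] of the convex moment function has to equal [c / 6]; its
    tangent line then makes the estimate independent of which critical [u] occurs. The slope
    vanishes at 0, so [d0 > 0] is imposed and [B(rho)] is reached as a limit from above.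

    For optimality, [P_rho] has third moment [B(rho)], third moments of centred laws add under
    convolution, and the normal one is 0; hence [x^3 / 6] gives the leading term exactly for every
    [k], while [eps n], being [O(1 / n)], is negligible against [1 / sqrt n]. Since [x^3 / 6] is
    unbounded, it enters [zeta3] only as a limit of rescaled sines. *)

Definition der {R : realType} (f f1 : R -> R) :=
  forall x, is_derive x (1 : R) f (f1 x).

Section der_algebra.
Context {R : realType}.
Implicit Types (f g : R -> R) (a b c x y : R).

(** The rules below produce a derivative in some syntactic shape; this step lets [ring] or [field]
    bring it to the wanted one. *)
Lemma eq_der f f1 g1 : der f f1 -> f1 =1 g1 -> der f g1.
Proof. by move=> df e x; rewrite -e. Qed.

Lemma der_cst c : der (fun=> c) (fun=> 0).
Proof. by move=> x; exact: is_derive_cst. Qed.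

Lemma der_id : der (@idfun R) (fun=> 1).
Proof. by move=> x; exact: is_derive_id. Qed.

Lemma derD f f1 g g1 : der f f1 -> der g g1 ->
  der (fun x => f x + g x) (fun x => f1 x + g1 x).
Proof. by move=> df dg x; apply: is_deriveD. Qed.

Lemma derN f f1 : der f f1 -> der (fun x => - f x) (fun x => - f1 x).
Proof. by move=> df x; apply: is_deriveN. Qed.

Lemma derB f f1 g g1 : der f f1 -> der g g1 ->
  der (fun x => f x - g x) (fun x => f1 x - g1 x).
Proof. by move=> df dg; apply: derD => //; exact: derN. Qed.

Lemma derM f f1 g g1 : der f f1 -> der g g1 ->
  der (fun x => f x * g x) (fun x => f1 x * g x + f x * g1 x).
Proof.
move=> df dg x; apply: is_derive_eq; first exact: is_deriveM.
by rewrite /= /GRing.scale /= addrC [g x * _]mulrC.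
Qed.

Lemma derZ c f f1 : der f f1 -> der (fun x => c * f x) (fun x => c * f1 x).
Proof.
move=> df; apply: eq_der; first by apply: derM; [exact: der_cst|exact: df].
by move=> x /=; ring.
Qed.

Lemma derX n : der (fun x : R => x ^+ n) (fun x => n%:R * x ^+ n.-1).
Proof.
elim: n => [|n IH]; first by move=> x; apply: is_derive_eq; [exact: der_cst|rewrite mul0r].
under [X in der X _]eq_fun do rewrite exprS.
apply: eq_der; first by apply: derM; [exact: der_id|exact: IH].
move=> x /=; case: n {IH} => [|n]; first by rewrite !expr0; ring.
by rewrite /= -natr1 exprS; ring.
Qed.

Lemma der_comp_affine f f1 a b : der f f1 ->
  der (fun x => f (a * x + b)) (fun x => a * f1 (a * x + b)).
Proof.
move=> df x; have dg : is_derive x 1 (fun x => a * x + b) a.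
  have := derD (derZ a der_id) (der_cst b) x.
  by rewrite mulr1 addr0.
have dfg := df (a * x + b).
by have := @is_derive1_comp _ f (fun x => a * x + b) x _ _ dfg dg; rewrite mulrC.
Qed.

Lemma der_continuous f f1 : der f f1 -> continuous f.
Proof.
move=> df x; apply: differentiable_continuous; apply/derivable1_diffP.
by case: (df x).
Qed.

Lemma der_mvt f f1 a b : der f f1 -> a < b ->
  exists2 c, a < c < b & f b - f a = f1 c * (b - a).
Proof.
move=> df ab.
have [||c cab e] := @MVT _ f f1 a b ab; first by move=> x _; exact: df.
  by apply: continuous_subspaceT; exact: der_continuous df.
by exists c => //; move: cab; rewrite in_itv.
Qed.

Lemma der_ge0 f f1 a b : der f f1 -> a <= b ->
  (forall x, a < x < b -> 0 <= f1 x) -> f a <= f b.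
Proof.
move=> df; rewrite le_eqVlt => /predU1P[->//|ab f0].
have [c cab e] := der_mvt df ab.
by rewrite -subr_ge0 e mulr_ge0 ?f0// subr_ge0 ltW.
Qed.

Lemma der_le0 f f1 a b : der f f1 -> a <= b ->
  (forall x, a < x < b -> f1 x <= 0) -> f b <= f a.
Proof.
move=> df ab f0; rewrite -lerN2.
by apply: (der_ge0 (derN df)) => // x /f0; rewrite oppr_ge0.
Qed.

(** The second-difference and sine estimates below all integrate a sign twice from the origin in
    this form. *)
Lemma der2_ge0 f f1 f2 : der f f1 -> der f1 f2 -> f 0 = 0 -> f1 0 = 0 ->
  (forall x, 0 <= x -> 0 <= f2 x) -> forall x, 0 <= x -> 0 <= f x.
Proof.
move=> df df1 f0 f10 f2_ge0 x x0; rewrite -f0; apply: (der_ge0 df) => // y /andP[y0 _].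
rewrite -f10; apply: (der_ge0 df1);  first exact: ltW.
by move=> z /andP[z0 _]; rewrite f2_ge0 ?ltW.
Qed.

(* A remainder bound that is uniform in the base point survives integration, so this
   criterion differentiates under the integral sign. *)
Lemma is_derive_quadratic_bound f c d x :
  (forall h, `|h| <= 1 -> `|f (x + h) - f x - h * d| <= c * h ^+ 2) ->
  is_derive x 1 f d.
Proof.
move=> fc; apply/is_derive1_caratheodory.
pose g z := if z == x then d else (f z - f x) / (z - x).
have gx : g x = d by rewrite /g eqxx.
exists g; split => //.
  move=> z; rewrite /g; case: eqVneq => [->|zx]; first by rewrite !subrr mulr0.
  by rewrite divfK// subr_eq0.
have c0 : 0 <= c by have := fc 1; rewrite normr1 lexx expr1n mulr1 => /(_ isT); apply: le_trans.
apply/cvgrPdist_le => e e0; near=> z; rewrite gx /g.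
case: eqVneq => [_|zx]; first by rewrite subrr normr0 ltW.
have zx0 : z - x != 0 by rewrite subr_eq0.
rewrite -(ler_pM2r (_ : 0 < `|z - x|)) ?normr_gt0// -normrM mulrBl divfK//.
have h1 : `|z - x| <= 1 by rewrite distrC; near: z; exact: cvgr_dist_le.
have h2 : (c + 1) * `|z - x| <= e.
  rewrite -ler_pdivlMl ?ltr_wpDl// distrC; near: z; apply: cvgr_dist_le => //.
  by rewrite mulr_gt0// invr_gt0 ltr_wpDl.
have := fc _ h1; rewrite subrKC -normrN opprB [d * _]mulrC => /le_trans; apply.
rewrite -real_normK ?num_real// expr2 mulrA ler_wpM2r//.
by apply: le_trans h2; rewrite ler_wpM2r// lerDl.
Unshelve. all: end_near. Qed.

(** Averaging over [x + t] and [x - t] removes the odd terms; the second derivative in [t] of the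
    remainder is an average of increments of [f2], bounded by [c * t]. *)
Lemma second_difference_cubic f f1 f2 c x t : der f f1 -> der f1 f2 ->
  (forall y z, `|f2 y - f2 z| <= c * `|y - z|) ->
  `|(f (x + t) + f (x - t)) / 2 - f x - t ^+ 2 / 2 * f2 x| <= c * `|t| ^+ 3 / 6.
Proof.
move=> df df1 f2c.
wlog t0 : t / 0 <= t => [H|].
  have [t0|t0] := leP 0 t; first exact: H.
  by have := H (- t); rewrite oppr_ge0 (ltW t0) opprK normrN sqrrN [f (x - t) + _]addrC => ->.
(* The sign [s] treats both halves of the absolute value at once; the arguments are written
   [1 * t + x] and [-1 * t + x] to match [der_comp_affine]. *)
pose E s t := c * t ^+ 3 / 6 + s * ((f (1 * t + x) + f (-1 * t + x)) / 2 - f x - t ^+ 2 / 2 * f2 x).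
have key s : s = 1 \/ s = -1 -> 0 <= E s t.
  move=> s1; apply: (@der2_ge0 (E s)
    (fun t => c * t ^+ 2 / 2 + s * ((f1 (1 * t + x) - f1 (-1 * t + x)) / 2 - t * f2 x))
    (fun t => c * t + s * ((f2 (1 * t + x) + f2 (-1 * t + x)) / 2 - f2 x))).
  - apply: eq_der; first apply: derD.
    + by apply: derM; [apply: derZ; exact: derX|exact: der_cst].
    + apply: derZ; apply: derB; first (apply: derB; last exact: der_cst).
        apply: derM; last exact: der_cst.
        by apply: derD; exact: der_comp_affine df.
      apply: derM; last exact: der_cst.
      by apply: derM; [exact: derX|exact: der_cst].
    + by move=> y /=; field.
  - apply: eq_der; first apply: derD.
    + by apply: derM; [apply: derZ; exact: derX|exact: der_cst].
    + apply: derZ; apply: derB; last by apply: derM; [exact: der_id|exact: der_cst].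
      apply: derM; last exact: der_cst.
      by apply: derB; exact: der_comp_affine df1.
    + by move=> y /=; field.
  - by rewrite /E !mulr0 !add0r; field.
  - by rewrite !mulr0 !add0r; field.
  - move=> y y0.
    have := f2c (1 * y + x) x; have := f2c (-1 * y + x) x.
    rewrite !addrK mulN1r mul1r normrN (ger0_norm y0) !ler_norml => /andP[a1 a2] /andP[b1 b2].
    by case: s1 => ->; lra.
  - exact: t0.
have := key 1 (or_introl erefl); have := key (-1) (or_intror erefl).
rewrite /E !mul1r !mulN1r (addrC t) (addrC (- t)) ?(ger0_norm t0) => a b.
by rewrite ler_norml; lra.
Qed.

(** A bound on the second differences of [f2] plays the part of a fourth derivative; Gaussian
    smoothing provides exactly such a bound. *)
Lemma second_difference_quartic f f1 f2 L x t : der f f1 -> der f1 f2 ->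
  (forall t, `|f2 (x + t) + f2 (x - t) - 2 * f2 x| <= L * t ^+ 2) ->
  `|(f (x + t) + f (x - t)) / 2 - f x - t ^+ 2 / 2 * f2 x| <= L * t ^+ 4 / 24.
Proof.
move=> df df1 f2c.
wlog t0 : t / 0 <= t => [H|].
  have [t0|t0] := leP 0 t; first exact: H.
  have := H (- t); rewrite oppr_ge0 (ltW t0) opprK sqrrN [f (x - t) + _]addrC.
  by rewrite (_ : (- t) ^+ 4 = t ^+ 4)//; [exact|ring].
pose E s t := L * t ^+ 4 / 24 + s * ((f (1 * t + x) + f (-1 * t + x)) / 2 - f x - t ^+ 2 / 2 * f2 x).
have key s : s = 1 \/ s = -1 -> 0 <= E s t.
  move=> s1; apply: (@der2_ge0 (E s)
    (fun t => L * t ^+ 3 / 6 + s * ((f1 (1 * t + x) - f1 (-1 * t + x)) / 2 - t * f2 x))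
    (fun t => L * t ^+ 2 / 2 + s * ((f2 (1 * t + x) + f2 (-1 * t + x)) / 2 - f2 x))).
  - apply: eq_der; first apply: derD.
    + by apply: derM; [apply: derZ; exact: derX|exact: der_cst].
    + apply: derZ; apply: derB; first (apply: derB; last exact: der_cst).
        apply: derM; last exact: der_cst.
        by apply: derD; exact: der_comp_affine df.
      apply: derM; last exact: der_cst.
      by apply: derM; [exact: derX|exact: der_cst].
    + by move=> y /=; field.
  - apply: eq_der; first apply: derD.
    + by apply: derM; [apply: derZ; exact: derX|exact: der_cst].
    + apply: derZ; apply: derB; last by apply: derM; [exact: der_id|exact: der_cst].
      apply: derM; last exact: der_cst.
      by apply: derB; exact: der_comp_affine df1.
    + by move=> y /=; field.
  - by rewrite /E !mulr0 !add0r; field.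
  - by rewrite !mulr0 !add0r; field.
  - move=> y y0; have := f2c y.
    rewrite ![_ * y]mulrC mulrN1 mulr1 ![_ + x]addrC ler_norml => /andP[a1 a2].
    by case: s1 => ->; lra.
  - exact: t0.
have := key 1 (or_introl erefl); have := key (-1) (or_intror erefl).
rewrite /E !mul1r !mulN1r (addrC t) (addrC (- t)) ?(ger0_norm t0) => a b.
by rewrite ler_norml; lra.
Qed.

End der_algebra.

(** * Two-point laws *)

Section two_point_optimization.
Context {R : realType}.
Implicit Types (f g h : R -> R) (a b c u v w x y : R).

(** The error is at most [h ^+ 2] at every base point, including the kink of the absolute value at
    0. *)
Lemma der_xnormx : der (fun x : R => x * `|x|) (fun x => 2 * `|x|).
Proof.
suff key (x h : R) : `|(x + h) * `|x + h| - x * `|x| - h * (2 * `|x|)| <= 1 * h ^+ 2.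
  by move=> x; apply: (@is_derive_quadratic_bound _ _ 1) => h _; exact: key.
rewrite mul1r ler_norml.
have sx := sqr_ge0 x; have sxh := sqr_ge0 (x + h); have sh := sqr_ge0 h.
have [x0|x0] := ger0P x; have [xh|xh] := ger0P (x + h); apply/andP; split; try lra.
- by have := mulr_ge0_le0 x0 (ltW xh); lra.
- by have := mulr_le0_ge0 (ltW x0) xh; lra.
Qed.

Lemma der_normx3 : der (fun x : R => `|x| ^+ 3) (fun x => 3 * (x * `|x|)).
Proof.
have -> : (fun x : R => `|x| ^+ 3) = (fun x => x * (x * `|x|)).
  apply/funext => x; rewrite mulrA -expr2 -real_normK ?num_real//; ring.
apply: eq_der; first by apply: derM; [exact: der_id|exact: der_xnormx].
by move=> x /=; ring.
Qed.

(** [h1] is convex, so its integral is overestimated by the trapezoid rule; differentiating in the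
    right endpoint reduces this to a comparison of a chord slope with [h2 t]. *)
Lemma trapezoid_convex h h1 h2 a b : der h h1 -> der h1 h2 ->
  {homo h2 : x y / x <= y} -> a <= b ->
  h b - h a <= (b - a) / 2 * (h1 a + h1 b).
Proof.
move=> dh dh1 h2m ab.
pose T t := (t - a) / 2 * (h1 a + h1 t) - (h t - h a).
suff : T a <= T b by rewrite /T !subrr !mul0r subrr subr_ge0.
apply: (@der_ge0 _ T (fun t => (h1 a + h1 t) / 2 + (t - a) / 2 * h2 t - h1 t)).
- apply: eq_der.
    apply: derB; last by apply: derB; [exact: dh|exact: der_cst].
    apply: derM; last by apply: derD; [exact: der_cst|exact: dh1].
    apply: derM; last exact: der_cst.
    by apply: derB; [exact: der_id|exact: der_cst].
  by move=> x /=; field.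
- exact: ab.
move=> t /andP[ta _]; have [s /andP[_ st] e] := der_mvt dh1 ta.
have := h2m _ _ (ltW st); rewrite -(ler_pM2r (_ : 0 < t - a)) ?subr_gt0// => sh.
lra.
Qed.

(** Every two-point law of mean 0 and variance 1 has atoms [- u] and [u^-1] for some [u > 0], with
    these weights. *)
Definition two_point_mean u f : R := (u^-1 * f (- u) + u * f u^-1) / (u + u^-1).

Lemma addrV_gt0 u : 0 < u -> 0 < u + u^-1.
Proof. by move=> u0; rewrite addr_gt0// invr_gt0. Qed.

Let is_deriveM1 f g (x df dg : R) : is_derive x 1 f df -> is_derive x 1 g dg ->
  is_derive x 1 (fun x => f x * g x) (df * g x + f x * dg).
Proof.
move=> Df Dg; apply: (is_derive_eq (is_deriveM Df Dg)).
by rewrite /= /GRing.scale /= addrC [g x * _]mulrC.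
Qed.

(** The numerator is [2 * u^-1] times the error of the trapezoid rule for [f1] between the atoms.
    Its sign gives monotonicity in [u], and its vanishing is the tangency condition for the
    majorant. *)
Lemma is_derive_two_point_mean u f f1 : der f f1 -> 0 < u ->
  is_derive u 1 (two_point_mean ^~ f)
   ((2 * u^-1 * (f u^-1 - f (- u)) - u^-1 * (u + u^-1) * (f1 (- u) + f1 u^-1))
     / (u + u^-1) ^+ 2).
Proof.
move=> df u0.
have un0 : u != 0 by rewrite gt_eqF.
have dV : is_derive u 1 (fun x : R => x^-1) (- u ^- 2).
  have := @is_deriveV _ (fun x : R => x) u 1 1 un0 (der_id u).
  by rewrite /GRing.scale /= mulr1.
have dN : is_derive u 1 (fun x : R => f (- x)) (- f1 (- u)).
  have := der_comp_affine (-1) 0 df u; rewrite addr0 !mulN1r.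
  by under [X in is_derive _ _ X _]eq_fun do rewrite addr0 mulN1r.
have dfV : is_derive u 1 (fun x : R => f x^-1) (f1 u^-1 * - u ^- 2).
  by have := @is_derive1_comp _ f (fun x => x^-1) u _ _ (df _) dV.
have dden : is_derive u 1 (fun x : R => x + x^-1) (1 + - u ^- 2).
  exact: (is_deriveD (der_id u) dV).
have n0 : u + u^-1 != 0 by rewrite gt_eqF ?addrV_gt0.
have diden : is_derive u 1 (fun x : R => (x + x^-1)^-1)
    (- (u + u^-1) ^- 2 * (1 + - u ^- 2)).
  exact: (@is_deriveV _ (fun x : R => x + x^-1) u _ _ n0 dden).
have dnum := is_deriveD (is_deriveM1 dV dN) (is_deriveM1 (der_id u) dfV).
apply: (is_derive_eq (is_deriveM1 dnum diden)).
rewrite fctE /=.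
field; rewrite un0 /= gt_eqF//.
by have := sqr_ge0 u; lra.
Qed.

Lemma two_point_mean_nincr h h1 h2 u w : der h h1 -> der h1 h2 ->
  {homo h2 : x y / x <= y} -> 0 < u -> u <= w ->
  two_point_mean w h <= two_point_mean u h.
Proof.
move=> dh dh1 h2m u0; rewrite le_eqVlt => /predU1P[->//|uw].
pose D (u : R) := ((2 * u^-1 * (h u^-1 - h (- u)) - u^-1 * (u + u^-1) * (h1 (- u) + h1 u^-1))
     / (u + u^-1) ^+ 2).
have dQ x : 0 < x -> is_derive x 1 (two_point_mean ^~ h) (D x).
  exact: is_derive_two_point_mean.
have [x||c cuw e] := @MVT _ (two_point_mean ^~ h) D u w uw.
- by rewrite in_itv/= => /andP[ux _]; apply: dQ; exact: lt_trans ux.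
- apply: derivable_within_continuous => x; rewrite in_itv/= => /andP[ux _].
  by have [] := dQ x (lt_le_trans u0 ux).
rewrite -subr_le0 e mulr_le0_ge0 ?subr_ge0 ?(ltW uw)//.
have c0 : 0 < c by move: cuw; rewrite in_itv/= => /andP[uc _]; exact: lt_trans uc.
have ci : 0 < c^-1 by rewrite invr_gt0.
rewrite /D mulr_le0_ge0 ?invr_ge0 ?sqr_ge0//.
have := @trapezoid_convex h h1 h2 (- c) c^-1 dh dh1 h2m; rewrite opprK => t.
have /t{}t : - c <= c^-1 by rewrite (@le_trans _ _ 0) ?oppr_le0 ?ltW.
rewrite (_ : _ - _ = c^-1 * (2 * (h c^-1 - h (- c)) - (c^-1 + c) * (h1 (- c) + h1 c^-1))); last ring.
by apply: mulr_ge0_le0; [exact: ltW|lra].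
Qed.

Lemma two_point_mean1 f : two_point_mean 1 f = (f 1 + f (-1)) / 2.
Proof. by rewrite /two_point_mean invr1 !mul1r addrC. Qed.

(** Adding [c / 6 * x ^+ 3] to [f] or [- f] makes the second derivative nondecreasing, hence the
    mean monotone in [u]. The cube has mean [u^-1 - u], which vanishes at the Rademacher parameter
    [u = 1]. *)
Lemma two_point_mean_rademacher f f1 f2 c u : der f f1 -> der f1 f2 ->
  (forall x y, `|f2 x - f2 y| <= c * `|x - y|) -> 0 < u ->
  `|two_point_mean u f - (f 1 + f (-1)) / 2| <= c * `|u^-1 - u| / 6.
Proof.
move=> df df1 f2c u0; have ui0 : 0 < u^-1 by rewrite invr_gt0.
pose h s x := c / 6 * x ^+ 3 + s * f x.
have hQ s w : 0 < w -> two_point_mean w (h s) =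
    c / 6 * (w^-1 - w) + s * two_point_mean w f.
  move=> w0; rewrite /two_point_mean /h; field.
  by have := sqr_ge0 w => ?; rewrite !gt_eqF//=; lra.
have mono s w1 w2 : s = 1 \/ s = -1 -> 0 < w1 -> w1 <= w2 ->
    two_point_mean w2 (h s) <= two_point_mean w1 (h s).
  move=> s1; apply: (@two_point_mean_nincr (h s)
    (fun x => c / 2 * x ^+ 2 + s * f1 x) (fun x => c * x + s * f2 x)).
  - apply: eq_der; first by apply: derD; apply: derZ; [exact: derX|exact: df].
    by move=> x /=; field.
  - apply: eq_der; first by apply: derD; apply: derZ; [exact: derX|exact: df1].
    by move=> x /=; field.
  - move=> x y xy; have := f2c x y; rewrite (ler0_norm (_ : x - y <= 0)) ?subr_le0//.
    by rewrite ler_norml => /andP[a b]; case: s1 => ->; lra.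
have c0 : 0 <= c.
  by have := f2c 1 0; rewrite subr0 normr1 mulr1; apply: le_trans.
rewrite -two_point_mean1 ler_norml.
have [u1|u1] := leP u 1.
  have := mono 1 _ _ (or_introl erefl) u0 u1; have := mono (-1) _ _ (or_intror erefl) u0 u1.
  rewrite !hQ// invr1 ger0_norm; last by rewrite subr_ge0 (le_trans u1)// -invr1 lef_pV2// posrE.
  by move=> a b; apply/andP; split; lra.
have := mono 1 _ _ (or_introl erefl) ltr01 (ltW u1).
have := mono (-1) _ _ (or_intror erefl) ltr01 (ltW u1).
rewrite !hQ// invr1 ler0_norm; first by move=> a b; apply/andP; split; lra.
by rewrite subr_le0 (le_trans _ (ltW u1))// invf_le1// ltW.
Qed.

End two_point_optimization.

(** * Quadratic majorants and the third absolute moment of two-point laws *)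

Section quadratic_majorants.
Context {R : realType}.
Implicit Types (f g h : R -> R) (a b c d u v w x y : R).

(* The difference [r] of the quadratic and [g] has a strictly V-shaped second
   derivative. Two double zeros of [r] force a third zero of [r'] between them,
   hence two zeros of [r''], and these determine all the signs. *)
Lemma quadratic_majorant g g1 g2 u v : 0 < u -> 0 < v -> der g g1 -> der g1 g2 ->
  (forall x y, 0 <= x -> x < y -> g2 y < g2 x) ->
  (forall x y, y <= 0 -> x < y -> g2 x < g2 y) ->
  (u + v) * (g1 (- u) + g1 v) = 2 * (g v - g (- u)) ->
  exists k, forall x, g x <=
    g (- u) + (g v - g (- u)) / (u + v) * (x + u) + k * ((x + u) * (x - v)).
Proof.
move=> u0 v0 dg dg1 g2d g2i crit.
set l := _ / (u + v); have uv0 : 0 < u + v by rewrite addr_gt0.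
have uvn0 : u + v != 0 by rewrite gt_eqF.
(* [k] gives the quadratic the slope of [g] at [v]; the hypothesis [crit] then forces equal slopes
   at [- u]. *)
pose k := (g1 v - l) / (u + v); exists k => x; rewrite -subr_ge0.
have lE : l * (u + v) = g v - g (- u) by rewrite divfK.
have kE : k * (u + v) = g1 v - l by rewrite divfK.
have g1uE : g1 (- u) = l - k * (u + v).
  by apply: (mulfI uvn0); move: crit; rewrite -lE kE; lra.
pose r x := g (- u) + l * (x + u) + k * ((x + u) * (x - v)) - g x.
pose r1 x := l + k * (2 * x + u - v) - g1 x.
pose r2 x := 2 * k - g2 x.
have dr : der r r1.
  apply: eq_der.
    apply: derB; last exact: dg.
    apply: derD; first (apply: derD; first exact: der_cst).
      by apply: derZ; apply: derD; [exact: der_id|exact: der_cst].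
    by apply: derZ; apply: derM; [apply: derD|apply: derB];
      (exact: der_id || exact: der_cst).
  by move=> y /=; rewrite /r1; ring.
have dr1 : der r1 r2.
  apply: eq_der.
    apply: derB; last exact: dg1.
    apply: derD; first exact: der_cst.
    apply: derZ; apply: derB; last exact: der_cst.
    by apply: derD; last exact: der_cst; apply: derZ; exact: der_id.
  by move=> y /=; rewrite /r2; ring.
have ru : r (- u) = 0 by rewrite /r addNr; ring.
have rv : r v = 0 by rewrite /r subrr mulr0 mulr0 addr0 addrC [v + u]addrC lE; ring.
have r1u : r1 (- u) = 0 by rewrite /r1 g1uE; ring.
have r1v : r1 v = 0 by rewrite /r1 (_ : 2 * v + u - v = u + v) ?kE; ring.
have r2i y z : 0 <= y -> y < z -> r2 y < r2 z.
  by move=> y0 yz; rewrite /r2 ltrD2l ltrN2 g2d.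
have r2d y z : z <= 0 -> y < z -> r2 z < r2 y.
  by move=> z0 yz; rewrite /r2 ltrD2l ltrN2 g2i.
have zero_between h h1 s t : der h h1 -> s < t -> h s = 0 -> h t = 0 ->
    exists2 m, s < m < t & h1 m = 0.
  move=> dh st hs ht; have [m mst] := der_mvt dh st.
  rewrite hs ht subrr => /esym/eqP; rewrite mulf_eq0 subr_eq0 (gt_eqF st) orbF => /eqP.
  by exists m.
have nuv : - u < v by rewrite (lt_trans _ v0)// oppr_lt0.
have [m /andP[um mv] r1m] := zero_between _ _ _ _ dr nuv ru rv.
have [s /andP[us sm] r2s] := zero_between _ _ _ _ dr1 um r1u r1m.
have [t /andP[mt tv] r2t] := zero_between _ _ _ _ dr1 mv r1m r1v.
have st := lt_trans sm mt.
have s0 : s <= 0.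
  by rewrite leNgt; apply/negP => s0; have := r2i _ _ (ltW s0) st; rewrite r2s r2t ltxx.
have t0 : 0 <= t.
  by rewrite leNgt; apply/negP => t0; have := r2d _ _ (ltW t0) st; rewrite r2s r2t ltxx.
have r2_ge0l y : y <= s -> 0 <= r2 y.
  rewrite le_eqVlt => /predU1P[->|ys]; first by rewrite r2s.
  by rewrite -r2s; exact: (ltW (r2d _ _ s0 ys)).
have r2_ge0r y : t <= y -> 0 <= r2 y.
  rewrite le_eqVlt => /predU1P[<-|ty]; first by rewrite r2t.
  by rewrite -r2t; exact: (ltW (r2i _ _ t0 ty)).
have r2_le0 y : s <= y <= t -> r2 y <= 0.
  move=> /andP[]; rewrite (le_eqVlt s) (le_eqVlt y) => /predU1P[<-|sy]; first by rewrite r2s.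
  move=> /predU1P[->|yt]; first by rewrite r2t.
  have [y0|/ltW y0] := leP y 0; first by rewrite -r2s; exact: (ltW (r2d _ _ y0 sy)).
  by rewrite -r2t; exact: (ltW (r2i _ _ y0 yt)).
have r1_le y : y <= - u -> r1 y <= 0.
  move=> yu; rewrite -r1u; apply: (der_ge0 dr1) => // z /andP[_ zu].
  by apply: r2_ge0l; rewrite ltW// (lt_trans zu).
have r1_ge y : v <= y -> 0 <= r1 y.
  move=> vy; rewrite -r1v; apply: (der_ge0 dr1) => // z /andP[vz _].
  by apply: r2_ge0r; rewrite ltW// (lt_trans tv).
have r1_l y : - u <= y <= m -> 0 <= r1 y.
  move=> /andP[uy ym]; have [ys|/ltW sy] := leP y s.
    rewrite -r1u; apply: (der_ge0 dr1) => // z /andP[_ zy].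
    by apply: r2_ge0l; rewrite (le_trans (ltW zy)).
  rewrite -r1m; apply: (der_le0 dr1) => // z /andP[yz zm].
  by apply: r2_le0; rewrite (le_trans sy (ltW yz)) (le_trans (ltW zm) (ltW mt)).
have r1_r y : m <= y <= v -> r1 y <= 0.
  move=> /andP[my yv]; have [yt|/ltW ty] := leP y t.
    rewrite -r1m; apply: (der_le0 dr1) => // z /andP[mz zy].
    by apply: r2_le0; rewrite (le_trans (ltW sm) (ltW mz)) (le_trans (ltW zy)).
  rewrite -r1v; apply: (der_ge0 dr1) => // z /andP[yz _].
  by apply: r2_ge0r; rewrite (le_trans ty (ltW yz)).
rewrite -/(r x); have [xu|ux] := leP x (- u).
  rewrite -ru; apply: (der_le0 dr) => // z /andP[_ zu].
  by apply: r1_le; exact: ltW.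
have [xm|mx] := leP x m.
  rewrite -ru; apply: (der_ge0 dr); first exact: ltW.
  by move=> z /andP[uz zx]; apply: r1_l; rewrite !ltW// (lt_le_trans zx).
have [xv|vx] := leP x v.
  rewrite -rv; apply: (der_le0 dr) => // z /andP[xz zv].
  by apply: r1_r; rewrite !ltW// (lt_trans mx).
rewrite -rv; apply: (der_ge0 dr); first exact: ltW.
by move=> z /andP[vz _]; apply: r1_ge; exact: ltW.
Qed.

(** Third absolute moment of the standardized two-point law with absolute skewness [d], that is
    [d = |u^-1 - u|] and [sqrt (d^2 + 4) = u + u^-1]. *)
Definition two_point_mom3 d : R := (d ^+ 2 + 2) / Num.sqrt (d ^+ 2 + 4).

(** The derivative of [two_point_mom3]. *)
Definition two_point_slope d : R :=
  d * (d ^+ 2 + 6) / Num.sqrt (d ^+ 2 + 4) ^+ 3.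

Lemma sqr4D_gt0 d : 0 < d ^+ 2 + 4.
Proof. by rewrite ltr_wpDl ?sqr_ge0. Qed.

Lemma two_point_slope_gt0 d : 0 < d -> 0 < two_point_slope d.
Proof.
by move=> d0; rewrite divr_gt0 ?mulr_gt0 ?exprn_gt0 ?sqrtr_gt0 ?sqr4D_gt0// ltr_wpDl ?sqr_ge0.
Qed.

(** This makes the multiplier exceed [c / 6], so that [- lam * |x|^3] dominates [f] in the second
    derivative and yields the V shape required by [quadratic_majorant]. *)
Lemma two_point_slope_lt1 d : 0 < d -> two_point_slope d < 1.
Proof.
move=> d0; have w0 : 0 < Num.sqrt (d ^+ 2 + 4) by rewrite sqrtr_gt0 sqr4D_gt0.
have w2 : Num.sqrt (d ^+ 2 + 4) ^+ 2 = d ^+ 2 + 4 by rewrite sqr_sqrtr// ltW// sqr4D_gt0.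
rewrite /two_point_slope ltr_pdivrMr ?exprn_gt0// mul1r.
set w := Num.sqrt _ in w0 w2 *.
have d2 := sqr_ge0 d.
rewrite -(@ltr_pXn2r _ 2) ?nnegrE//; first last.
- by rewrite exprn_ge0// ltW.
- by rewrite mulr_ge0 ?(ltW d0)//; lra.
by rewrite -exprM mulnC exprM w2; lra.
Qed.

(** Convexity in the form of a support line. Both sides of the cleared inequality are nonnegative;
    after squaring, their difference is [(d - d0) ^+ 2] times a polynomial with nonnegative
    coefficients. *)
Lemma two_point_mom3_tangent d0 d : 0 < d0 -> 0 <= d ->
  two_point_mom3 d0 + two_point_slope d0 * (d - d0) <= two_point_mom3 d.
Proof.
move=> d00 d_ge0; rewrite /two_point_mom3 /two_point_slope.
have w0 x : 0 < Num.sqrt (x ^+ 2 + 4) by rewrite sqrtr_gt0 sqr4D_gt0.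
have w2 x : Num.sqrt (x ^+ 2 + 4) ^+ 2 = x ^+ 2 + 4 by rewrite sqr_sqrtr// ltW// sqr4D_gt0.
move: (w0 d) (w0 d0) (w2 d) (w2 d0); set w := Num.sqrt (d ^+ 2 + 4); set z := Num.sqrt _.
move=> w_gt0 z_gt0 wE zE; set S := d0 * (d0 ^+ 2 + 6).
have S0 : 0 <= S by rewrite mulr_ge0 ?(ltW d00)// addr_ge0 ?sqr_ge0.
(* The constant is [(d0 ^+ 2 + 2) * z ^+ 2 - S * d0], which collapses to 8. *)
have -> : (d0 ^+ 2 + 2) / z + S / z ^+ 3 * (d - d0) = (8 + S * d) / z ^+ 3.
  have -> : 8 + S * d = (d0 ^+ 2 + 2) * z ^+ 2 + S * (d - d0) by rewrite zE /S; ring.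
  by field; rewrite gt_eqF.
rewrite ler_pdivrMr ?exprn_gt0// [_ / w * _]mulrAC ler_pdivlMr//.
have a0 : 0 <= (8 + S * d) * w by rewrite mulr_ge0 ?(ltW w_gt0)// addr_ge0// mulr_ge0.
have b0 : 0 <= (d ^+ 2 + 2) * z ^+ 3.
  by rewrite mulr_ge0 ?exprn_ge0 ?(ltW z_gt0)// addr_ge0 ?sqr_ge0.
rewrite -(@ler_pXn2r _ 2) ?nnegrE// -subr_ge0.
have -> : ((8 + S * d) * w) ^+ 2 = (8 + S * d) ^+ 2 * (d ^+ 2 + 4) by rewrite -wE; ring.
have -> : ((d ^+ 2 + 2) * z ^+ 3) ^+ 2 = (d ^+ 2 + 2) ^+ 2 * (d0 ^+ 2 + 4) ^+ 3.
  by rewrite -zE; ring.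
have -> : (d ^+ 2 + 2) ^+ 2 * (d0 ^+ 2 + 4) ^+ 3 - (8 + S * d) ^+ 2 * (d ^+ 2 + 4)
   = (d - d0) ^+ 2 * ((12 * d0 ^+ 2 + 64) * d ^+ 2
       + (8 * d0 ^+ 3 + 32 * d0) * d + (4 * d0 ^+ 4 + 48 * d0 ^+ 2 + 192)) by rewrite /S; ring.
have d00' := ltW d00; rewrite mulr_ge0 ?sqr_ge0// !addr_ge0// mulr_ge0 ?exprn_ge0//.
- by rewrite addr_ge0// mulr_ge0 ?exprn_ge0.
- by rewrite addr_ge0 ?mulr_ge0 ?exprn_ge0.
Qed.

Lemma two_point_mean_normx3 u : 0 < u ->
  two_point_mean u (fun x => `|x| ^+ 3) = two_point_mom3 `|u^-1 - u|.
Proof.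
move=> u0; rewrite /two_point_mean /two_point_mom3 normrN (gtr0_norm u0) (gtr0_norm (_ : 0 < u^-1)) ?invr_gt0//.
have un0 : u != 0 by rewrite gt_eqF.
rewrite real_normK ?num_real// (_ : (u^-1 - u) ^+ 2 + 4 = (u + u^-1) ^+ 2); last by field.
rewrite sqrtr_sqr gtr0_norm ?addrV_gt0//; congr (_ / _); by field.
Qed.

End quadratic_majorants.

Section cubic_majorants.
Context {R : realType}.
Implicit Types (f g h : R -> R) (a b c d u v w x y : R).

Lemma two_point_mean_le f M u : (forall x, `|f x| <= M) -> 0 < u ->
  `|two_point_mean u f| <= M.
Proof.
move=> fM u0; have ui : 0 < u^-1 by rewrite invr_gt0.
rewrite /two_point_mean normrM normfV (gtr0_norm (addrV_gt0 u0)) ler_pdivrMr ?addrV_gt0//.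
rewrite (le_trans (ler_normD _ _))// !normrM (gtr0_norm u0) (gtr0_norm ui) mulrDr addrC.
by rewrite ![M * _]mulrC lerD// ler_pM2l.
Qed.

(** Coercivity: the penalty grows at both ends of the parameter range and there outweighs the
    bounded function. *)
Lemma two_point_mom3_ge u : 0 < u -> (u + u^-1) / 2 <= two_point_mom3 `|u^-1 - u|.
Proof.
move=> u0; rewrite -two_point_mean_normx3// /two_point_mean normrN.
have ui : 0 < u^-1 by rewrite invr_gt0.
rewrite (gtr0_norm u0) (gtr0_norm ui) ler_pdivlMr ?addrV_gt0//.
have -> : u^-1 * u ^+ 3 + u * u^-1 ^+ 3 = u ^+ 2 + u^-1 ^+ 2 by field; rewrite gt_eqF.
by have := sqr_ge0 (u - u^-1); lra.
Qed.

Lemma two_point_meanB f g c u : two_point_mean u (fun x => f x - c * g x) =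
  two_point_mean u f - c * two_point_mean u g.
Proof. by rewrite /two_point_mean; ring. Qed.

(* Penalizing by [lam * `|x| ^+ 3] makes the mean over the two-point laws attain
   its maximum at an interior parameter [u]. *)
Lemma two_point_mean_critical f f1 M lam : der f f1 -> (forall x, `|f x| <= M) ->
  0 < lam ->
  let g x := f x - lam * `|x| ^+ 3 in
  let g1 x := f1 x - lam * (3 * (x * `|x|)) in
  exists2 u, 0 < u & (u + u^-1) * (g1 (- u) + g1 u^-1) = 2 * (g u^-1 - g (- u)).
Proof.
move=> df fM lam0 g g1.
have M0 : 0 <= M by exact: le_trans (fM 0).
have dg : der g g1 by apply: derB; [exact: df|apply: derZ; exact: der_normx3].
(* The first term of [T] makes [M - lam * T / 2] equal to [- M - lam], a lower bound for [Phi 1];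
   the added 1 makes the comparison strict. Since [u + u^-1] exceeds [T] at both endpoints, the
   maximum over the interval is interior. *)
pose Phi := two_point_mean ^~ g; pose T := 2 * (2 * M + lam) / lam + 1.
have T1 : 1 < T by rewrite ltrDr mulr_gt0 ?invr_gt0 ?mulr_gt0 ?ltr_wpDl ?mulr_ge0.
have T0 : 0 < T := lt_trans ltr01 T1.
have TiT : T^-1 < T by rewrite (lt_trans _ T1)// invf_lt1.
have dPhi u : 0 < u -> is_derive u 1 Phi _ := is_derive_two_point_mean dg.
have ubPhi u : 0 < u -> Phi u <= M - lam * ((u + u^-1) / 2).
  move=> u0; rewrite /Phi two_point_meanB two_point_mean_normx3// lerB//.
    by rewrite (le_trans (ler_norm _))// two_point_mean_le.
  by rewrite ler_pM2l// two_point_mom3_ge.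
have lbPhi : - M - lam <= Phi 1.
  have e1 : two_point_mean 1 (fun x : R => `|x| ^+ 3) = 1.
    by rewrite two_point_mean1 normrN normr1 expr1n divff.
  rewrite /Phi two_point_meanB e1 mulr1 lerB//.
  by have := two_point_mean_le fM ltr01; rewrite ler_norml => /andP[].
have edge u : 0 < u -> T < u + u^-1 -> Phi u < Phi 1.
  move=> u0 Tu; apply: le_lt_trans (ubPhi _ u0) _; apply: lt_le_trans lbPhi.
  have : lam * T < lam * (u + u^-1) by rewrite ltr_pM2l.
  rewrite {1}/T mulrDr mulr1 mulrCA divff ?gt_eqF// mulr1; lra.
have pos u : u \in `[T^-1, T] -> 0 < u.
  by rewrite in_itv => /andP[+ _]; apply: lt_le_trans; rewrite invr_gt0.
have [|u uT umax] := @EVT_max _ Phi T^-1 T (ltW TiT).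
  by apply: derivable_within_continuous => u /pos u0; have [] := dPhi u u0.
have u0 := pos _ uT; exists u => //.
have one : (1 : R) \in `[T^-1, T] by rewrite in_itv/= invf_le1// (ltW T1).
have u_int : u \in `]T^-1, T[.
  have ne : T < u + u^-1 -> False.
    by move=> /(edge _ u0); rewrite ltNge umax.
  move: uT; rewrite !in_itv/= !le_eqVlt => /andP[/predU1P[uE|->] /predU1P[uE'|->]] //.
  - by exfalso; apply: ne; rewrite -uE invrK ltrDr invr_gt0.
  - by exfalso; apply: ne; rewrite -uE invrK ltrDr invr_gt0.
  - by exfalso; apply: ne; rewrite uE' ltrDl invr_gt0.
have d0 : is_derive u 1 Phi 0.
  apply: (@derive1_at_max _ Phi T^-1 T u (ltW TiT)) => // t tT.
    have t0 : 0 < t by apply: pos; apply: subset_itv_oo_cc.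
    by have [] := dPhi t t0.
  by apply: umax; apply: subset_itv_oo_cc.
have := @derive_val _ _ _ _ _ _ _ (dPhi u u0); rewrite (@derive_val _ _ _ _ _ _ _ d0).
move=> /esym/eqP; rewrite mulf_eq0 invr_eq0 expf_eq0/= [u + u^-1 == 0]gt_eqF ?addrV_gt0// orbF.
rewrite subr_eq0 => /eqP e.
have ui : u^-1 != 0 by rewrite gt_eqF ?invr_gt0.
by apply: (mulfI ui); rewrite mulrA -e; ring.
Qed.

(** Under a standardized law the majorant integrates to [a + k] plus [lam] times the third absolute
    moment, so the last bound settles all such laws with third absolute moment at most
    [two_point_mom3 d0]. *)
Lemma cubic_majorant f f1 f2 c M d0 : der f f1 -> der f1 f2 ->
  (forall x y, `|f2 x - f2 y| <= c * `|x - y|) -> (forall x, `|f x| <= M) ->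
  0 < c -> 0 < d0 ->
  exists a b k lam, [/\ 0 < lam,
    forall x, f x <= a + b * x + k * x ^+ 2 + lam * `|x| ^+ 3 &
    a + k + lam * two_point_mom3 d0 <= (f 1 + f (-1)) / 2 + c * d0 / 6].
Proof.
move=> df df1 f2c fM c0 d00.
have s0 := two_point_slope_gt0 d00; have s1 := two_point_slope_lt1 d00.
set s := two_point_slope d0 in s0 s1.
(* With [lam * s = c / 6], moving from [d0] to the unknown skewness changes the penalty along the
   tangent by exactly the change of the trapezoid bound. *)
pose lam := c / (6 * s); have lam0 : 0 < lam by apply: divr_gt0 => //; exact: mulr_gt0.
have lamE : 6 * lam * s = c by rewrite /lam; field; rewrite gt_eqF.
have lamc : c < 6 * lam by have := mulr_gt0 lam0 (_ : 0 < 1 - s); rewrite subr_gt0 => /(_ s1); lra.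
have [u u0 crit] := two_point_mean_critical df fM lam0.
have ui : 0 < u^-1 by rewrite invr_gt0.
pose g x := f x - lam * `|x| ^+ 3.
have dg : der g (fun x => f1 x - lam * (3 * (x * `|x|))).
  by apply: derB; [exact: df|apply: derZ; exact: der_normx3].
have dg1 : der (fun x => f1 x - lam * (3 * (x * `|x|))) (fun x => f2 x - lam * (6 * `|x|)).
  apply: eq_der.
    by apply: derB; [exact: df1|apply: derZ; apply: derZ; exact: der_xnormx].
  by move=> x /=; ring.
have step x y : x < y -> `|f2 y - f2 x| < 6 * lam * (y - x).
  move=> xy; have := f2c y x; rewrite (gtr0_norm (_ : 0 < y - x)) ?subr_gt0// => /le_lt_trans; apply.
  by rewrite ltr_pM2r ?subr_gt0.
have [||k gk] := quadratic_majorant u0 ui dg dg1 _ _ crit.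
- move=> x y x0 xy; rewrite !ger0_norm//; last by rewrite (le_trans x0)// ltW.
  by have := step _ _ xy; rewrite ltr_norml => /andP[_]; lra.
- move=> x y y0 xy; rewrite !ler0_norm//; last by rewrite (le_trans _ y0)// ltW.
  by have := step _ _ xy; rewrite ltr_norml => /andP[+ _]; lra.
set l := _ / (u + u^-1) in gk.
exists (g (- u) + l * u - k), (l + k * (u - u^-1)), k, lam; split => //.
  move=> x; have := gk x.
  have -> : (x + u) * (x - u^-1) = x ^+ 2 + (u - u^-1) * x - 1 by field; rewrite gt_eqF.
  have : f x = g x + lam * `|x| ^+ 3 by rewrite /g subrK.
  by lra.
(* The quadratic agrees with [g] at both atoms, so its mean [a + k] is the two-point mean of [g]. *)
have -> : g (- u) + l * u - k + k = two_point_mean u g.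
  rewrite /two_point_mean /l -/(g _) -/(g _); field.
  by have := sqr_ge0 u => ?; rewrite !gt_eqF//=; lra.
rewrite two_point_meanB two_point_mean_normx3//.
have := two_point_mean_rademacher df df1 f2c u0; rewrite ler_norml => /andP[_ fR].
have : lam * (two_point_mom3 d0 + s * (`|u^-1 - u| - d0)) <= lam * two_point_mom3 `|u^-1 - u|.
  by rewrite ler_pM2l// two_point_mom3_tangent.
have -> : lam * (two_point_mom3 d0 + s * (`|u^-1 - u| - d0)) =
   lam * two_point_mom3 d0 + c * (`|u^-1 - u| - d0) / 6 by rewrite -lamE; field.
lra.
Qed.

End cubic_majorants.

(** * The function [B] as inverse of the moment function, and the parameter of [P_rho] *)

Section inverse_of_two_point_mom3.
Context {R : realType}.
Implicit Types (a b d rho eta : R).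

Lemma two_point_mom3_lt a b : 0 <= a -> a < b -> two_point_mom3 a < two_point_mom3 b.
Proof.
move=> a0 ab; have b0 := le_lt_trans a0 ab.
have E d : two_point_mom3 d = Num.sqrt (d ^+ 2 + 4) - 2 / Num.sqrt (d ^+ 2 + 4).
  have w0 : Num.sqrt (d ^+ 2 + 4) != 0 by rewrite gt_eqF// sqrtr_gt0 sqr4D_gt0.
  have : d ^+ 2 = Num.sqrt (d ^+ 2 + 4) ^+ 2 - 4.
    by rewrite sqr_sqrtr ?addrK// ltW// sqr4D_gt0.
  by rewrite /two_point_mom3 => {1}->; field.
have lt_sqrt : Num.sqrt (a ^+ 2 + 4) < Num.sqrt (b ^+ 2 + 4).
  by rewrite ltr_sqrt ?sqr4D_gt0// ltrD2r ltr_pXn2r// nnegrE ltW.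
by rewrite !E ltrD// ltrN2 ltr_pM2l// ltf_pV2// posrE sqrtr_gt0 sqr4D_gt0.
Qed.

Lemma two_point_mom3_0 : two_point_mom3 0 = 1 :> R.
Proof.
by rewrite /two_point_mom3 expr0n/= !add0r (_ : 4 = 2 ^+ 2) ?sqrtr_sqr ?gtr0_norm ?divff//; ring.
Qed.

(** [Bfun] and [p_rho] depend on [rho] only through [rho ^+ 2] and this term; eliminating its square
    by [sqrT] turns the identities below into polynomial ones. *)
Let T rho : R := rho / 2 * Num.sqrt (rho ^+ 2 + 8).

Let sqrT rho : T rho ^+ 2 = rho ^+ 4 / 4 + 2 * rho ^+ 2.
Proof. by rewrite /T exprMn sqr_sqrtr ?addr_ge0 ?sqr_ge0//; field. Qed.

(** The lower bound makes both radicands nonnegative; the upper one keeps that of [p_rho] below 1,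
    hence [p_rho] positive. *)
Let T_bounds rho : 1 <= rho -> rho ^+ 2 / 2 + 1 <= T rho < rho ^+ 2 / 2 + 2.
Proof.
move=> rho1; have rho0 : 0 <= rho by exact: le_trans rho1.
have T0 : 0 <= T rho by rewrite mulr_ge0 ?divr_ge0.
have r2 : 1 <= rho ^+ 2 by rewrite exprn_ege1.
have e := sqrT rho.
apply/andP; split.
  by rewrite -(@ler_pXn2r _ 2) ?nnegrE// ?e; [lra|lra].
by rewrite -(@ltr_pXn2r _ 2) ?nnegrE// ?e; [lra|lra].
Qed.

Lemma sqr_Bfun rho : 1 <= rho -> Bfun rho ^+ 2 = rho ^+ 2 / 2 + T rho - 2.
Proof.
move=> rho1; rewrite sqr_sqrtr//; have /andP[+ _] := T_bounds rho1.
have : 1 <= rho ^+ 2 by rewrite exprn_ege1.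
by rewrite -/(T rho); lra.
Qed.

Lemma Bfun_ge0 rho : 0 <= Bfun rho. Proof. exact: sqrtr_ge0. Qed.

Lemma two_point_mom3_Bfun rho : 1 <= rho -> two_point_mom3 (Bfun rho) = rho.
Proof.
move=> rho1; have rho0 : 0 <= rho by exact: le_trans rho1.
have w0 := sqr4D_gt0 (Bfun rho).
have sw0 : Num.sqrt (Bfun rho ^+ 2 + 4) != 0 by rewrite gt_eqF// sqrtr_gt0.
apply: (mulIf sw0); rewrite divfK//.
apply/eqP; rewrite -(@eqrXn2 _ 2)//; first last.
- by rewrite mulr_ge0.
- by rewrite addr_ge0 ?sqr_ge0.
rewrite [(rho * _) ^+ 2]exprMn (sqr_sqrtr (ltW w0)) sqr_Bfun//.
have e := sqrT rho; apply/eqP.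
transitivity (rho ^+ 4 / 4 + T rho * rho ^+ 2 + T rho ^+ 2); first by field.
by rewrite e; field.
Qed.

Lemma Bfun_lt_le rho d : 1 <= rho -> Bfun rho < d -> rho <= two_point_mom3 d.
Proof.
by move=> rho1 Bd; rewrite -{1}(two_point_mom3_Bfun rho1) ltW// two_point_mom3_lt// Bfun_ge0.
Qed.

(** [Bfun] inverts an increasing function with value 1 at 0, so [delta] is explicit. *)
Lemma Bfun_near1 eta : 0 < eta ->
  exists2 delta : R, 0 < delta & forall rho, 1 <= rho -> rho <= 1 + delta -> Bfun rho <= eta.
Proof.
move=> eta0; exists (two_point_mom3 eta - 1).
  by rewrite subr_gt0 -two_point_mom3_0 two_point_mom3_lt.
move=> rho rho1; rewrite subrKC => rhod; rewrite leNgt; apply/negP => Bd.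
have := two_point_mom3_lt (ltW eta0) Bd; rewrite two_point_mom3_Bfun//.
by rewrite ltNge rhod.
Qed.

Lemma p_rho_bounds rho : 1 <= rho -> 0 < p_rho rho <= 2^-1.
Proof.
move=> rho1; have /andP[l h] := T_bounds rho1.
have s0 := sqrtr_ge0 (rho / 2 * Num.sqrt (rho ^+ 2 + 8) - rho ^+ 2 / 2 - 1).
have : Num.sqrt (rho / 2 * Num.sqrt (rho ^+ 2 + 8) - rho ^+ 2 / 2 - 1) < 1.
  by rewrite -[ltRHS]sqrtr1 ltr_sqrt//; rewrite -/(T rho); lra.
by rewrite /p_rho => ?; apply/andP; split; lra.
Qed.

(** Places [P_rho] in the family of [two_point_mean]. The identity for the skewness is checked on
    squares, [(1 - 2 * p) ^+ 2 / (p * (1 - p))] being the squared skewness; [p <= 2^-1] fixes the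
    sign. *)
Lemma Bfun_p_rho rho : 1 <= rho -> let u := Num.sqrt (p_rho rho / (1 - p_rho rho)) in
  [/\ 0 < u, u^-1 = Num.sqrt ((1 - p_rho rho) / p_rho rho),
      p_rho rho = u / (u + u^-1) & u^-1 - u = Bfun rho].
Proof.
move=> rho1 u; have /andP[p0 p2] := p_rho_bounds rho1.
set p := p_rho rho in u p0 p2 *.
have q0 : 0 < 1 - p by lra.
have pq0 : 0 < p / (1 - p) by rewrite divr_gt0.
have u0 : 0 < u by rewrite sqrtr_gt0.
have un0 : u != 0 by rewrite gt_eqF.
have uE : u ^+ 2 = p / (1 - p) by rewrite sqr_sqrtr// ltW.
have pE : p = u / (u + u^-1).
  have -> : u / (u + u^-1) = u ^+ 2 / (u ^+ 2 + 1).
    by field; have := sqr_ge0 u => ?; rewrite !gt_eqF//=; lra.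
  by rewrite uE; field; rewrite !gt_eqF// ; lra.
have uV : u^-1 = Num.sqrt ((1 - p) / p) by rewrite /u -sqrtrV ?ltW// invf_div.
split => //.
have u1 : u <= 1.
  by rewrite -[leRHS]sqrtr1 ler_sqrt// ler_pdivrMr//; lra.
apply/eqP; rewrite -(@eqrXn2 _ 2)//; first last.
- exact: Bfun_ge0.
- by rewrite subr_ge0 (le_trans u1)// -invr1 lef_pV2// posrE.
rewrite sqr_Bfun//; have /andP[l h] := T_bounds rho1.
have e := sqrT rho.
have X : (1 - 2 * p) ^+ 2 = T rho - rho ^+ 2 / 2 - 1.
  rewrite /p /p_rho -/(T rho); set X := T rho - _ - 1.
  have -> : (1 - 2 * (2^-1 - 2^-1 * Num.sqrt X)) ^+ 2 = Num.sqrt X ^+ 2 by field.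
  by rewrite sqr_sqrtr// /X; lra.
have -> : (u^-1 - u) ^+ 2 = (1 - 2 * p) ^+ 2 / (p * (1 - p)).
  have -> : (u^-1 - u) ^+ 2 = (u ^+ 2)^-1 + u ^+ 2 - 2 by field.
  by rewrite uE; field; rewrite !gt_eqF.
have -> : p * (1 - p) = (1 - (1 - 2 * p) ^+ 2) / 4 by field.
rewrite X; have Y0 : 1 - (T rho - rho ^+ 2 / 2 - 1) != 0 by rewrite gt_eqF; lra.
apply/eqP; rewrite invf_div mulrA; apply: (mulIf Y0); rewrite divfK//.
transitivity (4 * (T rho - rho ^+ 2 / 2 - 1)); first by ring.
have -> : (rho ^+ 2 / 2 + T rho - 2) * (1 - (T rho - rho ^+ 2 / 2 - 1)) =
  - T rho ^+ 2 + 4 * T rho + rho ^+ 4 / 4 - 4 by field.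
by rewrite e; field.
Qed.

End inverse_of_two_point_mom3.

(** * Integration of functions of cubic growth *)

Section cubic_growth.
Context {R : realType}.
Implicit Types (P Q : law R) (f g : R -> R) (a b c A : R).

Definition third_moment_finite P :=
  P.-integrable [set: measurableTypeR R] (fun x => (`|x| ^+ 3)%:E).

Definition cubic_growth f := measurable_fun [set: R] f /\
  exists A, forall x, `|f x| <= A * (1 + `|x| ^+ 3).

Lemma normx3_ge0 (x : R) : 0 <= `|x| ^+ 3. Proof. by rewrite exprn_ge0. Qed.

Lemma cubic_growth_ge0 f : cubic_growth f ->
  measurable_fun [set: R] f /\ exists2 A, 0 <= A & forall x, `|f x| <= A * (1 + `|x| ^+ 3).
Proof.
move=> [mf [A fA]]; split => //; exists `|A| => // x.
apply: le_trans (fA x) _; rewrite ler_wpM2r ?ler_norm// addr_ge0// normx3_ge0.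
Qed.

Lemma cubic_growth_bounded f M : measurable_fun [set: R] f ->
  (forall x, `|f x| <= M) -> cubic_growth f.
Proof.
move=> mf fM; split => //; exists M => x; apply: le_trans (fM x) _.
by rewrite mulrDr mulr1 lerDl mulr_ge0 ?normx3_ge0// (le_trans _ (fM x)).
Qed.

Lemma cubic_growth_cst c : cubic_growth (fun=> c).
Proof. exact: (@cubic_growth_bounded _ `|c|). Qed.

Lemma cubic_growthD f g : cubic_growth f -> cubic_growth g ->
  cubic_growth (fun x => f x + g x).
Proof.
move=> [mf [A fA]] [mg [B gB]]; split; first exact: measurable_funD.
exists (A + B) => x; apply: le_trans (ler_normD _ _) _.
by rewrite mulrDl lerD.
Qed.

Lemma cubic_growthZ c f : cubic_growth f -> cubic_growth (fun x => c * f x).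
Proof.
move=> [mf [A fA]]; split; first exact: measurable_funM.
by exists (`|c| * A) => x; rewrite normrM -mulrA ler_wpM2l.
Qed.

Lemma cubic_growthB f g : cubic_growth f -> cubic_growth g ->
  cubic_growth (fun x => f x - g x).
Proof.
move=> tf tg; have := cubic_growthD tf (cubic_growthZ (-1) tg).
by under [X in cubic_growth X]eq_fun do rewrite mulN1r.
Qed.

Lemma cubic_growthX n : (n <= 3)%N -> cubic_growth (fun x => x ^+ n).
Proof.
move=> n3; split; first exact: measurable_funX.
exists 1 => x; rewrite mul1r normrX.
have [x1|x1] := leP `|x| 1.
  by rewrite (le_trans (exprn_ile1 _ _ _))// lerDl normx3_ge0.
by rewrite (le_trans (ler_weXn2l (ltW x1) n3))// lerDr.
Qed.

Lemma cubic_growth_id : cubic_growth (fun x => x).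
Proof. exact: (@cubic_growthX 1). Qed.

Lemma cubic_growth_normx3 : cubic_growth (fun x => `|x| ^+ 3).
Proof.
split; first by apply: measurable_funX; exact: normr_measurable.
by exists 1 => x; rewrite mul1r ger0_norm ?normx3_ge0// lerDr.
Qed.

Lemma ler_normD3 (x y : R) : `|x + y| ^+ 3 <= 4 * (`|x| ^+ 3 + `|y| ^+ 3).
Proof.
apply: (@le_trans _ _ ((`|x| + `|y|) ^+ 3)).
  by rewrite ler_pXn2r ?nnegrE ?addr_ge0// ler_normD.
rewrite -subr_ge0.
have -> : 4 * (`|x| ^+ 3 + `|y| ^+ 3) - (`|x| + `|y|) ^+ 3 = 3 * ((`|x| + `|y|) * (`|x| - `|y|) ^+ 2) by ring.
by apply: mulr_ge0 => //; apply: mulr_ge0; [exact: addr_ge0|exact: sqr_ge0].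
Qed.

Lemma cubic_growth_affine f a b : cubic_growth f -> cubic_growth (fun x => f (a * x + b)).
Proof.
move=> /cubic_growth_ge0[mf [A A0 fA]]; split.
  by apply: measurableT_comp => //; apply: measurable_funD => //; exact: measurable_funM.
exists (A * (1 + 4 * `|b| ^+ 3 + 4 * `|a| ^+ 3)) => x.
apply: le_trans (fA _) _; rewrite -mulrA ler_wpM2l//.
have := ler_normD3 (a * x) b; rewrite normrM exprMn.
have := normx3_ge0 x; have := normx3_ge0 a; have := normx3_ge0 b.
move: (`|x| ^+ 3) (`|a| ^+ 3) (`|b| ^+ 3) (`|a * x + b| ^+ 3) => X a3 b3 Y b0 a0 x0 h.
by have := mulr_ge0 b0 x0; lra.
Qed.

Lemma cubic_growth_integrable P f : third_moment_finite P -> cubic_growth f ->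
  P.-integrable [set: measurableTypeR R] (EFin \o f).
Proof.
move=> m3P /cubic_growth_ge0[mf [A A0 fA]].
apply: (@le_integrable _ _ _ P _ measurableT _ (fun x => (A * (1 + `|x| ^+ 3))%:E)).
- exact/measurable_EFinP.
- by move=> x _ /=; rewrite lee_fin (le_trans (fA x))// ler_norm.
- suff : P.-integrable [set: measurableTypeR R]
      (fun x : measurableTypeR R => A%:E * (1%:E + (`|x| ^+ 3)%:E))%E by [].
  apply: integrableZl => //; apply: integrableD => //.
  exact: finite_measure_integrable_cst.
Qed.

Section linearity.
Variable P : law R.
Hypothesis m3P : third_moment_finite P.

Lemma cubic_growth_RintD f g : cubic_growth f -> cubic_growth g ->
  \int[P]_x (f x + g x) = \int[P]_x f x + \int[P]_x g x.
Proof. by move=> tf tg; rewrite RintegralD//; exact: cubic_growth_integrable. Qed.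

Lemma cubic_growth_RintB f g : cubic_growth f -> cubic_growth g ->
  \int[P]_x (f x - g x) = \int[P]_x f x - \int[P]_x g x.
Proof. by move=> tf tg; rewrite RintegralB//; exact: cubic_growth_integrable. Qed.

Lemma cubic_growth_RintZ c f : cubic_growth f -> \int[P]_x (c * f x) = c * \int[P]_x f x.
Proof. by move=> tf; rewrite RintegralZl//; exact: cubic_growth_integrable. Qed.

Lemma cubic_growth_le_Rint f g : cubic_growth f -> cubic_growth g ->
  (forall x, f x <= g x) -> \int[P]_x f x <= \int[P]_x g x.
Proof.
by move=> tf tg fg; apply: le_Rintegral => //; exact: cubic_growth_integrable.
Qed.

Lemma Rint_cst c : \int[P]_x c = c.
Proof. rewrite Rintegral_cst//; have -> : fine (P setT) = 1 by rewrite probability_setT.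
by rewrite mulr1. Qed.

Lemma cubic_growth_Rint_near f g c : cubic_growth f -> cubic_growth g ->
  (forall x, `|f x - g x| <= c) -> `|\int[P]_x f x - \int[P]_x g x| <= c.
Proof.
move=> tf tg fg; rewrite -cubic_growth_RintB// ler_norml; apply/andP; split.
  rewrite -(Rint_cst (- c)); apply: cubic_growth_le_Rint.
  - exact: cubic_growth_cst.
  - exact: cubic_growthB.
  - by move=> x; have := fg x; rewrite ler_norml => /andP[].
rewrite -(Rint_cst c); apply: cubic_growth_le_Rint.
- exact: cubic_growthB.
- exact: cubic_growth_cst.
- by move=> x; have := fg x; rewrite ler_norml => /andP[].
Qed.

End linearity.

Lemma distribution_cubic_growth P (X : {mfun measurableTypeR R >-> measurableTypeR R}) :
  third_moment_finite P -> cubic_growth X ->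
  (exists2 A, 0 <= A & forall x, `|X x| ^+ 3 <= A * (1 + `|x| ^+ 3)) ->
  third_moment_finite (distribution P X) /\
  forall f, cubic_growth f -> \int[distribution P X]_x f x = \int[P]_x f (X x).
Proof.
move=> m3P tX [A A0 XA].
have tf f : cubic_growth f -> cubic_growth (f \o X).
  move=> /cubic_growth_ge0[mf [B B0 fB]]; split.
    exact: (measurableT_comp mf tX.1).
  exists (B * (1 + A)) => x; apply: le_trans (fB _) _; rewrite -mulrA ler_wpM2l//.
  have := XA x; have := normx3_ge0 x.
  by rewrite mulrDl mul1r; lra.
split.
  have t3 := tf _ cubic_growth_normx3.
  have := cubic_growth_integrable m3P t3.
  move=> h; apply: (@integrable_pushforward _ _ _ _ _ X _ P setT) => //.
  by apply/measurable_EFinP; case: cubic_growth_normx3.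
move=> f tf'; rewrite /Rintegral integral_distribution//.
  by apply/measurable_EFinP; case: tf'.
by have := cubic_growth_integrable m3P (tf _ tf').
Qed.

End cubic_growth.

(** * Fubini for convolutions *)

Section convolution_integrals.
Context {R : realType}.
Implicit Types (P Q : law R) (f g : R -> R) (a b c A : R).

(** Serves twice: as the integrability bound on the product, and as the growth bound of the averaged
    function. *)
Lemma cubic_growth_section_le Q f A x : third_moment_finite Q -> cubic_growth f ->
  0 <= A -> (forall x, `|f x| <= A * (1 + `|x| ^+ 3)) ->
  \int[Q]_y `|f (x + y)| <= A * (1 + 4 * \int[Q]_y (`|y| ^+ 3) + 4) * (1 + `|x| ^+ 3).
Proof.
move=> m3Q tf A0 fA; set m := \int[Q]_y (`|y| ^+ 3).
have m0 : 0 <= m by apply: Rintegral_ge0 => y _; exact: normx3_ge0.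
have tn f' : cubic_growth f' -> cubic_growth (fun x => `|f' x|).
  move=> [mf' [B f'B]]; split; first by apply: measurableT_comp => //; exact: normr_measurable.
  by exists B => y; rewrite normr_id.
have txf : cubic_growth (fun y => f (x + y)).
  have := cubic_growth_affine 1 x tf.
  by under [X in cubic_growth X]eq_fun do rewrite mul1r addrC.
have tb : cubic_growth (fun y => A * (1 + 4 * `|x| ^+ 3) + A * 4 * `|y| ^+ 3).
  by apply: cubic_growthD; [exact: cubic_growth_cst|apply: cubic_growthZ; exact: cubic_growth_normx3].
apply: (@le_trans _ _ (\int[Q]_y (A * (1 + 4 * `|x| ^+ 3) + A * 4 * `|y| ^+ 3))).
  apply: cubic_growth_le_Rint => //; first exact: tn.
  move=> y; apply: le_trans (fA _) _.
  by have := ler_wpM2l A0 (ler_normD3 x y); lra.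
rewrite cubic_growth_RintD//; last 2 first.
- exact: cubic_growth_cst.
- by apply: cubic_growthZ; exact: cubic_growth_normx3.
rewrite Rint_cst cubic_growth_RintZ//; last exact: cubic_growth_normx3.
rewrite -/m; have x0 := normx3_ge0 x; move: (`|x| ^+ 3) x0 => X x0.
have := mulr_ge0 A0 (mulr_ge0 m0 x0); have := mulr_ge0 A0 x0; lra.
Qed.

Lemma integral_law_dirac (x : R) (f : R -> \bar R) : measurable_fun [set: R] f ->
  (\int[(\d_(x : measurableTypeR R) : law R)]_y f y = f x)%E.
Proof.
move=> mf; rewrite integral_dirac// [X in (X * _)%E](_ : _ = 1%E) ?mul1e//.
exact: diracT.
Qed.

Lemma third_moment_finite_dirac x : third_moment_finite (\d_(x : measurableTypeR R) : law R).
Proof.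
have m3 : measurable_fun [set: R] (fun x => (`|x| ^+ 3)%:E).
  by apply/measurable_EFinP; case: (@cubic_growth_normx3 R).
apply/integrableP; split => //.
by rewrite (@integral_law_dirac x) ?ltry//; exact: measurableT_comp.
Qed.

Lemma Rintegral_dirac f x : measurable_fun [set: R] f ->
  \int[(\d_(x : measurableTypeR R) : law R)]_y f y = f x.
Proof. by move=> mf; rewrite /Rintegral integral_law_dirac//; exact/measurable_EFinP. Qed.

Section two_laws.
Variables P Q : law R.
Hypotheses (m3P : third_moment_finite P) (m3Q : third_moment_finite Q).

Let measurable_add_comp f : measurable_fun [set: R] f ->
  measurable_fun setT (fun z : measurableTypeR R * measurableTypeR R => (f (z.1 + z.2))%:E).
Proof.
move=> mf; apply/measurable_EFinP.
exact: (measurableT_comp mf (@measurable_add_map R)).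
Qed.

Lemma cubic_growth_integrable_prod f : cubic_growth f ->
  (P \x Q)%E.-integrable setT (fun z => (f (z.1 + z.2))%:E).
Proof.
move=> tf; have [mf [A A0 fA]] := cubic_growth_ge0 tf.
apply/integrable12ltyP; first exact: measurable_add_comp.
pose m := \int[Q]_y (`|y| ^+ 3).
pose C := A * (1 + 4 * m + 4).
have txf x : cubic_growth (fun y => f (x + y)).
  have := cubic_growth_affine 1 x tf.
  by under [X in cubic_growth X]eq_fun do rewrite mul1r addrC.
have tb : cubic_growth (fun x => C * (1 + `|x| ^+ 3)).
  apply: cubic_growthZ; apply: cubic_growthD; first exact: cubic_growth_cst.
  exact: cubic_growth_normx3.
apply: (@le_lt_trans _ _ (\int[P]_x (C * (1 + `|x| ^+ 3))%:E)%E); last first.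
  have /integrableP[_] := cubic_growth_integrable m3P tb.
  apply: le_lt_trans; apply: ge0_le_integral => //.
  - move=> x _; rewrite lee_fin; have := cubic_growth_section_le x m3Q tf A0 fA.
    by apply: le_trans; apply: Rintegral_ge0.
  - by apply/measurable_EFinP; case: tb.
  - by apply: measurableT_comp => //; apply/measurable_EFinP; case: tb.
  - by move=> x _; rewrite /= lee_fin ler_norm.
apply: ge0_le_integral => //.
- by move=> x _; apply: integral_ge0.
- apply: (measurable_fun_fubini_tonelli_F (abse \o (fun z : measurableTypeR R * measurableTypeR R => (f (z.1 + z.2))%:E))).
  + by apply: measurableT_comp => //; exact: measurable_add_comp.
  + by move=> z; exact: abse_ge0.
- by apply/measurable_EFinP; case: tb.
- move=> x _.
  have := cubic_growth_section_le x m3Q tf A0 fA; rewrite -lee_fin; apply: le_trans.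
  have /integrableP[_ fin] := cubic_growth_integrable m3Q (txf x).
  rewrite /Rintegral fineK//.
  by rewrite ge0_fin_numE// integral_ge0.
Qed.

Lemma Rintegral_conv f : cubic_growth f ->
  \int[Defs.conv P Q]_z f z = \int[P]_x \int[Q]_y f (x + y).
Proof.
move=> tf; have ifxy := cubic_growth_integrable_prod tf.
rewrite /Rintegral integral_distribution//=; last first.
  by apply/measurable_EFinP; case: tf.
congr fine; rewrite -(integral12_prod_meas1 ifxy).
apply: eq_integral => x _; rewrite /fubini_F fineK//.
apply: integrable_fin_num => //.
have := cubic_growth_integrable m3Q (cubic_growth_affine 1 x tf).
by under [X in _.-integrable _ (EFin \o X)]eq_fun do rewrite mul1r addrC.
Qed.

Lemma third_moment_finite_conv : third_moment_finite (Defs.conv P Q).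
Proof.
apply: (@integrable_pushforward _ _ _ _ _ (@add_map R) _ (P \x Q)%E setT) => //.
- by apply/measurable_EFinP; case: (@cubic_growth_normx3 R).
- exact: cubic_growth_integrable_prod cubic_growth_normx3.
Qed.

End two_laws.

Lemma cubic_growth_section Q f : third_moment_finite Q -> cubic_growth f ->
  cubic_growth (fun x => \int[Q]_y f (x + y)).
Proof.
move=> m3Q tf; have [mf [A A0 fA]] := cubic_growth_ge0 tf.
have txf x : cubic_growth (fun y => f (x + y)).
  have := cubic_growth_affine 1 x tf.
  by under [X in cubic_growth X]eq_fun do rewrite mul1r addrC.
split; last first.
  exists (A * (1 + 4 * \int[Q]_y (`|y| ^+ 3) + 4)) => x.
  apply: le_trans (cubic_growth_section_le x m3Q tf A0 fA).
  by apply: le_normr_Rintegral => //; exact: cubic_growth_integrable.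
(* The section depends on [Q] alone; a Dirac mass is taken as first factor to have an integrable
   function on a product. *)
have := measurable_fubini_F (cubic_growth_integrable_prod (third_moment_finite_dirac 0) m3Q tf).
move=> mF; apply/measurable_EFinP; apply: eq_measurable_fun mF => x _.
rewrite /fubini_F /= /Rintegral fineK//.
apply: integrable_fin_num => //.
exact: cubic_growth_integrable.
Qed.

Lemma third_moment_finite_conv_pow P n : third_moment_finite P ->
  third_moment_finite (conv_pow P n).
Proof.
move=> m3P; elim: n => [|n IH]; first exact: third_moment_finite_dirac.
exact: third_moment_finite_conv.
Qed.

End convolution_integrals.

(** * Standardization and convolution powers *)

Section standardization.
Context {R : realType}.
Implicit Types (P Q S : law R) (f g : R -> R) (a b c v : R).

Definition standardized P := [/\ third_moment_finite P,
  \int[P]_x x = 0 & \int[P]_x (x ^+ 2) = 1].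

Lemma variance_idE P : third_moment_finite P ->
  'V_P[idfun]%E = (\int[P]_x ((x - mean P) ^+ 2))%:E.
Proof.
move=> m3P; rewrite /variance unlock unlock /Rintegral fineK; last first.
  apply: integrable_fin_num => //; apply: (cubic_growth_integrable m3P).
  have := cubic_growth_affine 1 (- mean P) (@cubic_growthX R 2 isT).
  by under [X in cubic_growth X -> _]eq_fun do rewrite mul1r.
by apply: eq_integral => x _; rewrite expr2 /mean unlock.
Qed.

Lemma meanE P : mean P = \int[P]_x x.
Proof. by rewrite /mean unlock. Qed.

Lemma stddevE P : third_moment_finite P ->
  stddev P = Num.sqrt (\int[P]_x ((x - mean P) ^+ 2)).
Proof. by move=> m3P; rewrite /stddev variance_idE. Qed.

Lemma std_mapE m s (x : R) : std_map m s x = s^-1 * x + - (m / s).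
Proof. by rewrite /std_map (mulrC s^-1) -mulrBl. Qed.

Lemma standardizeP P : third_moment_finite P ->
  third_moment_finite (standardize P) /\ forall f, cubic_growth f ->
    \int[standardize P]_x f x = \int[P]_x f ((x - mean P) / stddev P).
Proof.
move=> m3P; apply: distribution_cubic_growth => //=.
  have := cubic_growth_affine (stddev P)^-1 (- (mean P / stddev P)) (@cubic_growth_id R).
  by under [X in cubic_growth X -> _]eq_fun do rewrite -std_mapE.
exists (4 * (`|(stddev P)^-1| ^+ 3 + `|mean P / stddev P| ^+ 3)).
  by rewrite mulr_ge0// addr_ge0// normx3_ge0.
move=> x; rewrite std_mapE; apply: le_trans (ler_normD3 _ _) _.
rewrite normrN normrM exprMn.
move: (normx3_ge0 x) (normx3_ge0 (stddev P)^-1) (normx3_ge0 (mean P / stddev P)).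
move: (`|x| ^+ 3) (`|(stddev P)^-1| ^+ 3) (`|mean P / stddev P| ^+ 3) => X s m X0 s0 m0.
by have := mulr_ge0 m0 X0; lra.
Qed.

(** Standardization absorbs a positive affine change. Laws are compared through integrals of
    functions of cubic growth, which include all test functions of [zeta3]. *)
Lemma standardizeE_affine Q S a b v : third_moment_finite Q -> third_moment_finite S ->
  0 < a -> 0 < v -> \int[S]_x x = 0 -> \int[S]_x (x ^+ 2) = v ->
  (forall f, cubic_growth f -> \int[Q]_x f x = \int[S]_x f (a * x + b)) ->
  forall f, cubic_growth f ->
    \int[standardize Q]_x f x = \int[S]_x f (x / Num.sqrt v).
Proof.
move=> m3Q m3S a0 v0 S1 S2 QS.
have mQ : mean Q = b.
  rewrite meanE (QS (fun x => x) (@cubic_growth_id R)) cubic_growth_RintD//; last exact: cubic_growth_cst.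
    by rewrite Rint_cst cubic_growth_RintZ ?S1 ?mulr0 ?add0r//; exact: cubic_growth_id.
  by apply: cubic_growthZ; exact: cubic_growth_id.
have sQ : stddev Q = a * Num.sqrt v.
  rewrite stddevE// mQ (QS (fun x => (x - b) ^+ 2)); last first.
    have := cubic_growth_affine 1 (- b) (@cubic_growthX R 2 isT).
    by under [X in cubic_growth X -> _]eq_fun do rewrite mul1r.
  under eq_Rintegral do rewrite addrK exprMn.
  rewrite cubic_growth_RintZ//; last exact: cubic_growthX.
  by rewrite S2 sqrtrM ?sqr_ge0// sqrtr_sqr gtr0_norm.
have s0 : 0 < Num.sqrt v by rewrite sqrtr_gt0.
move=> f tf; rewrite (standardizeP m3Q).2// (QS (fun x => f ((x - mean Q) / stddev Q))).
  by apply: eq_Rintegral => x _; rewrite mQ sQ addrK; congr f; field; rewrite !gt_eqF.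
have := cubic_growth_affine (stddev Q)^-1 (- (mean Q / stddev Q)) tf.
by under [X in cubic_growth X -> _]eq_fun do rewrite mulrC -mulrBl.
Qed.

Lemma P3_third_moment_finite P : P3 P -> third_moment_finite P.
Proof.
move=> [m3P _]; apply/integrableP; split.
  by apply/measurable_EFinP; case: (@cubic_growth_normx3 R).
by under eq_integral do rewrite abse_EFin ger0_norm ?normx3_ge0//.
Qed.

Lemma P3_stddev_gt0 P : P3 P -> 0 < stddev P.
Proof.
move=> PP; have m3P := P3_third_moment_finite PP; have [_] := PP.
by rewrite stddevE// variance_idE// lte_fin sqrtr_gt0.
Qed.

Lemma standardized_standardize P : P3 P -> standardized (standardize P).
Proof.
move=> PP; have m3P := P3_third_moment_finite PP; have s0 := P3_stddev_gt0 PP.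
have [m3s sE] := standardizeP m3P; split => //.
  rewrite (sE (fun x => x) (@cubic_growth_id R)).
  under eq_Rintegral do rewrite mulrC.
  rewrite cubic_growth_RintZ//; last first.
    by apply: cubic_growthB; [exact: cubic_growth_id|exact: cubic_growth_cst].
  rewrite cubic_growth_RintB//; [|exact: cubic_growth_id|exact: cubic_growth_cst].
  by rewrite Rint_cst -meanE subrr mulr0.
rewrite (sE (fun x => x ^+ 2))//; last exact: cubic_growthX.
under eq_Rintegral do rewrite exprMn mulrC.
have t2 : cubic_growth (fun x => (x - mean P) ^+ 2).
  have := cubic_growth_affine 1 (- mean P) (@cubic_growthX R 2 isT).
  by under [X in cubic_growth X -> _]eq_fun do rewrite mul1r.
rewrite cubic_growth_RintZ// exprVn.
have <- : stddev P ^+ 2 = \int[P]_x ((x - mean P) ^+ 2).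
  by rewrite stddevE// sqr_sqrtr//; apply: Rintegral_ge0 => x _; exact: sqr_ge0.
by rewrite mulVf// gt_eqF// exprn_gt0.
Qed.

Lemma standardize_affine P : P3 P -> forall f, cubic_growth f ->
  \int[P]_x f x = \int[standardize P]_x f (stddev P * x + mean P).
Proof.
move=> PP f tf; have s0 := P3_stddev_gt0 PP.
rewrite (standardizeP (P3_third_moment_finite PP)).2; last exact: cubic_growth_affine.
by apply: eq_Rintegral => x _; congr f; field; rewrite gt_eqF.
Qed.

Lemma varrho_standardize P : P3 P -> varrho P = \int[standardize P]_x (`|x| ^+ 3).
Proof.
move=> PP; rewrite (standardizeP (P3_third_moment_finite PP)).2//.
exact: cubic_growth_normx3.
Qed.

Lemma conv_pow_affine P S a b : third_moment_finite P -> third_moment_finite S ->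
  (forall f, cubic_growth f -> \int[P]_x f x = \int[S]_x f (a * x + b)) ->
  forall n f, cubic_growth f ->
    \int[conv_pow P n]_x f x = \int[conv_pow S n]_x f (a * x + n%:R * b).
Proof.
move=> m3P m3S PS; elim => [|n IH] f tf /=.
  have mf := (cubic_growth_affine a (0 * b) tf).1.
  rewrite !Rintegral_dirac//; last by case: tf.
  by rewrite mulr0 mul0r addr0.
have m3Pn := third_moment_finite_conv_pow n m3P.
have m3Sn := third_moment_finite_conv_pow n m3S.
rewrite !Rintegral_conv//; last exact: (cubic_growth_affine _ _ tf).
rewrite (IH (fun x => \int[P]_y f (x + y))); last exact: cubic_growth_section.
apply: eq_Rintegral => x _; rewrite (PS (fun y => f (a * x + n%:R * b + y))).
  by apply: eq_Rintegral => y _; congr f; rewrite -natr1; ring.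
have := cubic_growth_affine 1 (a * x + n%:R * b) tf.
by under [X in cubic_growth X -> _]eq_fun do rewrite mul1r addrC.
Qed.

(** The cross terms have mean zero because the summands are centred, so the third moment is
    additive; this makes the cubic identity exact for every [k]. *)
Lemma conv_pow_moments S n : standardized S ->
  [/\ \int[conv_pow S n]_x x = 0, \int[conv_pow S n]_x (x ^+ 2) = n%:R &
      \int[conv_pow S n]_x (x ^+ 3) = n%:R * \int[S]_x (x ^+ 3)].
Proof.
move=> [m3S S1 S2]; set s3 := \int[S]_x (x ^+ 3).
have t1 := @cubic_growth_id R; have t2 := @cubic_growthX R 2 isT.
have t3 := @cubic_growthX R 3 isT; have tc c := cubic_growth_cst c.
elim: n => [|n [IH1 IH2 IH3]].
  split; rewrite /=.
  - by rewrite Rintegral_dirac//; exact: t1.1.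
  - by rewrite Rintegral_dirac ?expr0n//; exact: t2.1.
  - by rewrite Rintegral_dirac ?expr0n ?mul0r//; exact: t3.1.
have m3n := third_moment_finite_conv_pow n m3S; split => /=.
- rewrite (Rintegral_conv m3n m3S t1).
  under eq_Rintegral do rewrite (cubic_growth_RintD m3S (tc _) t1) Rint_cst S1 addr0.
  exact: IH1.
- rewrite (Rintegral_conv m3n m3S t2).
  have -> : \int[conv_pow S n]_x \int[S]_y ((x + y) ^+ 2) =
      \int[conv_pow S n]_x (x ^+ 2 + 1).
    apply: eq_Rintegral => x _.
    have -> : \int[S]_y ((x + y) ^+ 2) = \int[S]_y (x ^+ 2 + 2 * x * y + y ^+ 2).
      by apply: eq_Rintegral => y _; ring.
    rewrite !cubic_growth_RintD//; do ?[exact: cubic_growthZ | apply: cubic_growthD => //; exact: cubic_growthZ].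
    by rewrite Rint_cst cubic_growth_RintZ// S1 S2 mulr0 addr0.
  by rewrite cubic_growth_RintD// IH2 Rint_cst natr1.
- rewrite (Rintegral_conv m3n m3S t3).
  have -> : \int[conv_pow S n]_x \int[S]_y ((x + y) ^+ 3) =
      \int[conv_pow S n]_x (x ^+ 3 + 3 * x + s3).
    apply: eq_Rintegral => x _.
    have -> : \int[S]_y ((x + y) ^+ 3) =
        \int[S]_y (x ^+ 3 + 3 * x ^+ 2 * y + 3 * x * y ^+ 2 + y ^+ 3).
      by apply: eq_Rintegral => y _; ring.
    rewrite !cubic_growth_RintD//; do ?[exact: cubic_growthZ | apply: cubic_growthD => //].
    by rewrite Rint_cst !cubic_growth_RintZ// S1 S2 mulr0 addr0 mulr1.
  rewrite !cubic_growth_RintD//; do ?[exact: cubic_growthZ | apply: cubic_growthD => //].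
  by rewrite IH3 cubic_growth_RintZ// IH1 Rint_cst mulr0 addr0 -natr1 mulrDl mul1r.
Qed.

Lemma standardize_conv_powE P n : P3 P -> (0 < n)%N ->
  forall f, cubic_growth f -> \int[standardize (conv_pow P n)]_x f x =
    \int[conv_pow (standardize P) n]_x f (x / Num.sqrt n%:R).
Proof.
move=> PP n0; have sP := standardized_standardize PP.
have m3P := P3_third_moment_finite PP; have [m3s _ _] := sP.
have [S1 S2 _] := conv_pow_moments n sP.
apply: (@standardizeE_affine _ _ (stddev P) (n%:R * mean P)) => //.
- exact: third_moment_finite_conv_pow.
- exact: third_moment_finite_conv_pow.
- exact: P3_stddev_gt0.
- by rewrite ltr0n.
- by apply: conv_pow_affine => //; exact: standardize_affine.
Qed.

End standardization.

(** * Two-point, Rademacher and binomial laws *)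

Section discrete_laws.
Context {R : realType}.
Implicit Types (P Q S : law R) (f g : R -> R) (a b c v rho : R).

(** The discrete integrals are first computed for nonnegative functions; adding and subtracting a
    dominating function extends the formula. *)
Lemma cubic_growth_Rint_nonneg P (T : (R -> R) -> R) : third_moment_finite P ->
  (forall f, cubic_growth f -> (forall x, 0 <= f x) -> \int[P]_x f x = T f) ->
  (forall f g, T (fun x => f x - g x) = T f - T g) ->
  forall f, cubic_growth f -> \int[P]_x f x = T f.
Proof.
move=> m3P PT TB f tf; have [_ [A A0 fA]] := cubic_growth_ge0 tf.
pose g (x : R) : R := A * (1 + `|x| ^+ 3).
have tg : cubic_growth g.
  apply: cubic_growthZ; apply: cubic_growthD; first exact: cubic_growth_cst.
  exact: cubic_growth_normx3.
have g0 x : 0 <= g x by rewrite mulr_ge0// addr_ge0// normx3_ge0.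
have tfg : cubic_growth (fun x => f x + g x) by exact: cubic_growthD.
have fg0 x : 0 <= f x + g x.
  by have := fA x; rewrite ler_norml => /andP[+ _]; rewrite -/(g x); lra.
have -> : f = fun x => f x + g x - g x by apply/funext => x; rewrite addrK.
by rewrite cubic_growth_RintB// TB !PT.
Qed.

Lemma P_integral rho : 1 <= rho -> let u := Num.sqrt (p_rho rho / (1 - p_rho rho)) in
  third_moment_finite (P_ rho) /\
  forall f, cubic_growth f -> \int[P_ rho]_x f x = two_point_mean u f.
Proof.
move=> rho1 u; have [u0 uV pE _] := Bfun_p_rho rho1.
have /andP[p0 p2] := p_rho_bounds rho1.
rewrite -/u in u0 uV pE.
have p01 : 0 <= p_rho rho <= 1 by rewrite (ltW p0)/=; lra.
have qE : 1 - p_rho rho = u^-1 / (u + u^-1).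
  by rewrite pE -[1](@divff _ (u + u^-1)) ?gt_eqF ?addrV_gt0// -mulrBl addrAC subrr add0r.
have I f : cubic_growth f -> (forall x, 0 <= f x) ->
    (\int[P_ rho]_x (f x)%:E = (two_point_mean u f)%:E)%E.
  move=> [mf _] f0; rewrite ge0_integral_distribution; [|exact/measurable_EFinP|by move=> x; rewrite lee_fin].
  rewrite integral_bernoulli_prob//; last by move=> x; rewrite lee_fin.
  rewrite /unstable.onem -!EFinM -EFinD /=; congr EFin.
  rewrite -uV -/u qE {1}pE /two_point_mean; field.
  by have := sqr_ge0 u => ?; rewrite !gt_eqF//=; lra.
have m3 : third_moment_finite (P_ rho).
  apply/integrableP; split; first by apply/measurable_EFinP; case: (@cubic_growth_normx3 R).
  under eq_integral do rewrite abse_EFin ger0_norm ?normx3_ge0//.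
  by rewrite (I _ (@cubic_growth_normx3 R)) ?ltry// => x; exact: normx3_ge0.
split=> //; apply: cubic_growth_Rint_nonneg => //.
  by move=> f tf f0; rewrite /Rintegral I.
by move=> f g; rewrite /two_point_mean; ring.
Qed.

Definition rademacher : law R := P_ 1.

Lemma p_rho1 : p_rho 1 = 2^-1 :> R.
Proof.
rewrite /p_rho (_ : 1 ^+ 2 + 8 = 3 ^+ 2) ?sqrtr_sqr; last by ring.
rewrite (gtr0_norm (_ : 0 < 3))// (_ : 1 / 2 * 3 - 1 ^+ 2 / 2 - 1 = 0) ?sqrtr0; first by ring.
by field.
Qed.

Lemma rademacher_third_moment_finite : third_moment_finite rademacher.
Proof. by case: (P_integral (lexx 1)). Qed.

Lemma rademacherE f : cubic_growth f -> \int[rademacher]_x f x = (f 1 + f (-1)) / 2.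
Proof.
move=> tf; rewrite (P_integral (lexx 1)).2// p_rho1.
have -> : 2^-1 / (1 - 2^-1) = 1 :> R by field.
by rewrite sqrtr1 two_point_mean1.
Qed.

Lemma standardized_P_ rho : 1 <= rho -> standardized (P_ rho).
Proof.
move=> rho1; have [m3 E] := P_integral rho1; have [u0 _ _ _] := Bfun_p_rho rho1.
split=> //; rewrite E; do ?[exact: cubic_growth_id|exact: cubic_growthX];
  rewrite /two_point_mean; field;
  have := sqr_ge0 (Num.sqrt (p_rho rho / (1 - p_rho rho))) => ?; rewrite ?gt_eqF//=; lra.
Qed.

Lemma standardized_rademacher : standardized rademacher.
Proof. exact: standardized_P_. Qed.

Lemma P_x3 rho : 1 <= rho -> \int[P_ rho]_x (x ^+ 3) = Bfun rho.
Proof.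
move=> rho1; have [m3 E] := P_integral rho1; have [u0 _ _ <-] := Bfun_p_rho rho1.
rewrite E; last exact: cubic_growthX.
by rewrite /two_point_mean; field; have := sqr_ge0 (Num.sqrt (p_rho rho / (1 - p_rho rho))) => ?;
  rewrite ?gt_eqF//=; lra.
Qed.

Lemma P_normx3 rho : 1 <= rho -> \int[P_ rho]_x (`|x| ^+ 3) = rho.
Proof.
move=> rho1; have [m3 E] := P_integral rho1; have [u0 _ _ Be] := Bfun_p_rho rho1.
rewrite E; last exact: cubic_growth_normx3.
by rewrite two_point_mean_normx3// Be (ger0_norm (Bfun_ge0 _)) two_point_mom3_Bfun.
Qed.

Lemma standardized_P3 P : standardized P -> P3 P /\ varrho P = \int[P]_x (`|x| ^+ 3).
Proof.
move=> [m3P P1 P2]; have mP : mean P = 0 by rewrite meanE.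
have vP : \int[P]_x ((x - mean P) ^+ 2) = 1.
  by under eq_Rintegral do rewrite mP subr0.
split; last first.
  by apply: eq_Rintegral => x _; rewrite mP subr0 stddevE// vP sqrtr1 divr1.
split; last by rewrite variance_idE// vP lte_fin.
have /integrableP[_] := m3P.
by under eq_integral do rewrite abse_EFin ger0_norm ?normx3_ge0//.
Qed.

Definition binomial_mean n f : R := \sum_(k < n.+1) 2^-1 ^+ n * 'C(n, k)%:R * f k%:R.

(** Pascal's rule, read as conditioning on one fair Bernoulli summand. *)
Lemma binomial_meanS n f : binomial_mean n.+1 f =
  (binomial_mean n (fun x => f (x + 1)) + binomial_mean n f) / 2.
Proof.
rewrite /binomial_mean big_ord_recl/=.
under eq_bigr do rewrite /bump leq0n add1n binS [('C(n, _) + _)%N]addnC natrD mulrDr mulrDl.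
rewrite big_split/= addrCA mulrDl. congr (_ + _).
  rewrite mulr_suml; apply: eq_bigr => k _.
  by rewrite -[k.+1%:R]natr1 exprS; field.

have -> : \sum_(k < n.+1) 2^-1 ^+ n * 'C(n, k)%:R * f k%:R =
    \sum_(k < n.+2) 2^-1 ^+ n * 'C(n, k)%:R * f k%:R.
  by rewrite [RHS]big_ord_recr/= bin_small// mulr0 mul0r addr0.
rewrite mulr_suml [RHS]big_ord_recl/= !bin0 exprS; congr (_ + _); first by field.
by apply: eq_bigr => k _; rewrite /bump leq0n add1n; field.
Qed.

Lemma cubic_growth_affine_eq f g a b : cubic_growth f ->
  (forall x, g x = a * x + b) -> cubic_growth (fun x => f (g x)).
Proof.
by move=> tf gE; under eq_fun do rewrite gE; exact: cubic_growth_affine.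
Qed.

(** A Rademacher variable [e] gives the Bernoulli variable [(e + 1) / 2]; summing gives the affine
    map. *)
Lemma rademacher_conv_pow_binomial n f : cubic_growth f ->
  \int[conv_pow rademacher n]_x f ((x + n%:R) / 2) = binomial_mean n f.
Proof.
have half c h : cubic_growth h -> cubic_growth (fun x => h ((x + c) / 2)).
  by move=> th; apply: (@cubic_growth_affine_eq h _ 2^-1 (c / 2)) => // x; field.
elim: n f => [|n IH] f tf.
  rewrite /= (@Rintegral_dirac _ (fun x => f ((x + 0%:R) / 2))).
    by rewrite /binomial_mean big_ord1 addr0 mul0r bin0 expr0 !mul1r.
  exact: (half _ _ tf).1.
have m3 := rademacher_third_moment_finite.
have m3n := third_moment_finite_conv_pow n m3.
rewrite /= (Rintegral_conv m3n m3 (half _ _ tf)) binomial_meanS.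
have tf1 : cubic_growth (fun x => f (x + 1)).
  by apply: (@cubic_growth_affine_eq f _ 1 1) => // x; rewrite mul1r.
rewrite -(IH _ tf1) -(IH _ tf) mulrC.
have tn1 := half n%:R _ tf1; have tn := half n%:R _ tf.
rewrite -(cubic_growth_RintD m3n tn1 tn).
rewrite -(cubic_growth_RintZ m3n _ (cubic_growthD tn1 tn)).
apply: eq_Rintegral => x _.
rewrite (@rademacherE (fun y => f ((x + y + n.+1%:R) / 2))).
  by rewrite mulrC -[n.+1%:R]natr1; congr (_ * (f _ + f _)); field.
by apply: (@cubic_growth_affine_eq f _ 2^-1 ((x + n.+1%:R) / 2)) => // y; field.
Qed.

Lemma binomial_halfP n : third_moment_finite (binomial_half n : law R) /\
  forall f, cubic_growth f -> \int[binomial_half n]_x f x = binomial_mean n f.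
Proof.
have h0 : (0 : R) <= 2^-1 by rewrite invr_ge0.
have h1 : (NngNum h0)%:num <= 1 by rewrite /= invf_le1// ler1n.
have I f : cubic_growth f -> (forall x, 0 <= f x) ->
    (\int[binomial_half n]_x (f x)%:E = (binomial_mean n f)%:E)%E.
  move=> [mf _] f0; rewrite ge0_integral_distribution; [|exact/measurable_EFinP|by move=> x; rewrite lee_fin].
  rewrite (integral_binomial _ h1)//; last by move=> x; rewrite lee_fin.
  rewrite /binomial_mean -sumEFin; apply: eq_bigr => k _.
  rewrite -EFinM /= /nat_inj -[_ *+ 'C(n, k)]mulr_natr; congr ((_ * _ * _)%:E).
  rewrite /unstable.onem (_ : 1 - 2^-1 = 2^-1) -?exprD ?subnKC//; last by field.
  by rewrite -ltnS.
have m3 : third_moment_finite (binomial_half n : law R).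
  apply/integrableP; split; first by apply/measurable_EFinP; case: (@cubic_growth_normx3 R).
  under eq_integral do rewrite abse_EFin ger0_norm ?normx3_ge0//.
  by rewrite (I _ (@cubic_growth_normx3 R)) ?ltry// => x; exact: normx3_ge0.
split=> //; apply: cubic_growth_Rint_nonneg => //.
  by move=> f tf f0; rewrite /Rintegral I.
by move=> f g; rewrite /binomial_mean -sumrB; apply: eq_bigr => k _; rewrite mulrBr.
Qed.

Lemma standardize_binomial_halfE n : (0 < n)%N ->
  forall f, cubic_growth f -> \int[standardize (binomial_half n)]_x f x =
    \int[conv_pow rademacher n]_x f (x / Num.sqrt n%:R).
Proof.
move=> n0; have [m3b bE] := binomial_halfP n.
have [m3 _ _] := standardized_rademacher.
have [S1 S2 _] := conv_pow_moments n standardized_rademacher.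
apply: (@standardizeE_affine _ _ _ 2^-1 (n%:R / 2)) => //.
- exact: third_moment_finite_conv_pow.
- by rewrite ltr0n.
- move=> f tf; rewrite bE// -rademacher_conv_pow_binomial//.
  by apply: eq_Rintegral => x _; rewrite mulrDl mulrC.
Qed.

End discrete_laws.

(** * Comparison with the Rademacher law *)

(** The constant [c] is kept free because rescaling by [a] multiplies it by [a ^+ 3]. *)
Definition smooth3 {R : realType} (c : R) (f f1 f2 : R -> R) :=
  [/\ der f f1, der f1 f2, forall x y, `|f2 x - f2 y| <= c * `|x - y| &
      exists M, forall x, `|f x| <= M].

Section rademacher_comparison.
Context {R : realType}.
Implicit Types (P Q S : law R) (f g : R -> R) (a b c v rho : R).

Lemma continuous_cubic_growth f M : continuous f -> (forall x, `|f x| <= M) -> cubic_growth f.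
Proof. by move=> cf; apply: cubic_growth_bounded; exact: continuous_measurable_fun. Qed.

Lemma smooth3_cubic_growth c f f1 f2 : smooth3 c f f1 f2 -> cubic_growth f.
Proof. by move=> [df _ _ [M fM]]; apply: continuous_cubic_growth fM; exact: der_continuous df. Qed.

Lemma smooth3N c f f1 f2 : smooth3 c f f1 f2 ->
  smooth3 c (fun x => - f x) (fun x => - f1 x) (fun x => - f2 x).
Proof.
move=> [df df1 f2c [M fM]]; split; [exact: derN|exact: derN| |exists M => x; rewrite normrN//].
by move=> x y; rewrite -opprD normrN.
Qed.

Lemma der_shift h h1 b : der h h1 -> der (fun x => h (x + b)) (fun x => h1 (x + b)).
Proof.
move=> dh; have E g : (fun x => g (x + b)) = (fun x => g (1 * x + b)).
  by apply/funext => x; rewrite mul1r.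
rewrite !E; apply: eq_der; first exact: der_comp_affine dh.
by move=> x; rewrite mul1r.
Qed.

Lemma smooth3_shift c f f1 f2 a : smooth3 c f f1 f2 ->
  smooth3 c (fun x => f (x + a)) (fun x => f1 (x + a)) (fun x => f2 (x + a)).
Proof.
move=> [df df1 f2c [M fM]]; split; [exact: der_shift|exact: der_shift| |by exists M].
by move=> x y; have := f2c (x + a) (y + a); rewrite (_ : x + a - (y + a) = x - y)//; ring.
Qed.

Lemma smooth3_affine c f f1 f2 a b : 0 < a -> smooth3 c f f1 f2 ->
  smooth3 (c * a ^+ 3) (fun x => f (a * x + b)) (fun x => a * f1 (a * x + b))
    (fun x => a * (a * f2 (a * x + b))).
Proof.
move=> a0 [df df1 f2c [M fM]]; split; last by exists M.
- exact: der_comp_affine.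
- by apply: derZ; exact: der_comp_affine.
- move=> x y; rewrite -!mulrBr !normrM (gtr0_norm a0).
  have := f2c (a * x + b) (a * y + b); rewrite (_ : a * x + b - (a * y + b) = a * (x - y)) ?normrM ?(gtr0_norm a0); last by ring.
  move=> h.
  have -> : c * a ^+ 3 * `|x - y| = a * (a * (c * (a * `|x - y|))) by ring.
  by rewrite !ler_pM2l.
Qed.

Lemma smooth3_average c f f1 f2 : smooth3 c f f1 f2 ->
  smooth3 c (fun x => (f (x + 1) + f (x + -1)) / 2) (fun x => (f1 (x + 1) + f1 (x + -1)) / 2)
    (fun x => (f2 (x + 1) + f2 (x + -1)) / 2).
Proof.
move=> [df df1 f2c [M fM]].
have dav (h h1 : R -> R) : der h h1 -> der (fun x => (h (x + 1) + h (x + -1)) / 2)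
    (fun x => (h1 (x + 1) + h1 (x + -1)) / 2).
  move=> dh.
  apply: (eq_der (derM (derD (der_shift 1 dh) (der_shift (-1) dh)) (der_cst 2^-1))).
  by move=> x /=; rewrite mulr0 addr0.
split; [exact: dav|exact: dav| |].
- move=> x y; have -> : (f2 (x + 1) + f2 (x + -1)) / 2 - (f2 (y + 1) + f2 (y + -1)) / 2 =
    (f2 (x + 1) - f2 (y + 1) + (f2 (x + -1) - f2 (y + -1))) / 2 by ring.
  rewrite normrM (gtr0_norm (_ : 0 < 2^-1))// ler_pdivrMr//.
  apply: le_trans (ler_normD _ _) _.
  have := f2c (x + -1) (y + -1); have := f2c (x + 1) (y + 1).
  rewrite (_ : x + 1 - (y + 1) = x - y); last by ring.
  by rewrite (_ : x + -1 - (y + -1) = x - y); [lra|ring].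
- exists M => x; rewrite normrM (gtr0_norm (_ : 0 < 2^-1))// ler_pdivrMr//.
  apply: le_trans (ler_normD _ _) _.
  by have := fM (x + 1); have := fM (x + -1); lra.
Qed.

Lemma standardized_normx3_ge1 P : standardized P -> 1 <= \int[P]_x (`|x| ^+ 3).
Proof.
move=> [m3P P1 P2].
have t2 := @cubic_growthX R 2 isT; have tc := cubic_growth_cst (1 / 2 : R).
have t32 := cubic_growthZ (3 / 2) t2.
(* The tangent to [t^(3/2)] at [t = 1], taken at [t = x^2]; its mean under a standardized law is
   1. *)
have -> : 1 = \int[P]_x (3 / 2 * x ^+ 2 - 1 / 2).
  rewrite (cubic_growth_RintB m3P t32 tc) (cubic_growth_RintZ m3P _ t2).
  by rewrite P2 Rint_cst; field.
apply: cubic_growth_le_Rint => //.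
- exact: cubic_growthB.
- exact: cubic_growth_normx3.
- move=> x; rewrite -real_normK ?num_real// -subr_ge0.
  have -> : `|x| ^+ 3 - (3 / 2 * `|x| ^+ 2 - 1 / 2) = (`|x| - 1) ^+ 2 * (2 * `|x| + 1) / 2 by field.
  by rewrite divr_ge0// mulr_ge0 ?sqr_ge0// addr_ge0// mulr_ge0.
Qed.

Lemma standardized_le_rademacher P c f f1 f2 : standardized P -> smooth3 c f f1 f2 -> 0 < c ->
  \int[P]_x f x <= \int[rademacher]_x f x + c * Bfun (\int[P]_x (`|x| ^+ 3)) / 6.
Proof.
move=> sP sf c0; have tf := smooth3_cubic_growth sf.
have rho1 := standardized_normx3_ge1 sP; set rho := \int[P]_x _ in rho1 *.
have [m3P P1 P2] := sP; have [df df1 f2c [M fM]] := sf.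
have t3 := @cubic_growth_normx3 R; have t2 := @cubic_growthX R 2 isT; have t1 := @cubic_growth_id R.
rewrite rademacherE//.
(* At [rho = 1] the value [Bfun rho = 0] would admit no multiplier, so a larger [d] is used; the
   excess [6 * e / c] below contributes exactly [e]. *)
have key d : Bfun rho < d -> \int[P]_x f x <= (f 1 + f (-1)) / 2 + c * d / 6.
  move=> Bd; have d0 := le_lt_trans (Bfun_ge0 _) Bd.
  have [a [b [k [lam [lam0 fle fR]]]]] := cubic_majorant df df1 f2c fM c0 d0.
  apply: le_trans fR.
  have tq : cubic_growth (fun x => a + b * x + k * x ^+ 2).
    apply: cubic_growthD; last exact: cubic_growthZ.
    by apply: cubic_growthD; [exact: cubic_growth_cst|exact: cubic_growthZ].
  apply: (@le_trans _ _ (\int[P]_x (a + b * x + k * x ^+ 2 + lam * `|x| ^+ 3))).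
    apply: cubic_growth_le_Rint => //.
    by apply: cubic_growthD => //; exact: cubic_growthZ.
  rewrite cubic_growth_RintD//; last exact: cubic_growthZ.
  rewrite cubic_growth_RintD//; [|by apply: cubic_growthD; [exact: cubic_growth_cst|exact: cubic_growthZ]|exact: cubic_growthZ].
  rewrite cubic_growth_RintD//; [|exact: cubic_growth_cst|exact: cubic_growthZ].
  rewrite !cubic_growth_RintZ// Rint_cst P1 P2 mulr0 mulr1 addr0 lerD2l ler_pM2l//.
  exact: Bfun_lt_le.
apply/ler_addgt0Pl => e e0; have := key (Bfun rho + 6 * e / c).
rewrite ltrDl divr_gt0 ?mulr_gt0// => /(_ isT)/le_trans; apply.
rewrite mulrDr [c * (6 * e / c)]mulrC divfK ?gt_eqF//; lra.
Qed.

Lemma standardized_rademacher_bound P c f f1 f2 : standardized P -> smooth3 c f f1 f2 -> 0 < c ->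
  `|\int[P]_x f x - \int[rademacher]_x f x| <= c * Bfun (\int[P]_x (`|x| ^+ 3)) / 6.
Proof.
move=> sP sf c0; have tf := smooth3_cubic_growth sf; have [m3P _ _] := sP.
have h1 := standardized_le_rademacher sP sf c0.
have h2 := standardized_le_rademacher sP (smooth3N sf) c0.
have e S : third_moment_finite S -> \int[S]_x (- f x) = - \int[S]_x f x.
  move=> m3S; under eq_Rintegral do rewrite -mulN1r.
  by rewrite cubic_growth_RintZ// mulN1r.
rewrite !e// in h2; last exact: rademacher_third_moment_finite.
by rewrite ler_norml; apply/andP; split; lra.
Qed.

(* Replacing the last summand by a Rademacher variable turns the test function into
   its average over [x + 1] and [x - 1], which is again in the class. *)
Lemma conv_pow_rademacher_bound P c n f f1 f2 : standardized P -> smooth3 c f f1 f2 -> 0 < c ->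
  `|\int[conv_pow P n]_x f x - \int[conv_pow rademacher n]_x f x| <=
    n%:R * (c * Bfun (\int[P]_x (`|x| ^+ 3)) / 6).
Proof.
move=> sP; set C := c * _ / 6; elim: n f f1 f2 => [|n IH] f f1 f2 sf c0 /=.
  by rewrite subrr normr0 mul0r.
have tf := smooth3_cubic_growth sf; have [m3P _ _] := sP.
have m3R := @rademacher_third_moment_finite R.
have m3Pn := third_moment_finite_conv_pow n m3P.
have m3Rn := third_moment_finite_conv_pow n m3R.
pose g x := (f (x + 1) + f (x + -1)) / 2.
have sg := smooth3_average sf; have tg := smooth3_cubic_growth sg.
have txf x : cubic_growth (fun y => f (x + y)).
  by apply: (@cubic_growth_affine_eq _ f _ 1 x) => // y; rewrite mul1r addrC.
have gE x : \int[rademacher]_y f (x + y) = g x by rewrite rademacherE.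
rewrite (Rintegral_conv m3Pn m3P tf) (Rintegral_conv m3Rn m3R tf).
under [X in _ - X]eq_Rintegral do rewrite gE.
have -> : n.+1%:R * C = C + n%:R * C by rewrite -natr1 mulrDl mul1r addrC.
apply: le_trans (ler_distD (\int[conv_pow P n]_x g x) _ _) _; apply: lerD; last exact: IH sg c0.
apply: cubic_growth_Rint_near => //; first exact: cubic_growth_section.
move=> x; rewrite -gE.
have E h : (fun y => h (x + y)) = (fun y => h (y + x)).
  by apply/funext => y; rewrite addrC.
by rewrite (E _ f); exact: standardized_rademacher_bound sP (smooth3_shift x sf) c0.
Qed.

End rademacher_comparison.

(** * Gaussian integrals *)

Section gaussian_density.
Context {R : realType}.
Implicit Types (m s t a b x y z : R).
Notation mu := (@lebesgue_measure R).
Local Open Scope ereal_scope.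

(** The change of variables is stated for the Radon-Nikodym derivative, which agrees with the
    explicit density almost everywhere. *)
Lemma integral_normal_density m s (f : R -> \bar R) :
  measurable_fun [set: R] f -> (forall x, 0 <= f x) ->
  \int[normal_prob m s]_x f x = \int[mu]_x (f x * (normal_pdf m s x)%:E).
Proof.
move=> mf f0; have dom := normal_prob_dominates m s.
rewrite -(Radon_Nikodym_SigmaFinite.change_of_variables dom)//.
have fi := Radon_Nikodym_SigmaFinite.f_integrable dom.
apply: ae_eq_integral => //.
- by apply: emeasurable_funM => //; exact: measurable_int fi.
- by apply: emeasurable_funM => //; apply/measurable_EFinP; exact: measurable_normal_pdf.
- apply: ae_eqe_mul2l; apply: integral_ae_eq => //.
    by apply/measurable_EFinP; exact: measurable_normal_pdf.
  by move=> E _ mE; rewrite -Radon_Nikodym_SigmaFinite.f_integral.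
Qed.

Lemma integral_normalT m s : \int[normal_prob m s]_x (1 : \bar R) = 1.
Proof. by rewrite integral_cst// mul1e; exact: probability_setT. Qed.

Lemma normal_pdf_affine m s z : (0 < s)%R ->
  (normal_pdf m s (s * z + m) * s = normal_pdf 0 1 z)%R.
Proof.
move=> s0; rewrite !normal_pdfE ?oner_eq0 ?gt_eqF//.
rewrite /normal_peak /normal_fun addrK subr0 -mulrAC; congr (_ * expR _)%R.
  rewrite expr1n mul1r -mulrnAr sqrtrM ?sqr_ge0// sqrtr_sqr gtr0_norm//.
  by rewrite invfM mulrAC mulVf ?mul1r// gt_eqF.
by rewrite expr1n exprMn !mulr2n; field; rewrite gt_eqF// addr_gt0// exprn_gt0.
Qed.

Lemma integral_normal_affine m s (G : R -> R) : (0 < s)%R -> continuous G ->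
  (forall x, 0 <= G x)%R ->
  \int[normal_prob m s]_x (G x)%:E = \int[normal_prob 0 1]_z (G (s * z + m)%R)%:E.
Proof.
move=> s0 cG G0.
have dF := @der_comp_affine R _ _ s m (@der_id R).
have F1 : ((fun z : R => s * z + m)^`()%classic = (fun=> s))%R.
  apply/funext => z; rewrite derive1E.
  by rewrite (@derive_val _ _ _ _ _ _ _ (dF z)) mulr1.
have mG : measurable_fun [set: R] G by exact: continuous_measurable_fun.
have cF : continuous (fun z : R => s * z + m)%R by exact: der_continuous dF.
rewrite integral_normal_density; [|exact/measurable_EFinP|by move=> x; rewrite lee_fin].
rewrite integral_normal_density; first last.
- by move=> x; rewrite lee_fin.
- apply/measurable_EFinP; apply: (measurableT_comp mG).
  exact: continuous_measurable_fun.
under eq_integral do rewrite -EFinM.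
rewrite (@increasing_ge0_integration_by_substitutionT _ (fun z => s * z + m)%R).
- apply: eq_integral => z _; rewrite F1 -EFinM; congr EFin.
  by rewrite !fctE/= -mulrA normal_pdf_affine.
- by move=> x y xy; rewrite ltrD2r ltr_pM2l.
- by rewrite F1; exact: cst_continuous.
- by rewrite F1; exact: is_cvg_cst.
- by rewrite F1; exact: is_cvg_cst.
- by move=> x; have [] := dF x.
- apply: (cvg_comp (fun z => s * z)%R (fun z => z + m)%R).
    exact: (gt0_cvgMrNy s0 (@cvg_id _ _)).
  exact: cvg_addrr_Ny.
- apply: (cvg_comp (fun z => s * z)%R (fun z => z + m)%R).
    exact: (gt0_cvgMry s0 (@cvg_id _ _)).
  exact: cvg_addrr.
- move=> x; apply: cvgM; first exact: cG.
  by apply: continuous_normal_pdf; rewrite gt_eqF.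
- by move=> x; rewrite mulr_ge0// normal_pdf_ge0.
Qed.

Lemma integral_normalN (G : R -> R) : measurable_fun [set: R] G -> (forall x, 0 <= G x)%R ->
  \int[normal_prob 0 1]_x (G (- x)%R)%:E = \int[normal_prob 0 1]_x (G x)%:E.
Proof.
move=> mG G0.
have mN : measurable_fun [set: R] (fun x => G (- x)%R) by exact: measurableT_comp.
rewrite integral_normal_density; [|exact/measurable_EFinP|by move=> x; rewrite lee_fin].
rewrite integral_normal_density; [|exact/measurable_EFinP|by move=> x; rewrite lee_fin].
pose F x := (G x)%:E * (normal_pdf 0 1 x)%:E.
have mF : measurable_fun [set: R] F.
  by apply: emeasurable_funM; apply/measurable_EFinP => //; exact: measurable_normal_pdf.
have F0 x : 0 <= F x by rewrite mule_ge0// lee_fin ?normal_pdf_ge0.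
transitivity (\int[mu]_x F (- x)%R).
  apply: eq_integral => x _; rewrite /F; congr (_ * _%:E).
  by rewrite !normal_pdfE ?oner_eq0// /normal_fun !subr0 sqrrN.
transitivity (\int[pushforward mu (-%R : R -> measurableTypeR R)]_x F x).
  by rewrite ge0_integral_pushforward.
by apply: eq_measure_integral => //= A mA _; exact: lebesgue_measureN.
Qed.

End gaussian_density.

Section gaussian_identities.
Context {R : realType}.
Implicit Types (m s t a b x y z w : R).
Notation mu := (@lebesgue_measure R).
Local Open Scope ereal_scope.

Lemma normal_pdf_tilt a z :
  (expR (a * z - a ^+ 2 / 2) * normal_pdf 0 1 z = normal_pdf a 1 z)%R.
Proof.
rewrite !normal_pdfE ?oner_eq0// mulrCA /normal_fun -expRD; congr (_ * expR _)%R.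
by rewrite expr1n mulr2n; field.
Qed.

(** A translation of the argument is moved onto the density, so that its effect can be estimated
    without derivatives of [g]. *)
Lemma integral_normal_tilt a (g : R -> R) : continuous g -> (forall x, 0 <= g x)%R ->
  \int[normal_prob 0 1]_z (g (z + a)%R)%:E =
  \int[normal_prob 0 1]_z (g z * expR (a * z - a ^+ 2 / 2))%:E.
Proof.
move=> cg g0.
have mg : measurable_fun [set: R] g by exact: continuous_measurable_fun.
have mt : measurable_fun [set: R] (fun z => g z * expR (a * z - a ^+ 2 / 2))%R.
  apply: measurable_funM => //; apply: measurableT_comp => //.
  by apply: measurable_funB => //; exact: measurable_funM.
transitivity (\int[normal_prob a 1]_x (g x)%:E).
  have H := @integral_normal_affine R a 1 g ltr01 cg g0.
  rewrite H.
  by apply: eq_integral => z _; rewrite mul1r.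
rewrite integral_normal_density; [|exact/measurable_EFinP|by move=> x; rewrite lee_fin].
rewrite integral_normal_density; [|exact/measurable_EFinP|].
  by apply: eq_integral => z _; rewrite -!EFinM -normal_pdf_tilt mulrA.
by move=> z; rewrite lee_fin mulr_ge0// expR_ge0.
Qed.

Lemma normal_pdf_rescale s z : (0 < s)%R ->
  (expR (- (s ^- 2 - 1) * z ^+ 2 / 2) * normal_pdf 0 1 z = s * normal_pdf 0 s z)%R.
Proof.
move=> s0; rewrite !normal_pdfE ?oner_eq0 ?gt_eqF// mulrCA /normal_fun -expRD [RHS]mulrA.
congr (_ * expR _)%R.
  rewrite /normal_peak expr1n mul1r -mulrnAr sqrtrM ?sqr_ge0// sqrtr_sqr gtr0_norm//.
  by rewrite invfM mulrA divff ?mul1r// gt_eqF.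
rewrite expr1n !mulr2n subr0; field.
by rewrite !gt_eqF// ?addr_gt0// ?exprn_gt0.
Qed.

(** Up to the factor [s], the integrand is the density of a centred normal law of deviation [s]. The
    value at [s = sqrt 2] gives an integrable majorant; varying [s] around 1 identifies the
    variance. *)
Lemma integral_normal_expR_sqr s : (0 < s)%R ->
  \int[normal_prob 0 1]_z (expR (- (s ^- 2 - 1) * z ^+ 2 / 2))%:E = s%:E.
Proof.
move=> s0.
rewrite integral_normal_density; [| |by move=> x; rewrite lee_fin expR_ge0]; last first.
  apply/measurable_EFinP; apply: measurableT_comp => //; apply: measurable_funM => //.
  by apply: measurable_funM => //; exact: measurable_funX.
under eq_integral do rewrite -EFinM normal_pdf_rescale// EFinM.
rewrite ge0_integralZl//.
- by rewrite integral_normal_pdf mule1.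
- by apply/measurable_EFinP; exact: measurable_normal_pdf.
- by move=> x _; rewrite lee_fin normal_pdf_ge0.
- by rewrite lee_fin ltW.
Qed.

(* Completing the square: both sides are the density of a pair [(x, w)] of standard
   normal variables with covariance [a]. *)
Lemma normal_pdf_swap a b x w : (0 < b)%R -> (a ^+ 2 + b ^+ 2 = 1)%R ->
  (normal_pdf (a * x) b w * normal_pdf 0 1 x =
   normal_pdf 0 1 w * normal_pdf (a * w) b x)%R.
Proof.
move=> b0 ab; rewrite !normal_pdfE ?oner_eq0 ?gt_eqF// /normal_fun.
rewrite mulrACA [RHS]mulrACA -!expRD; congr (_ * expR _)%R; first by rewrite mulrC.
rewrite !expr1n !mulr2n !subr0.
have b2 : (b ^+ 2 = 1 - a ^+ 2)%R by rewrite -ab; ring.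
have n0 : (1 - a ^+ 2 != 0)%R by rewrite -b2 gt_eqF// exprn_gt0.
by rewrite b2; field; rewrite -mulr2n mulrn_eq0.
Qed.

(** After exchanging the roles of [x] and [w] in the joint density, the integral over [x] has total
    mass 1 and only the standard density in [w] is left. *)
Lemma normal_stable a b (G : R -> R) : (0 < b)%R -> (a ^+ 2 + b ^+ 2 = 1)%R ->
  continuous G -> (forall x, 0 <= G x)%R ->
  \int[normal_prob 0 1]_x \int[normal_prob 0 1]_y (G (b * y + a * x)%R)%:E =
  \int[normal_prob 0 1]_x (G x)%:E.
Proof.
move=> b0 ab cG G0.
have mG : measurable_fun [set: R] G by exact: continuous_measurable_fun.
pose K (z : R * R) := (G z.2 * normal_pdf (a * z.1) b z.2)%:E.
have mK : measurable_fun [set: R * R] K.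
  apply/measurable_EFinP; apply: measurable_funM; first exact: measurableT_comp.
  rewrite (_ : (fun z : R * R => _) = (fun z : R * R => normal_pdf 0 b (z.2 - a * z.1)%R)).
    apply: measurableT_comp; first exact: measurable_normal_pdf.
    by apply: measurable_funB => //; exact: measurable_funM.
  by apply/funext => z; rewrite !normal_pdfE ?gt_eqF// /normal_fun subr0.
have K0 (z : R * R) : 0 <= K z by rewrite lee_fin mulr_ge0// normal_pdf_ge0.
have inner x : \int[normal_prob 0 1]_y (G (b * y + a * x)%R)%:E = \int[mu]_w K (x, w).
  rewrite -(integral_normal_affine _ b0)// integral_normal_density.
  - by apply: eq_integral => w _; rewrite -EFinM.
  - exact/measurable_EFinP.
  - by move=> w; rewrite lee_fin.
under eq_integral do rewrite inner.
have mF : measurable_fun [set: R] (fun x => \int[mu]_w K (x, w)).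
  exact: (@measurable_fun_fubini_tonelli_F _ _ _ _ _ mu K).
rewrite [LHS]integral_normal_density; [|exact: mF|by move=> x; apply: integral_ge0 => w _; exact: K0].
pose L (z : R * R) := K z * (normal_pdf 0 1 z.1)%:E.
have mL : measurable_fun [set: R * R] L.
  apply: emeasurable_funM => //; apply/measurable_EFinP.
  by apply: (measurableT_comp (@measurable_normal_pdf R 0 1)).
have L0 (z : R * R) : 0 <= L z by rewrite mule_ge0// lee_fin normal_pdf_ge0.
transitivity (\int[mu]_x \int[mu]_w L (x, w)).
  apply: eq_integral => x _; rewrite -ge0_integralZr//.
  - exact: (measurableT_comp mK (pair1_measurable x)).
  - by rewrite lee_fin normal_pdf_ge0.
transitivity (\int[mu]_w \int[mu]_x L (x, w)).
  exact: (@fubini_tonelli _ _ _ _ _ mu mu L mL L0).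
rewrite [RHS]integral_normal_density; [|exact/measurable_EFinP|by move=> x; rewrite lee_fin].
apply: eq_integral => w _.
under eq_integral => x _.
  rewrite /L /K/= -EFinM -mulrA normal_pdf_swap// mulrA EFinM.
  over.
rewrite ge0_integralZl//.
- by rewrite integral_normal_pdf mule1 EFinM.
- by apply/measurable_EFinP; exact: measurable_normal_pdf.
- by move=> x _; rewrite lee_fin normal_pdf_ge0.
- by rewrite lee_fin mulr_ge0// normal_pdf_ge0.
Qed.

End gaussian_identities.

(** * Moments of the standard normal law and the effect of translations *)

Section standard_normal.
Context {R : realType}.
Implicit Types (m s t a b x y z w : R).
Local Notation N := (@std_normal R).

Lemma normal_expR_sqr s : 0 < s ->
  N.-integrable [set: measurableTypeR R] (fun z => (expR (- (s ^- 2 - 1) * z ^+ 2 / 2))%:E) /\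
  \int[N]_z (expR (- (s ^- 2 - 1) * z ^+ 2 / 2)) = s.
Proof.
move=> s0; have E := integral_normal_expR_sqr s0.
split; last by rewrite /Rintegral [X in fine X]E.
apply/integrableP; split.
  apply/measurable_EFinP; apply: measurableT_comp => //; apply: measurable_funM => //.
  by apply: measurable_funM => //; exact: measurable_funX.
by under eq_integral do rewrite gee0_abs ?lee_fin ?expR_ge0//; rewrite [X in (X < _)%E]E ltry.
Qed.

Lemma normal_integrable (f : R -> R) C : measurable_fun [set: R] f ->
  (forall z, `|f z| <= C * expR (z ^+ 2 / 4)) ->
  N.-integrable [set: measurableTypeR R] (EFin \o f).
Proof.
move=> mf fC; have s0 : 0 < Num.sqrt 2 :> R by rewrite sqrtr_gt0.
have [ie _] := normal_expR_sqr s0.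
have E : (fun z : R => (expR (- (Num.sqrt 2 ^- 2 - 1) * z ^+ 2 / 2))%:E) =
    (fun z => (expR (z ^+ 2 / 4))%:E).
  by apply/funext => z; rewrite sqr_sqrtr//; congr (expR _)%:E; field.
rewrite E in ie.
have iC := integrableZl (measurableT) C ie.
apply: le_integrable iC => //; first exact/measurable_EFinP.
move=> z _; rewrite /= lee_fin (le_trans (fC z))//.
exact: ler_norm.
Qed.

Lemma normal_integrableX n (f : R -> R) : (n <= 4)%N -> measurable_fun [set: R] f ->
  (forall z, `|f z| = `|z| ^+ n) -> N.-integrable [set: measurableTypeR R] (EFin \o f).
Proof.
move=> n4 mf fE; apply: (@normal_integrable _ 33) => // z; rewrite fE.
have e1 := @expR_ge1Dxn R (z ^+ 2 / 4) 1 (_ : 0 <= z ^+ 2 / 4).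
have h : z ^+ 4 <= 32 * expR (z ^+ 2 / 4).
  have := e1 (divr_ge0 (sqr_ge0 _) (ler0n _ _)).
  rewrite (_ : 2`! = 2%N)// (_ : (z ^+ 2 / 4) ^+ 2 = z ^+ 4 / 16); last by field.
  lra.
have h1 : 1 <= expR (z ^+ 2 / 4).
  by apply: le_trans (expR_ge1Dx _); rewrite lerDl divr_ge0 ?sqr_ge0.
have [z1|z1] := leP `|z| 1.
  by rewrite (le_trans (exprn_ile1 _ _ _))//; lra.
rewrite (le_trans (ler_weXn2l (ltW z1) n4))// -normrX ger0_norm; first by lra.
by rewrite (_ : 4%N = (2 * 2)%N)// exprM sqr_ge0.
Qed.

Lemma normal_third_moment_finite : third_moment_finite N.
Proof.
apply: (@normal_integrableX 3) => //; first by case: (@cubic_growth_normx3 R).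
by move=> z; rewrite ger0_norm// normx3_ge0.
Qed.

Lemma normal_integrable4 : N.-integrable [set: measurableTypeR R] (fun z => (z ^+ 4)%:E).
Proof. by apply: (@normal_integrableX 4) => // z; rewrite normrX. Qed.

Lemma normal_sym (f : R -> R) : cubic_growth f -> \int[N]_z f (- z) = \int[N]_z f z.
Proof.
move=> tf; have tN : cubic_growth (fun z => f (- z)).
  by apply: (@cubic_growth_affine_eq _ f _ (-1) 0) => // z; rewrite mulN1r addr0.
have [_ [A A0 fA]] := cubic_growth_ge0 tf.
pose g (z : R) : R := A * (1 + `|z| ^+ 3).
have tg : cubic_growth g.
  apply: cubic_growthZ; apply: cubic_growthD; first exact: cubic_growth_cst.
  exact: cubic_growth_normx3.
have m3 := normal_third_moment_finite.
have gN z : g (- z) = g z by rewrite /g normrN.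
have tfg := cubic_growthD tf tg.
have : \int[N]_z (f (- z) + g z) = \int[N]_z (f z + g z).
  rewrite /Rintegral; congr fine.
  have fg0 z : 0 <= f z + g z.
    by have := fA z; rewrite ler_norml => /andP[+ _]; rewrite -/(g z); lra.
  rewrite -[RHS](@integral_normalN R (fun z => f z + g z) tfg.1 fg0).
  by apply: eq_integral => z _; rewrite gN.
by rewrite !cubic_growth_RintD// => /addIr.
Qed.

Lemma normal_mean0 : \int[N]_z z = 0.
Proof.
have t1 := @cubic_growth_id R; have m3 := normal_third_moment_finite.
have := normal_sym t1; under eq_Rintegral do rewrite -mulN1r.
by rewrite (cubic_growth_RintZ m3 _ t1) => e; lra.
Qed.

Lemma normal_x3 : \int[N]_z (z ^+ 3) = 0.
Proof.
have t3 := @cubic_growthX R 3 isT; have m3 := normal_third_moment_finite.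
have := normal_sym t3; under eq_Rintegral do rewrite exprNn -signr_odd/= expr1.
by rewrite (cubic_growth_RintZ m3 _ t3) => e; lra.
Qed.

(* The variance is identified by minimality: [s - 1 + (s ^- 2 - 1) * m2 / 2] is
   nonnegative for every [s > 0] and vanishes at [s = 1]. *)
Lemma normal_var1 : \int[N]_z (z ^+ 2) = 1.
Proof.
have m3 := normal_third_moment_finite; have t2 := @cubic_growthX R 2 isT.
set m2 := \int[N]_z _.
have key s : 0 < s -> 1 - (s ^- 2 - 1) * m2 / 2 <= s.
  move=> s0; have [ie E] := normal_expR_sqr s0.
  have tk := cubic_growthZ ((s ^- 2 - 1) / 2) t2; have t1 := cubic_growth_cst (1 : R).
  have -> : 1 - (s ^- 2 - 1) * m2 / 2 = \int[N]_z (1 - (s ^- 2 - 1) / 2 * z ^+ 2).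
    by rewrite (cubic_growth_RintB m3 t1 tk) (cubic_growth_RintZ m3 _ t2) Rint_cst -/m2; ring.
  rewrite -{2}E; apply: le_Rintegral => //.
    exact: (cubic_growth_integrable m3 (cubic_growthB t1 tk)).
  by move=> z _; have := expR_ge1Dx (- (s ^- 2 - 1) * z ^+ 2 / 2); lra.
have key2 s : 0 < s -> 0 <= (s - 1) * (s ^+ 2 - (s + 1) * m2 / 2).
  move=> s0; have := key _ s0.
  have -> : 1 - (s ^- 2 - 1) * m2 / 2 = (s ^+ 2 - (1 - s ^+ 2) * m2 / 2) / s ^+ 2.
    by field; rewrite gt_eqF.
  by rewrite ler_pdivrMr ?exprn_gt0//; lra.
(* Dividing [key2] by [s - 1], with [s] just above and just below 1, gives the two inequalities up
   to [e]. *)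
apply/eqP; rewrite eq_le; apply/andP; split; apply/ler_addgt0Pl => e e0.
  have := key2 (1 + e / 2) _; rewrite addrAC subrr add0r pmulr_rge0; last by lra.
  have -> : 0 < 1 + e / 2 by lra.
  move=> /(_ isT) h.
  suff : (2 + e / 2) * m2 <= (2 + e / 2) * (e + 1) by rewrite ler_pM2l//; lra.
  have := sqr_ge0 e; lra.
have [e1|e1] := leP 1 e.
  by apply: (le_trans e1); rewrite lerDl; apply: Rintegral_ge0 => z _; exact: sqr_ge0.
have := key2 (1 - e / 2) _; rewrite addrAC subrr add0r nmulr_rge0; last by lra.
have -> : 0 < 1 - e / 2 by lra.
move=> /(_ isT) h.
suff : (2 - e / 2) * 1 <= (2 - e / 2) * (e + m2) by rewrite ler_pM2l//; lra.
have := sqr_ge0 e; nra.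
Qed.

Lemma bounded_nonneg_shift (f : R -> R) M x : (forall x, `|f x| <= M) -> 0 <= f x + M.
Proof. by move=> /(_ x); rewrite ler_norml => /andP[+ _]; lra. Qed.

Lemma normal_stable_bounded a b (f : R -> R) M : 0 < b -> a ^+ 2 + b ^+ 2 = 1 ->
  continuous f -> (forall x, `|f x| <= M) ->
  \int[N]_x \int[N]_y f (b * y + a * x) = \int[N]_x f x.
Proof.
move=> b0 ab cf fM; have tf := continuous_cubic_growth cf fM.
have m3 := normal_third_moment_finite.
have cg : continuous (fun x => f x + M).
  by move=> x; apply: cvgD; [exact: cf|exact: cvg_cst].
have := normal_stable b0 ab cg (fun x => bounded_nonneg_shift x fM).
have tM := cubic_growth_cst M.
have tb x : cubic_growth (fun y => f (b * y + a * x)) by exact: cubic_growth_affine.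
have inner x : (\int[N]_y (f (b * y + a * x) + M)%:E = (\int[N]_y f (b * y + a * x) + M)%:E)%E.
  rewrite -[X in _ = (_ + X)%:E](Rint_cst N) -cubic_growth_RintD// /Rintegral fineK//.
  by apply: integrable_fin_num => //; apply: (cubic_growth_integrable m3 (cubic_growthD (tb x) tM)).
under eq_integral do rewrite inner.
move=> /(congr1 fine) e.
have {}e : \int[N]_x (\int[N]_y f (b * y + a * x) + M) = \int[N]_x (f x + M) by exact: e.
move: e; rewrite !cubic_growth_RintD//; first by move=> /addIr.
have := cubic_growth_affine (a / b) 0 (cubic_growth_section m3 (cubic_growth_affine b 0 tf)).
congr cubic_growth; apply/funext => x; apply: eq_Rintegral => y _; congr f.
by field; rewrite gt_eqF.
Qed.

(** Density of the normal law with mean [a] and variance 1 with respect to the standard one. *)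
Definition normal_tilt a z : R := expR (a * z - a ^+ 2 / 2).

Lemma measurable_normal_tilt a : measurable_fun [set: R] (normal_tilt a).
Proof.
apply: measurableT_comp => //.
by apply: measurable_funB => //; exact: measurable_funM.
Qed.

Lemma normal_tilt_integrable a : N.-integrable [set: measurableTypeR R] (EFin \o normal_tilt a) /\
  \int[N]_z normal_tilt a z = 1.
Proof.
have E : (\int[N]_z (normal_tilt a z)%:E = 1)%E.
  have c1 : continuous (fun _ : R => 1 : R) by exact: cst_continuous.
  have := integral_normal_tilt a c1 (fun _ => ler01).
  under [in X in _ = X -> _]eq_integral do rewrite mul1r.
  by move=> <-; exact: integral_normalT.
split; last by rewrite /Rintegral E.
apply/integrableP; split; first by apply/measurable_EFinP; exact: measurable_normal_tilt.
under eq_integral do rewrite /= ger0_norm ?expR_ge0//.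
by rewrite [X in (X < _)%E]E ltry.
Qed.

Lemma normal_tilt_sqr a z : normal_tilt a z ^+ 2 = expR (a ^+ 2) * normal_tilt (2 * a) z.
Proof. by rewrite /normal_tilt -expRM_natl -expRD; congr expR; field. Qed.

Lemma normal_integrable_bounded_tilt a (k : R -> R) M : measurable_fun [set: R] k ->
  (forall x, `|k x| <= M) ->
  N.-integrable [set: measurableTypeR R] (EFin \o (fun z => k z * normal_tilt a z)).
Proof.
move=> mk kM; have [ti _] := normal_tilt_integrable a.
apply: le_integrable (integrableZl measurableT M ti) => //.
  by apply/measurable_EFinP; apply: measurable_funM => //; exact: measurable_normal_tilt.
move=> z _; rewrite /= lee_fin !normrM [`|normal_tilt a z|]ger0_norm ?expR_ge0//.
by rewrite ler_wpM2r ?expR_ge0// (le_trans (kM z))// ler_norm.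
Qed.

Lemma normal_tilt_bounded a (k : R -> R) M : continuous k -> (forall x, `|k x| <= M) ->
  \int[N]_z k (z + a) = \int[N]_z (k z * normal_tilt a z).
Proof.
move=> ck kM; have m3 := normal_third_moment_finite.
have mk : measurable_fun [set: R] k by exact: continuous_measurable_fun.
have tk := continuous_cubic_growth ck kM.
have cg : continuous (fun x => k x + M).
  by move=> x; apply: cvgD; [exact: ck|exact: cvg_cst].
have := integral_normal_tilt a cg (fun x => bounded_nonneg_shift x kM).
move=> /(congr1 fine) e.
have {}e : \int[N]_z (k (z + a) + M) = \int[N]_z (k z * normal_tilt a z + M * normal_tilt a z).
  rewrite [LHS]e; congr fine; apply: eq_integral => z _.
  by rewrite -mulrDl.
have [ti t1] := normal_tilt_integrable a.
have ikt := normal_integrable_bounded_tilt a mk kM.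
rewrite (RintegralD measurableT ikt (integrableZl measurableT M ti)) in e.
have tka : cubic_growth (fun z => k (z + a)).
  by apply: (@cubic_growth_affine_eq _ k _ 1 a) => // z; rewrite mul1r.
rewrite (cubic_growth_RintD m3 tka (cubic_growth_cst M)) Rint_cst in e.
by move: e; rewrite RintegralZl// t1 mulr1 => /addIr.
Qed.

Lemma expR_le_1D2x x : 0 <= x -> x <= 2^-1 -> expR x <= 1 + 2 * x.
Proof.
move=> x0 x1; have e1 := expR_ge1Dx (- x); have p := expR_gt0 x.
have : expR x * expR (- x) = 1 by rewrite -expRD subrr expR0.
have := ler_wpM2l (ltW p) e1; nra.
Qed.

(* Cauchy-Schwarz against the second moment [expR (a ^+ 2)] of the tilting density. *)
Lemma normal_tilt_L1 a : \int[N]_z `|1 - normal_tilt a z| <= 4 * `|a|.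
Proof.
have [ti t1] := normal_tilt_integrable a; have [ti2 t12] := normal_tilt_integrable (2 * a).
have mt := measurable_normal_tilt a.
have i1 : N.-integrable [set: measurableTypeR R] (EFin \o (fun=> 1 : R)).
  exact: finite_measure_integrable_cst.
have id : N.-integrable [set: measurableTypeR R] (EFin \o (fun z => `|1 - normal_tilt a z|)).
  exact: (integrable_norm (integrableB measurableT i1 ti)).
(* For [a ^+ 2 > 2^-1] the trivial bound 2 on the integral is already below [4 * |a|]. *)
have [a2|a2] := leP (a ^+ 2) 2^-1; last first.
  apply: (@le_trans _ _ 2); last first.
    have : 2^-1 < `|a| ^+ 2 by rewrite real_normK ?num_real.
    by have := normr_ge0 a; nra.
  apply: (@le_trans _ _ (\int[N]_z (1 + normal_tilt a z))).
    apply: le_Rintegral => //; first exact: (integrableD measurableT i1 ti).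
    move=> z _; apply: le_trans (ler_normB _ _) _.
    by rewrite normr1 [`|normal_tilt a z|]ger0_norm ?expR_ge0.
  by rewrite RintegralD// t1 Rint_cst.
have [->|a0] := eqVneq a 0.
  rewrite normr0 mulr0 (_ : (fun z => _) = (fun=> 0)) ?Rint_cst//.
  by apply/funext => z; rewrite /normal_tilt mul0r expr0n/= mul0r subr0 expR0 subrr normr0.
have b0 : 0 < `|a| by rewrite normr_gt0.
(* Cauchy-Schwarz is linearized pointwise as [|y| <= b / 2 + c * y ^+ 2]; the choice
   [c = 1 / (2 * b)] balances the terms, the second moment being of order [b ^+ 2]. *)
pose b := `|a|; pose c := (2 * b)^-1.
have c0 : 0 < c by rewrite invr_gt0 mulr_gt0.
have ic : N.-integrable [set: measurableTypeR R] (EFin \o (fun=> b / 2 + c)).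
  exact: finite_measure_integrable_cst.
have ict := integrableZl measurableT (- (2 * c)) ti.
have ict2 := integrableZl measurableT (c * expR (a ^+ 2)) ti2.
have iD := integrableD measurableT ic ict.
have E : \int[N]_z (b / 2 + c + (- (2 * c)) * normal_tilt a z +
    c * expR (a ^+ 2) * normal_tilt (2 * a) z) = b / 2 + c * (expR (a ^+ 2) - 1).
  rewrite (RintegralD measurableT iD ict2) (RintegralD measurableT ic ict) Rint_cst.
  rewrite (RintegralZl _ measurableT ti) (RintegralZl _ measurableT ti2) t1 t12; ring.
apply: (@le_trans _ _ (b / 2 + c * (expR (a ^+ 2) - 1))).
  rewrite -E; apply: le_Rintegral => //; first exact: (integrableD measurableT iD ict2).
  move=> z _; rewrite -mulrA -normal_tilt_sqr.
  have -> : b / 2 + c + - (2 * c) * normal_tilt a z + c * normal_tilt a z ^+ 2 =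
    b / 2 + c * `|1 - normal_tilt a z| ^+ 2 by rewrite real_normK ?num_real//; ring.
  have -> : b / 2 = c * b ^+ 2 by rewrite /c; field; rewrite gt_eqF.
  rewrite -mulrDr /c mulrC ler_pdivlMr ?mulr_gt0//.
  by have := sqr_ge0 (`|1 - normal_tilt a z| - b); lra.
have := expR_le_1D2x (sqr_ge0 a) a2.
rewrite -(real_normK (num_real a)) -/b => h.
have : c * (expR (b ^+ 2) - 1) <= c * (2 * b ^+ 2) by rewrite ler_pM2l//; lra.
have -> : c * (2 * b ^+ 2) = b by rewrite /c; field; rewrite gt_eqF.
rewrite -/b in b0; lra.
Qed.

(** The bound involves only the supremum of [k]: one order of smoothness is gained from the Gaussian
    density. *)
Lemma normal_shift_bound a (k : R -> R) M : continuous k -> (forall x, `|k x| <= M) ->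
  `|\int[N]_z k (z + a) - \int[N]_z k z| <= 4 * M * `|a|.
Proof.
move=> ck kM; have M0 : 0 <= M by exact: le_trans (kM 0).
have mk : measurable_fun [set: R] k by exact: continuous_measurable_fun.
have tk := continuous_cubic_growth ck kM.
have m3 := normal_third_moment_finite.
have ikt := normal_integrable_bounded_tilt a mk kM.
have ik := cubic_growth_integrable m3 tk.
have [ti _] := normal_tilt_integrable a.
have i1 : N.-integrable [set: measurableTypeR R] (EFin \o (fun=> 1 : R)).
  exact: finite_measure_integrable_cst.
have id : N.-integrable [set: measurableTypeR R] (EFin \o (fun z => `|1 - normal_tilt a z|)).
  exact: (integrable_norm (integrableB measurableT i1 ti)).
rewrite (normal_tilt_bounded a ck kM) -RintegralB//.
apply: (@le_trans _ _ (\int[N]_z (M * `|1 - normal_tilt a z|))); last first.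
  rewrite RintegralZl// (_ : 4 * M * `|a| = M * (4 * `|a|)); last by ring.
  by apply: ler_wpM2l => //; exact: normal_tilt_L1.
apply: le_trans (le_normr_Rintegral _ (integrableB measurableT ikt ik)) _ => //.
apply: le_Rintegral => //.
- exact: (integrable_norm (integrableB measurableT ikt ik)).
- exact: (integrableZl measurableT M id).
move=> z _; rewrite /= -[X in _ - X]mulr1 -mulrBr normrM distrC.
by rewrite ler_wpM2r.
Qed.

End standard_normal.

(** * Gaussian smoothing and the exchange of summands *)

Section gaussian_smoothing.
Context {R : realType}.
Implicit Types (f g : R -> R) (c s t x y z : R).
Local Notation N := (@std_normal R).

Lemma lipschitz_remainder f f1 c x h : der f f1 ->
  (forall x y, `|f1 x - f1 y| <= c * `|x - y|) ->
  `|f (x + h) - f x - h * f1 x| <= c * h ^+ 2.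
Proof.
move=> df f1c.
have c0 : 0 <= c by have := f1c 1 0; rewrite subr0 normr1 mulr1; apply: le_trans.
suff [k kh ->] : exists2 k, `|k - x| <= `|h| & f (x + h) - f x = h * f1 k.
  rewrite -mulrBr normrM -(real_normK (num_real h)) expr2 mulrCA ler_wpM2l//.
  by rewrite (le_trans (f1c _ _))// ler_wpM2l.
have [h0|h0|<-] := ltgtP 0 h.
- have [|k /andP[xk kx] e] := @der_mvt _ f f1 x (x + h) df; first by rewrite ltrDl.
  exists k; last by rewrite e [x + h]addrC addrK mulrC.
  by rewrite !gtr0_norm ?subr_gt0// lerBlDl ltW.
- have [|k /andP[xk kx] e] := @der_mvt _ f f1 (x + h) x df; first by rewrite gtrDl.
  exists k; first by rewrite !ltr0_norm ?subr_lt0//; lra.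
  by apply: oppr_inj; rewrite opprB e; ring.
- by exists x; [rewrite subrr normr0|rewrite addr0 subrr mul0r].
Qed.

Lemma lipschitz_of_der_bounded f f1 c : der f f1 -> (forall x, `|f1 x| <= c) ->
  forall x y, `|f x - f y| <= c * `|x - y|.
Proof.
move=> df f1c x y; wlog yx : x y / y < x => [H|].
  have [xy|yx|->] := ltgtP x y; [|exact: H|by rewrite !subrr normr0 mulr0].
  by rewrite distrC [`|x - y|]distrC; exact: H.
have [k _ ->] := der_mvt df yx.
by rewrite normrM ler_wpM2r.
Qed.

(** Landau-type interpolation: Taylor's formula with step 1 bounds [f2], and then [f1], by the
    supremum of [f] and [c]. *)
Lemma smooth3_bounds c f f1 f2 : smooth3 c f f1 f2 ->
  exists K, (forall x, `|f1 x| <= K) /\ (forall x, `|f2 x| <= K).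
Proof.
move=> [df df1 f2c [M fM]].
have M0 : 0 <= M by exact: le_trans (fM 0).
have c0 : 0 <= c by have := f2c 1 0; rewrite subr0 normr1 mulr1; apply: le_trans.
have f2K x : `|f2 x| <= 4 * M + c.
  have := second_difference_cubic x 1 df df1 f2c.
  have := fM (x + 1); have := fM (x - 1); have := fM x.
  rewrite !ler_norml normr1 expr1n => /andP[? ?] /andP[? ?] /andP[? ?] /andP[? ?].
  by apply/andP; split; lra.
exists (6 * M + c); split => x; last by have := f2K x; lra.
have := lipschitz_remainder x 1 df (lipschitz_of_der_bounded df1 f2K).
have := fM (x + 1); have := fM x.
rewrite !ler_norml expr1n => /andP[? ?] /andP[? ?] /andP[? ?].
by apply/andP; split; lra.
Qed.

Lemma lipschitz_continuous f c : (forall x y, `|f x - f y| <= c * `|x - y|) -> continuous f.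
Proof.
move=> fc x; have c0 : 0 <= c by have := fc 1 0; rewrite subr0 normr1 mulr1; apply: le_trans.
apply/cvgrPdist_le => e e0; near=> y.
apply: le_trans (fc _ _) _; apply: (@le_trans _ _ ((c + 1) * `|x - y|)).
  by rewrite ler_wpM2r// lerDl.
rewrite -ler_pdivlMl ?ltr_wpDl//; near: y; apply: cvgr_dist_le => //.
by rewrite mulr_gt0// invr_gt0 ltr_wpDl.
Unshelve. all: end_near. Qed.

(** The deviation [s = sqrt m] stands for [m] independent standard Gaussian summands, with [s = 0]
    for none. *)
Definition gauss_smooth s f x := \int[N]_z f (s * z + x).

Lemma gauss_smooth_der s f f1 c : der f f1 -> (forall x y, `|f1 x - f1 y| <= c * `|x - y|) ->
  cubic_growth f -> cubic_growth f1 -> der (gauss_smooth s f) (gauss_smooth s f1).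
Proof.
move=> df f1c tf tf1 x; apply: (@is_derive_quadratic_bound _ _ c) => h _.
have m3 := @normal_third_moment_finite R.
have ta f' y : cubic_growth f' -> cubic_growth (fun z => f' (s * z + y)).
  exact: cubic_growth_affine.
rewrite /gauss_smooth -(cubic_growth_RintZ m3 h (ta _ x tf1)) -addrA -opprD.
rewrite -(cubic_growth_RintD m3 (ta _ x tf) (cubic_growthZ h (ta _ x tf1))).
apply: cubic_growth_Rint_near => //; first exact: ta.
  by apply: cubic_growthD; [exact: ta|apply: cubic_growthZ; exact: ta].
by move=> z; rewrite opprD !addrA; exact: lipschitz_remainder.
Qed.

Lemma smooth3_gauss_smooth s c f f1 f2 : smooth3 c f f1 f2 ->
  smooth3 c (gauss_smooth s f) (gauss_smooth s f1) (gauss_smooth s f2).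
Proof.
move=> sf; have [K [f1K f2K]] := smooth3_bounds sf.
have [df df1 f2c [M fM]] := sf; have tf := smooth3_cubic_growth sf.
have m3 := @normal_third_moment_finite R.
have tf1 := continuous_cubic_growth (der_continuous df1) f1K.
have tf2 := continuous_cubic_growth (lipschitz_continuous f2c) f2K.
split.
- exact: (gauss_smooth_der s df (lipschitz_of_der_bounded df1 f2K)).
- exact: (gauss_smooth_der s df1 f2c).
- move=> x y; apply: cubic_growth_Rint_near => //; do ?exact: cubic_growth_affine.
  by move=> z; rewrite (le_trans (f2c _ _))// opprD addrACA subrr add0r.
- exists M => x; rewrite -[gauss_smooth s f x]subr0 -[X in _ - X](Rint_cst N).
  apply: cubic_growth_Rint_near => //; [exact: cubic_growth_affine|exact: cubic_growth_cst|].
  by move=> z; rewrite subr0.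
Qed.

(** The second difference is a first difference of the smoothed increment [k]. As [|k| <= c * |t|],
    shifting the Gaussian variable by [t / s] costs another factor [4 * |t| / s]. *)
Lemma gauss_smooth_second_difference s c f2 K x t : 0 < s -> 
  (forall x y, `|f2 x - f2 y| <= c * `|x - y|) -> (forall x, `|f2 x| <= K) ->
  `|gauss_smooth s f2 (x + t) + gauss_smooth s f2 (x - t) - 2 * gauss_smooth s f2 x| <=
    4 * c / s * t ^+ 2.
Proof.
move=> s0 f2c f2K; have cf := lipschitz_continuous f2c.
have tf2 := continuous_cubic_growth cf f2K.
have m3 := @normal_third_moment_finite R.
have ta y : cubic_growth (fun z => f2 (s * z + y)) by exact: cubic_growth_affine.
pose k z := f2 (s * z + x + t) - f2 (s * z + x).
have caff y : continuous (fun z => f2 (s * z + y)).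
  move=> z; apply: continuous_comp; last exact: cf.
  by have /der_continuous := der_comp_affine s y (@der_id R); apply.
have ck : continuous k.
  move=> z; apply: cvgB; last exact: caff.
  by under eq_fun do rewrite -addrA; rewrite /k -addrA; exact: caff.
have kM z : `|k z| <= c * `|t|.
  by rewrite (le_trans (f2c _ _))// addrAC subrr add0r.
have := normal_shift_bound (- (t / s)) ck kM.
have -> : \int[N]_z k z = gauss_smooth s f2 (x + t) - gauss_smooth s f2 x.
  rewrite -cubic_growth_RintB//; apply: eq_Rintegral => z _.
  by rewrite /k addrA.
have -> : \int[N]_z k (z + - (t / s)) = gauss_smooth s f2 x - gauss_smooth s f2 (x - t).
  rewrite -cubic_growth_RintB//; apply: eq_Rintegral => z _; rewrite /k.
  by congr (f2 _ - f2 _); field; rewrite gt_eqF.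
have -> : 4 * c / s * t ^+ 2 = 4 * (c * `|t|) * `|- (t / s)|.
  rewrite normrN normrM normfV (gtr0_norm s0) -(real_normK (num_real t)); field.
  by rewrite gt_eqF.
by rewrite -normrN; congr (`|_| <= _); ring.
Qed.

(** Both laws are symmetric with variance 1, so the quadratic approximation of the symmetrized [H]
    has the same mean under both and only the remainders count. *)
Lemma rademacher_normal_step H h2 x (B : R -> R) : cubic_growth H ->
  N.-integrable [set: measurableTypeR R] (EFin \o B) ->
  (forall y, `|(H (x + y) + H (x - y)) / 2 - H x - y ^+ 2 / 2 * h2| <= B y) ->
  `|\int[rademacher]_y H (x + y) - \int[N]_y H (x + y)| <= B 1 + \int[N]_y B y.
Proof.
move=> tH iB HB; have m3 := @normal_third_moment_finite R.
have t1 : cubic_growth (fun y => H (x + y)).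
  by apply: (@cubic_growth_affine_eq _ H _ 1 x) => // y; rewrite mul1r addrC.
have t2 : cubic_growth (fun y => H (x - y)).
  by apply: (@cubic_growth_affine_eq _ H _ (-1) x) => // y; rewrite mulN1r addrC.
have tX := @cubic_growthX R 2 isT.
have EN : \int[N]_y ((H (x + y) + H (x - y)) / 2) = \int[N]_y H (x + y).
  under eq_Rintegral do rewrite mulrC.
  rewrite (cubic_growth_RintZ m3 _ (cubic_growthD t1 t2)) (cubic_growth_RintD m3 t1 t2).
  by rewrite (normal_sym t1); field.
have tq : cubic_growth (fun y => H x + h2 / 2 * y ^+ 2).
  by apply: cubic_growthD; [exact: cubic_growth_cst|exact: cubic_growthZ].
have Eq : \int[N]_y (H x + h2 / 2 * y ^+ 2) = H x + h2 / 2.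
  rewrite cubic_growth_RintD//; [|exact: cubic_growth_cst|exact: cubic_growthZ].
  by rewrite Rint_cst cubic_growth_RintZ// normal_var1 mulr1.
have ts : cubic_growth (fun y => (H (x + y) + H (x - y)) / 2).
  have := cubic_growthZ 2^-1 (cubic_growthD t1 t2).
  by congr cubic_growth; apply/funext => y; rewrite mulrC.
have b1 : `|\int[N]_y H (x + y) - (H x + h2 / 2)| <= \int[N]_y B y.
  rewrite -EN -Eq -(cubic_growth_RintB m3 ts tq).
  have tb := cubic_growthB ts tq.
  have ib := cubic_growth_integrable m3 tb.
  apply: le_trans (le_normr_Rintegral _ ib) _ => //.
  apply: le_Rintegral => //; first exact: (integrable_norm ib).
  move=> y _; apply: le_trans (HB y); rewrite le_eqVlt; apply/orP; left; apply/eqP.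
  by congr (`|_|); ring.
have b2 : `|\int[rademacher]_y H (x + y) - (H x + h2 / 2)| <= B 1.
  rewrite rademacherE//; apply: le_trans (HB 1); rewrite le_eqVlt; apply/orP; left; apply/eqP.
  by congr (`|_|); ring.
rewrite [`|\int[N]_y _ - _|]distrC in b1.
by apply: le_trans (ler_distD (H x + h2 / 2) _ _) _; rewrite lerD.
Qed.

Lemma gauss_smoothS m c f f1 f2 x : smooth3 c f f1 f2 ->
  \int[N]_y gauss_smooth (Num.sqrt m%:R) f (x + y) = gauss_smooth (Num.sqrt m.+1%:R) f x.
Proof.
move=> sf; have [df _ _ [M fM]] := sf.
(* For [m = 0] the scale is 0, whereas the stability identity requires a positive one. *)
rewrite /gauss_smooth; case: m => [|m].
  apply: eq_Rintegral => y _; rewrite -[RHS](Rint_cst N); apply: eq_Rintegral => z _.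
  by rewrite sqrtr0 mul0r add0r sqrtr1 mul1r addrC.
set s := Num.sqrt m.+1%:R; set s1 := Num.sqrt m.+2%:R.
have s0 : 0 < s by rewrite sqrtr_gt0 ltr0n.
have s10 : 0 < s1 by rewrite sqrtr_gt0 ltr0n.
have ss : s ^+ 2 = m.+1%:R by rewrite sqr_sqrtr// ler0n.
have ss1 : s1 ^+ 2 = m.+1%:R + 1 by rewrite sqr_sqrtr ?ler0n// natr1.
have ab : s1^-1 ^+ 2 + (s / s1) ^+ 2 = 1.
  by rewrite exprMn exprVn ss ss1 -{1}[_^-1]mul1r -mulrDl addrC divff// -ss1 expf_neq0// gt_eqF.
have cf : continuous (fun w => f (s1 * w + x)).
  exact: der_continuous (der_comp_affine s1 x df).
have := normal_stable_bounded (divr_gt0 s0 s10) ab cf (fun w => fM (s1 * w + x)).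
move=> <-; apply: eq_Rintegral => y _; apply: eq_Rintegral => z _; congr f.
by field; rewrite gt_eqF.
Qed.

End gaussian_smoothing.

(** * Lindeberg exchange between Rademacher and Gaussian summands *)

Section lindeberg.
Context {R : realType}.
Implicit Types (f g : R -> R) (c s t x y z : R).
Local Notation N := (@std_normal R).

(** The first term pays for the step without smoothing. The second is [4 / 24] times the fourth
    moment contribution, doubled because [sqrt (m + 1) <= 2 * sqrt m] for [m >= 1]. *)
Definition lindeberg_const : R :=
  (1 + \int[N]_z (`|z| ^+ 3)) / 6 + (1 + \int[N]_z (z ^+ 4)) / 3.

Lemma normal_x4_ge0 : 0 <= \int[N]_z (z ^+ 4).
Proof. by apply: Rintegral_ge0 => z _; rewrite (_ : 4%N = (2 * 2)%N)// exprM sqr_ge0. Qed.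

Lemma normal_normx3_ge0 : 0 <= \int[N]_z (`|z| ^+ 3).
Proof. by apply: Rintegral_ge0 => z _; exact: normx3_ge0. Qed.

Lemma lindeberg_const_ge0 : 0 <= lindeberg_const.
Proof. by have := normal_x4_ge0; have := normal_normx3_ge0; rewrite /lindeberg_const; lra. Qed.

(** Makes the sum of the step costs telescope. *)
Lemma sqrt_step n : (Num.sqrt n.+1%:R)^-1 <= 2 * (Num.sqrt n.+1%:R - Num.sqrt n%:R) :> R.
Proof.
have a0 : 0 < Num.sqrt n.+1%:R :> R by rewrite sqrtr_gt0 ltr0n.
have b0 := sqrtr_ge0 (n%:R : R).
have : Num.sqrt n.+1%:R ^+ 2 = Num.sqrt n%:R ^+ 2 + 1 :> R.
  by rewrite !sqr_sqrtr ?ler0n// natr1.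
move: a0 b0; move: (Num.sqrt n.+1%:R) (Num.sqrt n%:R) => a b a0 b0 e.
rewrite -(ler_pM2l a0) divff ?gt_eqF//.
by have := sqr_ge0 (a - b); lra.
Qed.

(* With [m] Gaussian summands already in place the test function is smooth at scale
   [sqrt m]; the matching third moments then leave only a fourth order term. *)
Lemma gauss_smooth_step m c f f1 f2 x : 0 < c -> smooth3 c f f1 f2 ->
  `|\int[rademacher]_y gauss_smooth (Num.sqrt m%:R) f (x + y) -
     \int[N]_y gauss_smooth (Num.sqrt m%:R) f (x + y)| <=
    c * lindeberg_const / Num.sqrt m.+1%:R.
Proof.
move=> c0 sf; set G := gauss_smooth _ f; have sG := smooth3_gauss_smooth (Num.sqrt m%:R) sf.
have tG := smooth3_cubic_growth sG; have [dG dG1 G2c _] := sG.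
have m3 := @normal_third_moment_finite R.
have n3 := normal_normx3_ge0; have n4 := normal_x4_ge0.
have t3 := @cubic_growth_normx3 R.
(* With no Gaussian summand yet, the third order estimate serves for this single step. *)
rewrite {}/G in sG tG dG dG1 G2c *; case: m => [|m] in sG tG dG dG1 G2c *.
  have iB := cubic_growth_integrable m3 (cubic_growthZ (c / 6) t3).
  have := rademacher_normal_step tG iB (h2 := gauss_smooth (Num.sqrt 0%:R) f2 x) (x := x).
  rewrite sqrtr1 divr1 (cubic_growth_RintZ m3 _ t3) normr1 expr1n mulr1.
  move=> h; apply: (le_trans (h _)).
    by move=> y; rewrite [c / 6 * _]mulrAC; exact: (second_difference_cubic _ _ dG dG1 G2c).
  have -> : c / 6 + c / 6 * \int[N]_z (`|z| ^+ 3) = c * ((1 + \int[N]_z (`|z| ^+ 3)) / 6) by ring.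
  by rewrite ler_pM2l// /lindeberg_const lerDl; lra.
set s := Num.sqrt m.+1%:R in sG tG dG dG1 G2c *.
have s0 : 0 < s by rewrite sqrtr_gt0 ltr0n.
have [K [_ f2K]] := smooth3_bounds sf; have [_ _ f2c _] := sf.
have iB := integrableZl measurableT (4 * c / s / 24) (@normal_integrable4 R).
have := rademacher_normal_step (B := fun z => 4 * c / s / 24 * z ^+ 4) tG iB
  (h2 := gauss_smooth s f2 x) (x := x).
rewrite (RintegralZl _ measurableT (@normal_integrable4 R)) expr1n mulr1 => h.
apply: (le_trans (h _)).
  move=> y; rewrite [_ / 24 * _]mulrAC.
  apply: (second_difference_quartic _ dG dG1).
  by move=> t; exact: gauss_smooth_second_difference.
set s1 := Num.sqrt m.+2%:R; have s10 : 0 < s1 by rewrite sqrtr_gt0 ltr0n.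
have ss : s1 <= 2 * s.
  rewrite -(@ler_pXn2r _ 2) ?nnegrE ?mulr_ge0 ?ltW// exprMn !sqr_sqrtr ?ler0n//.
  by rewrite -[m.+2%:R]natr1; have := ler0n R m; rewrite -[m.+1%:R]natr1; lra.
set n := \int[N]_z (z ^+ 4) in n4 *.
have -> : 4 * c / s / 24 + 4 * c / s / 24 * n = c * (1 + n) / 6 / s by field; rewrite gt_eqF.
rewrite ler_pdivrMr// [_ / s1 * _]mulrAC ler_pdivlMr//.
have A0 : 0 <= c * (1 + n) / 6 by rewrite divr_ge0// mulr_ge0 ?(ltW c0)// addr_ge0.
apply: (@le_trans _ _ (c * (1 + n) / 6 * (2 * s))); first by rewrite ler_wpM2l.
have -> : c * (1 + n) / 6 * (2 * s) = c * ((1 + n) / 3) * s by field.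
by rewrite ler_pM2r// ler_pM2l// /lindeberg_const -/n; lra.
Qed.

(** The total [m + k] is preserved: each step trades the last Rademacher summand for a Gaussian one,
    so [m] varies in the induction. *)
Lemma lindeberg_exchange k m c f f1 f2 : 0 < c -> smooth3 c f f1 f2 ->
  `|\int[conv_pow rademacher k]_x gauss_smooth (Num.sqrt m%:R) f x -
    gauss_smooth (Num.sqrt (m + k)%:R) f 0| <=
  2 * (c * lindeberg_const) * (Num.sqrt (m + k)%:R - Num.sqrt m%:R).
Proof.
move=> c0 sf; have D0 := mulr_ge0 (ltW c0) lindeberg_const_ge0.
have tG n := smooth3_cubic_growth (smooth3_gauss_smooth (Num.sqrt n%:R) sf).
elim: k m => [|k IH] m /=.
  by rewrite addn0 Rintegral_dirac ?subrr ?normr0 ?mulr0//; case: (tG m).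
have m3 := @rademacher_third_moment_finite R.
have m3k := third_moment_finite_conv_pow k m3.
rewrite (Rintegral_conv m3k m3 (tG m)).
have := IH m.+1; rewrite addSnnS => h.
apply: le_trans (ler_distD (\int[conv_pow rademacher k]_x gauss_smooth (Num.sqrt m.+1%:R) f x) _ _) _.
have -> : 2 * (c * lindeberg_const) * (Num.sqrt (m + k.+1)%:R - Num.sqrt m%:R) =
  2 * (c * lindeberg_const) * (Num.sqrt m.+1%:R - Num.sqrt m%:R) +
  2 * (c * lindeberg_const) * (Num.sqrt (m + k.+1)%:R - Num.sqrt m.+1%:R) by ring.
apply: lerD h; apply: cubic_growth_Rint_near => //; first exact: cubic_growth_section.
move=> x; rewrite -(gauss_smoothS m x sf).
apply: le_trans (gauss_smooth_step m x c0 sf) _.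
have := ler_wpM2l D0 (sqrt_step m); lra.
Qed.

Lemma rademacher_normal_bound n c f f1 f2 : 0 < c -> smooth3 c f f1 f2 ->
  `|\int[conv_pow rademacher n]_x f x - \int[N]_x f (Num.sqrt n%:R * x)| <=
  2 * (c * lindeberg_const) * Num.sqrt n%:R.
Proof.
move=> c0 sf; have := lindeberg_exchange n 0 c0 sf.
rewrite add0n sqrtr0 subr0; congr (`|_ - _| <= _).
  apply: eq_Rintegral => x _; rewrite -[RHS](Rint_cst N).
  by apply: eq_Rintegral => z _; rewrite mul0r add0r.
by apply: eq_Rintegral => z _; rewrite addr0.
Qed.

End lindeberg.

(** * The Zolotarev distance *)

Section sine_test_functions.
Context {R : realType}.
Implicit Types (x y : R).

Lemma der_sin : der (@sin R) (@cos R). Proof. by move=> x; exact: is_derive_sin. Qed.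

Lemma der_cos : der (@cos R) (fun x => - sin x). Proof. by move=> x; exact: is_derive_cos. Qed.

(** Each estimate follows from the one two orders lower by integrating twice, starting from
    [sin <= 1] and [cos <= 1]. *)
Lemma sin_taylor_ge0 x : 0 <= x ->
  [/\ 0 <= x - sin x, x - sin x <= x ^+ 3 / 6 & x ^+ 3 / 6 - x ^+ 4 / 24 <= x - sin x].
Proof.
have d1 : der (fun x : R => x - sin x) (fun x => 1 - cos x).
  by apply: derB; [exact: der_id|exact: der_sin].
have le1 y : 0 <= y -> 0 <= y - sin y.
  move=> y0; have := @der_ge0 _ _ _ 0 y d1 y0; rewrite sin0 subrr; apply => z _.
  by rewrite subr_ge0 cos_le1.
have dX c n : der (fun x : R => c * x ^+ n) (fun x => c * (n%:R * x ^+ n.-1)).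
  by apply: derZ; exact: derX.
have le2 y : 0 <= y -> 0 <= 2^-1 * y ^+ 2 - (y - sin y).
  apply: (@der2_ge0 R (fun y => 2^-1 * y ^+ 2 - (y - sin y)) (fun y => 2^-1 * (2%:R * y ^+ 1) - (1 - cos y)) (fun y => 1 - sin y)).
  - exact: derB (dX _ _) d1.
  - apply: eq_der.
      apply: derB; first by apply: derZ; exact: dX.
      by apply: derB; [exact: der_cst|exact: der_cos].
    by move=> z /=; rewrite expr0; field.
  - by rewrite sin0; ring.
  - by rewrite cos0; ring.
  - by move=> z _; rewrite subr_ge0 sin_le1.
have le3 y : 0 <= y -> 0 <= 6^-1 * y ^+ 3 - (y - sin y).
  apply: (@der2_ge0 R (fun y => 6^-1 * y ^+ 3 - (y - sin y)) (fun y => 6^-1 * (3%:R * y ^+ 2) - (1 - cos y)) (fun y => y - sin y)).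
  - exact: derB (dX _ _) d1.
  - apply: eq_der.
      apply: derB; first by apply: derZ; exact: dX.
      by apply: derB; [exact: der_cst|exact: der_cos].
    by move=> z /=; field.
  - by rewrite sin0; ring.
  - by rewrite cos0; ring.
  - exact: le1.
have le4 y : 0 <= y -> 0 <= 24^-1 * y ^+ 4 - 6^-1 * y ^+ 3 + (y - sin y).
  apply: (@der2_ge0 R (fun y => 24^-1 * y ^+ 4 - 6^-1 * y ^+ 3 + (y - sin y)) (fun y => 24^-1 * (4%:R * y ^+ 3) - 6^-1 * (3%:R * y ^+ 2) + (1 - cos y))
    (fun y => 2^-1 * y ^+ 2 - (y - sin y))).
  - exact: derD (derB (dX _ _) (dX _ _)) d1.
  - apply: eq_der.
      apply: derD; first by apply: derB; apply: derZ; exact: dX.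
      by apply: derB; [exact: der_cst|exact: der_cos].
    by move=> z /=; field.
  - by rewrite sin0; ring.
  - by rewrite cos0; ring.
  - exact: le2.
by move=> x0; have := le1 _ x0; have := le3 _ x0; have := le4 _ x0; split; lra.
Qed.

Lemma sin_taylor x : `|x - sin x| <= `|x| ^+ 3 / 6 /\
  `|x - sin x - x ^+ 3 / 6| <= `|x| ^+ 4 / 24.
Proof.
wlog x0 : x / 0 <= x => [H|].
  have [x0|x0] := leP 0 x; first exact: H.
  have := H (- x); rewrite oppr_ge0 (ltW x0) normrN sinN => /(_ isT).
  have -> : - x - - sin x = - (x - sin x) by ring.
  have -> : - (x - sin x) - (- x) ^+ 3 / 6 = - (x - sin x - x ^+ 3 / 6) by ring.
  by rewrite !normrN.
have [a b c] := sin_taylor_ge0 x0; rewrite (ger0_norm x0) (ger0_norm a); split => //.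
have x4 : 0 <= x ^+ 4 by rewrite exprn_ge0.
by rewrite ler_norml; apply/andP; split; lra.
Qed.

(** The third derivative is [cos (x / k)], so the constant is 1 for every [k], however large the
    amplitude. *)
Lemma smooth3_sin k : 0 < k ->
  smooth3 1 (fun x : R => - k ^+ 3 * sin (k^-1 * x + 0)) (fun x => - k ^+ 2 * cos (k^-1 * x + 0))
    (fun x => k * sin (k^-1 * x + 0)).
Proof.
move=> k0; have kn0 : k != 0 by rewrite gt_eqF.
have d3 : der (fun x : R => k * sin (k^-1 * x + 0)) (fun x => cos (k^-1 * x + 0)).
  apply: eq_der; first by apply: derZ; exact: der_comp_affine der_sin.
  by move=> x /=; rewrite mulrA divff// mul1r.
split.
- apply: eq_der; first by apply: derZ; exact: der_comp_affine der_sin.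
  by move=> x /=; field.
- apply: eq_der; first by apply: derZ; exact: der_comp_affine der_cos.
  by move=> x /=; field.
- by apply: (lipschitz_of_der_bounded d3) => x; exact: cos_max.
- exists (k ^+ 3) => x; rewrite normrM normrN (ger0_norm (exprn_ge0 _ (ltW k0))).
  by rewrite ler_piMr ?sin_max// exprn_ge0// ltW.
Qed.

End sine_test_functions.

Section zolotarev_distance.
Context {R : realType}.
Implicit Types (P Q S : law R) (f : R -> R) (rho : R).
Local Notation N := (@std_normal R).

Lemma F3oo_smooth3 f : F3oo f -> smooth3 1 f f^`()%classic f^`(2)%classic.
Proof.
move=> [[M fM] d1 d2 _ lip]; split; last by exists M.
- by move=> x; rewrite derive1E; exact: derivableP.
- by move=> x; rewrite derive1nS derive1n1 derive1E; exact: derivableP.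
- by move=> x y; rewrite mul1r.
Qed.

Lemma smooth3_F3oo f f1 f2 : smooth3 1 f f1 f2 -> F3oo f.
Proof.
move=> [df df1 f2c [M fM]].
have E1 : f^`()%classic = f1.
  by apply/funext => x; rewrite derive1E (@derive_val _ _ _ _ _ _ _ (df x)).
have E2 : f^`(2)%classic = f2.
  by apply/funext => x; rewrite derive1nS derive1n1 E1 derive1E (@derive_val _ _ _ _ _ _ _ (df1 x)).
split.
- by exists M.
- by move=> x; have [] := df x.
- by move=> x; rewrite E1; have [] := df1 x.
- by rewrite E2; exact: lipschitz_continuous f2c.
- by move=> x y; rewrite E2 (le_trans (f2c _ _))// mul1r.
Qed.

Lemma zeta3_ge P Q f : F3oo f -> ((`|\int[P]_x f x - \int[Q]_x f x|)%:E <= zeta3 P Q)%E.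
Proof. by move=> Ff; apply: ereal_sup_ubound; exists f. Qed.

Lemma zeta3_le P Q (C : \bar R) :
  (forall f, F3oo f -> (`|\int[P]_x f x - \int[Q]_x f x|)%:E <= C)%E -> (zeta3 P Q <= C)%E.
Proof. by move=> fC; apply: ge_ereal_sup => _ [f Ff <-]; exact: fC. Qed.

Lemma zeta3_ge0 P Q : (0 <= zeta3 P Q)%E.
Proof.
apply: le_trans (zeta3_ge P Q (@smooth3_F3oo (fun=> 0) (fun=> 0) (fun=> 0) _)).
  by rewrite lee_fin.
by split; [exact: der_cst|exact: der_cst|move=> x y; rewrite subrr normr0 mul1r|
  exists 0 => x; rewrite normr0].
Qed.

Lemma F3oo_rescale n f : (0 < n)%N -> F3oo f ->
  exists f1 f2, smooth3 ((Num.sqrt n%:R)^-1 ^+ 3) (fun x => f (x / Num.sqrt n%:R)) f1 f2.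
Proof.
move=> n0 /F3oo_smooth3 sf.
have s0 : 0 < (Num.sqrt n%:R)^-1 :> R by rewrite invr_gt0 sqrtr_gt0 ltr0n.
have := smooth3_affine 0 s0 sf; rewrite mul1r => h.
exists (fun x => (Num.sqrt n%:R)^-1 * f^`()%classic ((Num.sqrt n%:R)^-1 * x + 0)),
  (fun x => (Num.sqrt n%:R)^-1 * ((Num.sqrt n%:R)^-1 * f^`(2)%classic ((Num.sqrt n%:R)^-1 * x + 0))).
have -> : (fun x => f (x / Num.sqrt n%:R)) = (fun x => f ((Num.sqrt n%:R)^-1 * x + 0)).
  by apply/funext => x; rewrite addr0 mulrC.
exact: h.
Qed.

Lemma F3oo_cubic_growth f : F3oo f -> cubic_growth f.
Proof. by move=> /F3oo_smooth3; exact: smooth3_cubic_growth. Qed.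

Lemma F3oo_conv_pow_bound P n f : P3 P -> (0 < n)%N -> F3oo f ->
  `|\int[standardize (conv_pow P n)]_x f x - \int[standardize (binomial_half n)]_x f x|
    <= Bfun (varrho P) / (6 * Num.sqrt n%:R).
Proof.
move=> PP n0 Ff; have tf := F3oo_cubic_growth Ff.
have s0 : 0 < Num.sqrt n%:R :> R by rewrite sqrtr_gt0 ltr0n.
have [f1 [f2 sf]] := F3oo_rescale n0 Ff.
rewrite standardize_conv_powE// standardize_binomial_halfE//.
apply: (le_trans (conv_pow_rademacher_bound n (standardized_standardize PP) sf _)).
  by rewrite exprn_gt0// invr_gt0.
rewrite -varrho_standardize// -[X in X * _](sqr_sqrtr (ler0n R n)) le_eqVlt.
by apply/orP; left; apply/eqP; field; rewrite gt_eqF.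
Qed.

Lemma F3oo_binomial_bound n f : (0 < n)%N -> F3oo f ->
  `|\int[standardize (binomial_half n)]_x f x - \int[N]_x f x| <= 2 * lindeberg_const / n%:R.
Proof.
move=> n0 Ff; have tf := F3oo_cubic_growth Ff.
have s0 : 0 < Num.sqrt n%:R :> R by rewrite sqrtr_gt0 ltr0n.
have [f1 [f2 sf]] := F3oo_rescale n0 Ff.
rewrite standardize_binomial_halfE//.
have := rademacher_normal_bound n (_ : 0 < (Num.sqrt n%:R)^-1 ^+ 3) sf.
rewrite exprn_gt0 ?invr_gt0// => /(_ isT).
under [X in `|_ - X| <= _ -> _]eq_Rintegral do rewrite [Num.sqrt _ * _]mulrC mulfK ?gt_eqF//.
move/le_trans; apply; rewrite -[X in _ <= _ / X](sqr_sqrtr (ler0n R n)) le_eqVlt.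
by apply/orP; left; apply/eqP; field; rewrite gt_eqF.
Qed.

Lemma eps_le n : (0 < n)%N -> (eps n <= (2 * lindeberg_const / n%:R : R)%:E)%E.
Proof. by move=> n0; apply: zeta3_le => f Ff; rewrite lee_fin F3oo_binomial_bound. Qed.

Lemma eps_fin_num n : (0 < n)%N -> (eps n : \bar R) \is a fin_num.
Proof.
move=> n0; rewrite ge0_fin_numE; last exact: zeta3_ge0.
by rewrite (le_lt_trans (eps_le n0))// ltry.
Qed.

Lemma zeta3_conv_pow_le P n : P3 P -> (0 < n)%N ->
  (zeta3 (standardize (conv_pow P n)) N <=
    (Bfun (varrho P) / (6 * Num.sqrt n%:R))%:E + eps n)%E.
Proof.
move=> PP n0; apply: zeta3_le => f Ff.
have := F3oo_conv_pow_bound PP n0 Ff; rewrite -lee_fin => b.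
apply: le_trans (leeD b (zeta3_ge (standardize (binomial_half n)) N Ff)).
by rewrite -EFinD lee_fin ler_distD.
Qed.

(** The triangle inequality in the reverse direction, which supplies the lower half of the limit for
    [rho -> 1]. *)
Lemma eps_le_zeta3_conv_pow P n : P3 P -> (0 < n)%N ->
  (eps n <= (Bfun (varrho P) / (6 * Num.sqrt n%:R))%:E +
    zeta3 (standardize (conv_pow P n)) N)%E.
Proof.
move=> PP n0; apply: zeta3_le => f Ff.
have := F3oo_conv_pow_bound PP n0 Ff; rewrite distrC -lee_fin => b.
apply: le_trans (leeD b (zeta3_ge (standardize (conv_pow P n)) N Ff)).
by rewrite -EFinD lee_fin ler_distD.
Qed.

(** Dominated convergence with majorant [|x|^3 / 6]; pointwise the error is at most [|x|^4 / 24]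
    divided by the scale. *)
Lemma sine_test_cvg S : third_moment_finite S ->
  \int[S]_x (n.+1%:R ^+ 2 * x - n.+1%:R ^+ 3 * sin (n.+1%:R^-1 * x + 0)) @[n --> \oo] -->
  \int[S]_x (x ^+ 3 / 6).
Proof.
move=> m3S; pose h n x : R := n.+1%:R ^+ 2 * x - n.+1%:R ^+ 3 * sin (n.+1%:R^-1 * x + 0).
have kn0 n : n.+1%:R != 0 :> R by rewrite pnatr_eq0.
have hE n x : h n x = n.+1%:R ^+ 3 * (n.+1%:R^-1 * x - sin (n.+1%:R^-1 * x)).
  by rewrite /h addr0; move: (kn0 n); move: (n.+1%:R) => k kn; field.
have k0 n : 0 < n.+1%:R ^+ 3 :> R by rewrite exprn_gt0.
have h1 n x : `|h n x| <= 6^-1 * `|x| ^+ 3.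
  rewrite hE normrM (gtr0_norm (k0 n)).
  have [+ _] := sin_taylor (n.+1%:R^-1 * x); rewrite -(ler_pM2l (k0 n)) => /le_trans; apply.
  rewrite normrM (gtr0_norm (_ : 0 < n.+1%:R^-1)) ?invr_gt0// le_eqVlt; apply/orP; left.
  by apply/eqP; move: (kn0 n); move: (n.+1%:R) => k kn; field.
have h2 n x : `|x ^+ 3 / 6 - h n x| <= `|x| ^+ 4 / 24 * n.+1%:R^-1.
  rewrite hE distrC.
  have -> : n.+1%:R ^+ 3 * (n.+1%:R^-1 * x - sin (n.+1%:R^-1 * x)) - x ^+ 3 / 6 =
    n.+1%:R ^+ 3 * (n.+1%:R^-1 * x - sin (n.+1%:R^-1 * x) - (n.+1%:R^-1 * x) ^+ 3 / 6).
    by move: (kn0 n); move: (n.+1%:R) => k kn; field.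
  rewrite normrM (gtr0_norm (k0 n)).
  have [_] := sin_taylor (n.+1%:R^-1 * x); rewrite -(ler_pM2l (k0 n)) => /le_trans; apply.
  rewrite normrM (gtr0_norm (_ : 0 < n.+1%:R^-1)) ?invr_gt0// le_eqVlt; apply/orP; left.
  by apply/eqP; move: (kn0 n); move: (n.+1%:R) => k kn; field.
have mh n : measurable_fun [set: R] (h n).
  apply: measurable_funB; first exact: measurable_funM.
  apply: measurable_funM => //; apply: continuous_measurable_fun.
  exact: der_continuous (der_comp_affine _ 0 der_sin).
have tb := cubic_growthZ 6^-1 (@cubic_growth_normx3 R).
have t3 : cubic_growth (fun x : R => x ^+ 3 / 6).
  have := cubic_growthZ 6^-1 (@cubic_growthX R 3 isT).
  by congr cubic_growth; apply/funext => x; rewrite mulrC.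
have pc x : h n x @[n --> \oo] --> x ^+ 3 / 6.
  have hc : harmonic n * (`|x| ^+ 4 / 24) @[n --> \oo] --> (0 : R).
    by rewrite -[X in _ --> X](mul0r (`|x| ^+ 4 / 24)); apply: cvgM; [exact: cvg_harmonic|exact: cvg_cst].
  apply/cvgrPdist_le => e e0; near=> n; apply: (le_trans (h2 n x)).
  have : `|0 - harmonic n * (`|x| ^+ 4 / 24)| <= e by near: n; move/cvgrPdist_le : hc; apply.
  rewrite sub0r normrN mulrC; apply: le_trans; exact: ler_norm.
have ib := cubic_growth_integrable m3S tb.
have := @dominated_cvg _ _ _ S setT measurableT (fun n => EFin \o h n)
  (fun x => (x ^+ 3 / 6)%:E) (fun x => (6^-1 * `|x| ^+ 3)%:E).
move=> /(_ _ _ _ ib) dc.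
have fin : (\int[S]_x (x ^+ 3 / 6)%:E)%E \is a fin_num.
  by apply: integrable_fin_num => //; exact: (cubic_growth_integrable m3S t3).
rewrite /Rintegral; apply: fine_cvg; rewrite fineK//; apply: dc.
- by move=> n; apply/measurable_EFinP; exact: mh.
- by move=> x _; apply/cvg_EFin; [exact: nearW|exact: pc].
- by [].
- by move=> n x _; rewrite lee_fin.
Unshelve. all: by end_near. Qed.

End zolotarev_distance.

(** * The cubic lower bound and the limit along [P_rho] *)

Section cubic_lower_bound.
Context {R : realType}.
Implicit Types (P Q S : law R) (rho : R).
Local Notation N := (@std_normal R).

(* [x ^+ 3 / 6] is unbounded, but it is the limit of the admissible functions
   [- k ^+ 3 * sin (x / k)] up to a linear term, on which laws of equal mean agree. *)
Lemma zeta3_ge_cube P Q : third_moment_finite P -> third_moment_finite Q ->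
  \int[P]_x x = \int[Q]_x x ->
  ((`|\int[P]_x (x ^+ 3 / 6) - \int[Q]_x (x ^+ 3 / 6)|)%:E <= zeta3 P Q)%E.
Proof.
move=> m3P m3Q PQ.
pose h n x : R := n.+1%:R ^+ 2 * x - n.+1%:R ^+ 3 * sin (n.+1%:R^-1 * x + 0).
have a_le n : ((`|\int[P]_x h n x - \int[Q]_x h n x|)%:E <= zeta3 P Q)%E.
  have sf := @smooth3_sin R n.+1%:R (ltr0Sn _ _).
  have tf := smooth3_cubic_growth sf.
  have t1 := cubic_growthZ (n.+1%:R ^+ 2) (@cubic_growth_id R).
  have E S : third_moment_finite S -> \int[S]_x h n x =
      n.+1%:R ^+ 2 * \int[S]_x x + \int[S]_x (- n.+1%:R ^+ 3 * sin (n.+1%:R^-1 * x + 0)).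
    move=> m3S; rewrite -(cubic_growth_RintZ m3S _ (@cubic_growth_id R)).
    rewrite -(cubic_growth_RintD m3S t1 tf).
    by apply: eq_Rintegral => x _; rewrite /h mulNr.
  rewrite !E// PQ opprD addrACA subrr add0r.
  exact: zeta3_ge (smooth3_F3oo sf).
have c : `|\int[P]_x h n x - \int[Q]_x h n x| @[n --> \oo] -->
    `|\int[P]_x (x ^+ 3 / 6) - \int[Q]_x (x ^+ 3 / 6)|.
  by apply: cvg_norm; apply: cvgB; exact: sine_test_cvg.
have := zeta3_ge0 P Q; case: (zeta3 P Q) a_le => [z||//] a_le _; last by rewrite leey.
rewrite lee_fin; apply/ler_addgt0Pl => e e0.
move/cvgrPdist_le : c => /(_ e e0)[n _ /(_ n (leqnn n))] /= le_e.
have := a_le n; rewrite lee_fin => az.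
move: le_e; rewrite ler_norml => /andP[_]; rewrite lerBlDr => /le_trans; apply.
by rewrite lerD2l.
Qed.

Lemma P_P3 rho : 1 <= rho -> P3 (P_ rho).
Proof. by move=> rho1; have [] := standardized_P3 (standardized_P_ rho1). Qed.

Lemma varrho_P_ rho : 1 <= rho -> varrho (P_ rho) = rho.
Proof. by move=> rho1; have [_ ->] := standardized_P3 (standardized_P_ rho1); exact: P_normx3. Qed.

Lemma standardized_standardizeE P : standardized P -> forall f, cubic_growth f ->
  \int[standardize P]_x f x = \int[P]_x f x.
Proof.
move=> [m3P P1 P2] f tf; have mP : mean P = 0 by rewrite meanE.
rewrite (standardizeP m3P).2//; apply: eq_Rintegral => x _; rewrite stddevE// mP.
by under eq_Rintegral do rewrite subr0; rewrite P2 sqrtr1 subr0 divr1.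
Qed.

Lemma cubic_growth_cube : cubic_growth (fun x : R => x ^+ 3 / 6).
Proof.
have := cubic_growthZ 6^-1 (@cubic_growthX R 3 isT).
by congr cubic_growth; apply/funext => x; rewrite mulrC.
Qed.

Lemma normal_cube : \int[N]_x (x ^+ 3 / 6) = 0.
Proof.
under eq_Rintegral do rewrite mulrC.
rewrite (cubic_growth_RintZ normal_third_moment_finite _ (@cubic_growthX R 3 isT)).
by rewrite normal_x3 mulr0.
Qed.

Lemma P_conv_pow_cube rho k : 1 <= rho -> (0 < k)%N ->
  \int[standardize (conv_pow (P_ rho) k)]_x (x ^+ 3 / 6) = Bfun rho / (6 * Num.sqrt k%:R).
Proof.
move=> rho1 k0; have PP := P_P3 rho1; have sP := standardized_standardize PP.
have s0 : 0 < Num.sqrt k%:R :> R by rewrite sqrtr_gt0 ltr0n.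
have t3 := @cubic_growthX R 3 isT.
rewrite (standardize_conv_powE PP k0 cubic_growth_cube).
have -> : \int[conv_pow (standardize (P_ rho)) k]_x ((x / Num.sqrt k%:R) ^+ 3 / 6) =
    \int[conv_pow (standardize (P_ rho)) k]_x ((Num.sqrt k%:R ^- 3 / 6) * x ^+ 3).
  by apply: eq_Rintegral => x _; field; rewrite gt_eqF.
have m3s := third_moment_finite_conv_pow k (let: And3 m _ _ := sP in m).
rewrite (cubic_growth_RintZ m3s _ t3); have [_ _ ->] := conv_pow_moments k sP.
rewrite (standardized_standardizeE (standardized_P_ rho1) t3) P_x3//.
by rewrite -[X in _ * (X * _)](sqr_sqrtr (ler0n R k)); field; rewrite gt_eqF.
Qed.

Lemma sqrt_P_conv_pow_cube rho k : 1 <= rho -> (0 < k)%N ->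
  Bfun rho / 6 = Num.sqrt k%:R * `|\int[standardize (conv_pow (P_ rho) k)]_x (x ^+ 3 / 6)
                   - \int[N]_x (x ^+ 3 / 6)|.
Proof.
move=> rho1 k0; have s0 : 0 < Num.sqrt k%:R :> R by rewrite sqrtr_gt0 ltr0n.
rewrite P_conv_pow_cube// normal_cube subr0 ger0_norm; last first.
  by rewrite divr_ge0 ?Bfun_ge0// mulr_ge0// ltW.
by field; rewrite gt_eqF.
Qed.

Lemma zeta3_P_conv_pow_ge rho k : 1 <= rho -> (0 < k)%N ->
  ((Bfun rho / (6 * Num.sqrt k%:R))%:E <= zeta3 (standardize (conv_pow (P_ rho) k)) N)%E.
Proof.
move=> rho1 k0; have PP := P_P3 rho1; have sP := standardized_standardize PP.
have m3P := P3_third_moment_finite PP.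
have [m3s _] := standardizeP (third_moment_finite_conv_pow k m3P).
apply: le_trans (zeta3_ge_cube m3s normal_third_moment_finite _).
  by rewrite P_conv_pow_cube// normal_cube subr0 lee_fin ler_norm.
rewrite normal_mean0 (standardize_conv_powE PP k0 (@cubic_growth_id R)).
have m3c := third_moment_finite_conv_pow k (let: And3 m _ _ := sP in m).
under eq_Rintegral do rewrite mulrC.
rewrite (cubic_growth_RintZ m3c _ (@cubic_growth_id R)).
by have [-> _ _] := conv_pow_moments k sP; rewrite mulr0.
Qed.

Lemma zeta3_P_conv_pow_cvg rho : 1 <= rho ->
  ((Num.sqrt n%:R)%:E * zeta3 (standardize (conv_pow (P_ rho) n)) N)%E
    @[n --> \oo] --> (Bfun rho / 6)%:E.
Proof.
move=> rho1; have PP := P_P3 rho1; pose D : R := 2 * lindeberg_const.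
have D0 : 0 <= D by rewrite mulr_ge0// lindeberg_const_ge0.
pose g n := ((Num.sqrt n%:R)%:E * zeta3 (standardize (conv_pow (P_ rho) n)) N)%E.
(* The bounds hold for positive [n] only, hence the shifted sequence. *)
suff h : g n.+1 @[n --> \oo] --> (Bfun rho / 6)%:E by rewrite -(cvg_shiftS g); exact: h.
apply: (@squeeze_cvge nat \oo _ R (fun=> (Bfun rho / 6)%:E) (fun n => g n.+1)
  (fun n => (Bfun rho / 6 + D * (Num.sqrt n.+1%:R)^-1)%:E)).
- apply: nearW => n.
  have s0 : 0 < Num.sqrt n.+1%:R :> R by rewrite sqrtr_gt0 ltr0n.
  have sE : (0 <= (Num.sqrt n.+1%:R : R)%:E)%E by rewrite lee_fin ltW.
  apply/andP; split.
    have := zeta3_P_conv_pow_ge rho1 (ltn0Sn n).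
    move=> /(lee_wpmul2l sE) h; apply: le_trans h.
    by rewrite -EFinM lee_fin le_eqVlt; apply/orP; left; apply/eqP; field; rewrite gt_eqF.
  have := zeta3_conv_pow_le PP (ltn0Sn n); rewrite varrho_P_// => h1.
  have {h1} := le_trans h1 (leeD (lexx _) (eps_le (ltn0Sn n))).
  move=> /(lee_wpmul2l sE)/le_trans; apply.
  rewrite -EFinD -EFinM lee_fin -/D le_eqVlt; apply/orP; left; apply/eqP.
  by rewrite -[X in D / X](sqr_sqrtr (ler0n R n.+1)); field; rewrite gt_eqF.
- exact: cvg_cst.
- apply/cvg_EFin; first exact: nearW.
  rewrite -[X in _ --> X]addr0 -[X in _ --> _ + X](mulr0 D).
  apply: cvgD; first exact: cvg_cst.
  apply: cvgM; first exact: cvg_cst.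
  apply/cvgrPdist_le => e e0; near=> n.
  have s0 : 0 < Num.sqrt n.+1%:R :> R by rewrite sqrtr_gt0 ltr0n.
  rewrite sub0r normrN normfV (gtr0_norm s0) invf_ple ?posrE//.
  rewrite -(@ler_pXn2r _ 2) ?nnegrE ?ltW ?invr_gt0// sqr_sqrtr ?ler0n//.
  apply: (@le_lt_trans _ _ n%:R); last by rewrite ltr_nat.
  by near: n; exact: nbhs_infty_ger.
Unshelve. all: by end_near. Qed.

End cubic_lower_bound.

Unset Implicit Arguments.
Set Strict Implicit.
Set Printing Implicit Defensive.

Theorem theorem1p11 (R : realType) :
  [/\ (forall (P : law R) (n : nat), P3 P -> (0 < n)%N ->
        (zeta3 (standardize (conv_pow P n)) std_normal
          <= (Bfun (varrho P) / (6 * Num.sqrt n%:R))%:E + eps n)%E),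
      (forall rho : R, 1 <= rho ->
        [/\ P3 (P_ rho),
            varrho (P_ rho) = rho,
            ((Num.sqrt n%:R)%:E
               * zeta3 (standardize (conv_pow (P_ rho) n)) std_normal)%E
              @[n --> \oo] --> (Bfun rho / 6)%:E &
            forall k : nat, (0 < k)%N ->
              Bfun rho / 6 =
              Num.sqrt k%:R *
                `| \int[standardize (conv_pow (P_ rho) k)]_x (x ^+ 3 / 6)
                   - \int[std_normal]_x (x ^+ 3 / 6) | ]) &
      (forall n : nat, (0 < n)%N ->
        forall eta : R, 0 < eta ->
        exists2 delta : R, 0 < delta &
          forall P : law R, P3 P -> varrho P <= 1 + delta ->
          (`| zeta3 (standardize (conv_pow P n)) std_normal - eps n |
             <= eta%:E)%E) ].
Proof.
split.
- by move=> P n PP n0; exact: zeta3_conv_pow_le.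
- move=> rho rho1; split; [exact: P_P3|exact: varrho_P_|exact: zeta3_P_conv_pow_cvg|].
  by move=> k k0; exact: sqrt_P_conv_pow_cube.
- move=> n n0 eta eta0.
  have s0 : 0 < 6 * Num.sqrt n%:R :> R by rewrite mulr_gt0// sqrtr_gt0 ltr0n.
  have [delta delta0 Bdelta] := Bfun_near1 (mulr_gt0 eta0 s0).
  exists delta => // P PP Pdelta.
  have rho1 : 1 <= varrho P.
    by rewrite (varrho_standardize PP); exact: standardized_normx3_ge1 (standardized_standardize PP).
  have b : Bfun (varrho P) / (6 * Num.sqrt n%:R) <= eta.
    by rewrite ler_pdivrMr//; exact: Bdelta.
  have := zeta3_conv_pow_le PP n0; have := eps_le_zeta3_conv_pow PP n0.
  have := zeta3_ge0 (standardize (conv_pow P n)) std_normal.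
  have /fineK <- := @eps_fin_num R n n0; move: (fine (eps n)) => e.
  (* The value plus infinity contradicts the upper bound, and minus infinity contradicts
     nonnegativity. *)
  case: (zeta3 _ _) => [z||]//; rewrite -!EFinD !lee_fin => _ h1 h2.
  by rewrite ler_norml; apply/andP; split; lra.
Qed.
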